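(* Let $a\in C^1(\mathbf{R})$ and assume there exists $\beta\ge1$ such that for each $M>0$ there exists $\alpha_M>0$ with $$a'(v)-a'(w)\ge\alpha_M(v-w)^\beta\qquad\text{whenever } -M\le w<v\le M.$$ Let $\gamma\in\mathbf{N}$ and let $m$ be a signed Radon measure on $\mathbf{R}_+\times\mathbf{R}\times\mathbf{R}$. Assume $f\in L^\infty(\mathbf{R}_+\times\mathbf{R}\times\mathbf{R})$, $f\equiv f(t,x,v)$, satisfies in the sense of distributions $$(\partial_t+a'(v)\partial_x)f=\partial_v^\gamma m,$$ and that for each $y\in\mathbf{R}$ and each $s\ge0$, $$\big(f(t+s,x+y,v)-f(t,x,v)\big)\big(f(t+s,x+y,w)-f(t,x,w)\big)\ge0\quad\text{for a.e. }(t,x,v,w)\in\mathbf{R}_+\times\mathbf{R}\times\mathbf{R}\times\mathbf{R}.$$ Then for each $\psi\in C^\infty_c(\mathbf{R})$, $$\int_{\mathbf{R}}f(t,x,v)\psi(v)\,dv\in B^{s,2}_{\infty,loc}((0,\infty)\times\mathbf{R})\quad\text{with } s=\frac1{4+2\beta}.$$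
   Context: For an open set $\Omega\subset\mathbf{R}^2$, $0<s<1$ and $1\le p<\infty$, a function $g\in L^p_{loc}(\Omega)$ belongs to the local Besov space $B^{s,p}_{\infty,loc}(\Omega)$ if for every compact $K\subset\Omega$ there exist $C,h_0>0$ such that $\int_K|g(z+h)-g(z)|^p\,dz\le C|h|^{sp}$ for all $h\in\mathbf{R}^2$ with $|h|\le h_0$. *)

(* Defs.v *)
From HB Require Import structures.
From mathcomp Require Import all_boot all_order all_algebra.
From mathcomp Require Import all_classical all_reals all_analysis.
Import Order.TTheory GRing.Theory Num.Theory.
Import numFieldNormedType.Exports.
Local Open Scope classical_set_scope.
Local Open Scope ring_scope.

Set Implicit Arguments.
Unset Strict Implicit.
Unset Printing Implicit Defensive.

(* Lebesgue measure on R, R^2 = R*R, R^3 = (R*R)*R, R^4 = ((R*R)*R)*R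
   (product measures; points written (t,x), (t,x,v), (t,x,v,w)). *)
Definition leb (R : realType) := @lebesgue_measure R.
Arguments leb R : clear implicits.
Definition leb2 (R : realType) := (leb R \x leb R)%E.
Definition leb3 (R : realType) := ((leb R \x leb R) \x leb R)%E.
Definition leb4 (R : realType) := (((leb R \x leb R) \x leb R) \x leb R)%E.
Arguments leb2 R : clear implicits.
Arguments leb3 R : clear implicits.
Arguments leb4 R : clear implicits.

Definition Omega2 (R : realType) : set (R * R) := [set z | 0 < z.1].
Definition Omega3 (R : realType) : set (R * R * R) := [set p | 0 < p.1.1].
Arguments Omega2 R : clear implicits.
Arguments Omega3 R : clear implicits.

Definition norm2 (R : realType) (h : R * R) : R := Num.sqrt (h.1 ^+ 2 + h.2 ^+ 2).

Inductive dir := Dt | Dx | Dv.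

Definition pd (R : realType) (d : dir) (phi : R * R * R -> R) : R * R * R -> R :=
  fun p => match d with
  | Dt => derive1 (fun s => phi (s, p.1.2, p.2)) p.1.1
  | Dx => derive1 (fun s => phi (p.1.1, s, p.2)) p.1.2
  | Dv => derive1 (fun s => phi (p.1.1, p.1.2, s)) p.2
  end.

Definition pdable (R : realType) (d : dir) (phi : R * R * R -> R) (p : R * R * R) : Prop :=
  match d with
  | Dt => derivable (fun s => phi (s, p.1.2, p.2)) p.1.1 1
  | Dx => derivable (fun s => phi (p.1.1, s, p.2)) p.1.2 1
  | Dv => derivable (fun s => phi (p.1.1, p.1.2, s)) p.2 1
  end.

Definition iter_pd (R : realType) (ds : seq dir) (phi : R * R * R -> R) :=
  foldr (@pd R) phi ds.

Definition smooth3 (R : realType) (phi : R * R * R -> R) : Prop :=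
  forall ds : seq dir,
    continuous (iter_pd ds phi) /\ (forall d p, pdable d (iter_pd ds phi) p).

Definition test_fun3 (R : realType) (phi : R * R * R -> R) : Prop :=
  smooth3 phi /\
  exists K : set (R * R * R), [/\ compact K, K `<=` Omega3 R &
                                 forall p, ~ K p -> phi p = 0].

Definition test_fun1 (R : realType) (psi : R -> R) : Prop :=
  (forall (n : nat) (x : R), derivable (derive1n n psi) x 1) /\
  exists K : set R, compact K /\ forall v, ~ K v -> psi v = 0.

Definition radon3 (R : realType) (mu : {measure set (R * R * R) -> \bar R}) : Prop :=
  forall K : set (R * R * R), compact K -> K `<=` Omega3 R -> (mu K < +oo)%E.

Definition Linfty3 (R : realType) (f : R * R * R -> R) : Prop :=
  measurable_fun (Omega3 R) f /\
  exists C : R, {ae leb3 R, forall p, Omega3 R p -> `|f p| <= C}.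

(* (d_t + a'(v) d_x) f = d_v^gamma m  in D'((0,oo) x R x R),
   where the signed Radon measure is m = mu1 - mu2. *)
Definition kinetic_eq (R : realType) (a : R -> R) (gamma : nat)
    (mu1 mu2 : {measure set (R * R * R) -> \bar R}) (f : R * R * R -> R) : Prop :=
  forall phi : R * R * R -> R, test_fun3 phi ->
    - Rintegral (leb3 R) setT
        (fun p => f p * (pd Dt phi p + derive1 a p.2 * pd Dx phi p))
    = (-1) ^+ gamma *
      (Rintegral mu1 setT (iter_pd (nseq gamma Dv) phi)
       - Rintegral mu2 setT (iter_pd (nseq gamma Dv) phi)).

Definition besov_loc (R : realType) (s p : R) (Om : set (R * R)) (g : R * R -> R) : Prop :=
  [/\ measurable_fun Om g,
      (forall K : set (R * R), compact K -> K `<=` Om ->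
         (\int[leb2 R]_(z in K) (`|g z| `^ p)%:E < +oo)%E) &
      (forall K : set (R * R), compact K -> K `<=` Om ->
         exists C h0 : R, [/\ 0 < C, 0 < h0 &
           forall h : R * R, norm2 h <= h0 ->
             (\int[leb2 R]_(z in K) (`|g (z.1 + h.1, z.2 + h.2) - g z| `^ p)%:E
               <= (C * norm2 h `^ (s * p))%:E)%E])].

(* Main.v *)
Require Import Defs.
From HB Require Import structures.
From mathcomp Require Import all_boot all_order all_algebra.
From mathcomp Require Import all_classical all_reals all_analysis.
From mathcomp Require Import measurable_realfun.
From mathcomp Require Import ring lra.
Import Order.TTheory GRing.Theory Num.Theory.
Import numFieldNormedType.Exports.
Local Open Scope classical_set_scope.
Local Open Scope ring_scope.

Set Implicit Arguments.
Unset Strict Implicit.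
Unset Printing Implicit Defensive.

(** Following Golse and Perthame: let [Psi >= 0] be a smooth weight with [|psi| <= K Psi] and let
    [rho_i], [J_i] be the moments of [f] and [a' f] against [v^i Psi], [i = 0, 1].  The kinetic
    equation says that [d_t rho_i + d_x J_i] is a measure.  For an increment [D] along one of the
    two axes, by an amount [y], a one-dimensional div-curl argument (one field is replaced by a
    potential of size [O(y)]) bounds the integral of [D rho_0 D J_1 - D J_0 D rho_1] over a
    rectangle by [O(y)].  This integrand equals
      [1/2 int int Psi(v) Psi(w) (v - w) (a'(v) - a'(w)) Df(v) Df(w) dv dw],
    which is nonnegative by the sign condition and, by the convexity of [a], dominates
    a multiple of [delta^(1 + beta) |Df(v) Df(w)|] where [|v - w| >= delta].  The strip [|v - w| < delta]
    contributes [O(delta)] to [(D int f psi)^2], and [delta = y^(1/(beta + 2))] balances both. *)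

(** * Bounded measurable functions and product measures *)

(** The divergences are only measures, so their products with bounded fields have no direct meaning.
    All fields are mollified by tensor-product kernels; the div-curl bound depends on the kernels
    only through their masses, so it is uniform in the scale and survives the limit. The potential
    is obtained by taking a primitive in the kernel and not in the field, so that it is again a
    smooth test function. This primitive runs along the increment, which suits the coordinates only
    for increments along an axis; a general increment is a sum of two.

    The weight [Psi] replaces [|psi|], which is not smooth, because the [gamma] derivatives in [v]
    must fall on the weight. The first moment obeys a conservation law too, since [v Psi] is again
    smooth with compact support.

    The balance leaves a squared increment of order [y^(1/(beta + 2))], and this is [y^(2 s)] for
    [s = 1/(4 + 2 beta)].

    Since [f] is bounded almost everywhere and on [t > 0] only, it is truncated in value and cut to
    a box in [(t, x)]; this gives a function bounded at every point, whose moments are those of [f]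
    almost everywhere in the box. *)

Definition bm d (T : measurableType d) (R : realType) (f : T -> R) : Prop :=
  measurable_fun setT f /\ exists M : R, forall x, `|f x| <= M.

Notation Int m f := (m.-integrable setT (EFin \o f)).

Lemma bm_cst d (T : measurableType d) (R : realType) (c : R) :
  bm (fun _ : T => c).
Proof. by split; [exact: measurable_cst|exists `|c|]. Qed.

Lemma bmD d (T : measurableType d) (R : realType) (f g : T -> R) :
  bm f -> bm g -> bm (fun x => f x + g x).
Proof.
move=> [mf [M fM]] [mg [N gN]]; split; first exact: measurable_funD.
by exists (M + N) => x; rewrite (le_trans (ler_normD _ _))// lerD.
Qed.

Lemma bmM d (T : measurableType d) (R : realType) (f g : T -> R) :
  bm f -> bm g -> bm (fun x => f x * g x).
Proof.
move=> [mf [M fM]] [mg [N gN]]; split; first exact: measurable_funM.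
by exists (M * N) => x; rewrite normrM ler_pM.
Qed.

Lemma bmN d (T : measurableType d) (R : realType) (f : T -> R) :
  bm f -> bm (fun x => - f x).
Proof.
move=> [mf [M fM]]; split; first exact: measurableT_comp.
by exists M => x; rewrite normrN.
Qed.

Lemma bmB d (T : measurableType d) (R : realType) (f g : T -> R) :
  bm f -> bm g -> bm (fun x => f x - g x).
Proof. by move=> bf bg; apply: bmD => //; exact: bmN. Qed.

Lemma bm_norm d (T : measurableType d) (R : realType) (f : T -> R) :
  bm f -> bm (fun x => `|f x|).
Proof.
move=> [mf [M fM]]; split; first exact: measurableT_comp.
by exists M => x; rewrite normr_id.
Qed.

(** Since the bound in [bm] holds at every point and not just almost everywhere, it passes through
    any measurable [p]; shifts, sections and exchanges of coordinates rest on this. *)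
Lemma bm_comp d d' (T : measurableType d) (T' : measurableType d') (R : realType)
  (f : T -> R) (p : T' -> T) : bm f -> measurable_fun setT p -> bm (fun x => f (p x)).
Proof.
move=> [mf [M fM]] mp; split; first exact: measurableT_comp.
by exists M => x.
Qed.

Lemma bm_indic d (T : measurableType d) (R : realType) (A : set T) :
  measurable A -> bm (\1_A : T -> R).
Proof.
move=> mA; split; first exact: measurable_indic.
by exists 1 => x; rewrite indicE; case: (_ \in _); rewrite ?normr1 ?normr0.
Qed.

Lemma bm_bounded d (T : measurableType d) (R : realType) (f : T -> R) D :
  bm f -> [bounded f x | x in D].
Proof.
move=> [_ [M fM]]; exists M; split; first by rewrite num_real.
by move=> x Mx y _ /=; rewrite (le_trans (fM _))// ltW.
Qed.

Lemma bm_int d (T : measurableType d) (R : realType)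
  (m : {finite_measure set T -> \bar R}) (f : T -> R) : bm f -> Int m f.
Proof.
move=> bf; apply: measurable_bounded_integrable => //.
- by rewrite -ge0_fin_numE// fin_num_measure.
- exact: (proj1 bf).
- exact: bm_bounded.
Qed.

Lemma int_bmM d (T : measurableType d) (R : realType)
  (m : {measure set T -> \bar R}) (f u : T -> R) : bm f -> Int m u ->
  Int m (fun x => f x * u x).
Proof.
by move=> bf iu; exact: (integrableMr measurableT (proj1 bf) (bm_bounded _ bf) iu).
Qed.

Lemma intD d (T : measurableType d) (R : realType)
  (m : {measure set T -> \bar R}) (f u : T -> R) : Int m f -> Int m u ->
  Int m (fun x => f x + u x).
Proof.
by move=> i1 i2; exact: (integrableD measurableT i1 i2).
Qed.

Lemma intB d (T : measurableType d) (R : realType)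
  (m : {measure set T -> \bar R}) (f u : T -> R) : Int m f -> Int m u ->
  Int m (fun x => f x - u x).
Proof.
by move=> i1 i2; exact: (integrableB measurableT i1 i2).
Qed.

(** Tonelli gives measurability of the integrals of the positive and the negative part. At points
    where the inner integral is infinite, [fine] returns 0, which keeps measurability. *)
Lemma meas_Rint d1 d2 (T1 : measurableType d1) (T2 : measurableType d2) (R : realType)
  (m2 : {sigma_finite_measure set T2 -> \bar R}) (F : T1 * T2 -> R) :
  measurable_fun setT F -> measurable_fun setT (fun x => \int[m2]_y F (x, y)).
Proof.
move=> mF; have mF' : measurable_fun setT (EFin \o F) by exact/measurable_EFinP.
rewrite /Rintegral; apply: measurableT_comp => //.
rewrite [X in measurable_fun _ X](_ : _ = (fun x =>
   \int[m2]_y ((EFin \o F)^\+ (x, y)) - \int[m2]_y ((EFin \o F)^\- (x, y)))%E); last first.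
  by apply/funext => x; rewrite [LHS]integralE; congr (_ - _)%E; apply: eq_integral => y _; rewrite ?funeposE ?funenegE.
apply: emeasurable_funB.
- apply: measurable_fun_fubini_tonelli_F => //; exact: measurable_funepos.
- apply: measurable_fun_fubini_tonelli_F => //; exact: measurable_funeneg.
Qed.

Lemma bm_pair1 d1 d2 (T1 : measurableType d1) (T2 : measurableType d2) (R : realType)
  (F : T1 * T2 -> R) x : bm F -> bm (fun y => F (x, y)).
Proof. move=> bF; apply: (bm_comp (p := fun y => (x, y)) bF).
by apply: measurable_fun_pair. Qed.

Lemma bm_pair2 d1 d2 (T1 : measurableType d1) (T2 : measurableType d2) (R : realType)
  (F : T1 * T2 -> R) y : bm F -> bm (fun x => F (x, y)).
Proof. move=> bF; apply: (bm_comp (p := fun x => (x, y)) bF).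
by apply: measurable_fun_pair. Qed.

Lemma Rint_bound d (T : measurableType d) (R : realType)
  (m : {finite_measure set T -> \bar R}) (f : T -> R) (M : R) : measurable_fun setT f ->
  (forall x, `|f x| <= M) -> `|\int[m]_x f x| <= M * fine (m setT).
Proof.
move=> mf fM; have bf : bm f by split => //; exists M.
rewrite (le_trans (le_normr_Rintegral _ _))//; first exact: bm_int.
rewrite -Rintegral_cst//; apply: le_Rintegral => //.
- by apply: (@bm_int _ _ _ _ (fun x => `|f x|)); exact: bm_norm.
- exact: (@bm_int _ _ _ _ (fun=> M) (bm_cst _ _)).
Qed.

Lemma bm_Rint d1 d2 (T1 : measurableType d1) (T2 : measurableType d2) (R : realType)
  (m2 : {finite_measure set T2 -> \bar R}) (F : T1 * T2 -> R) :
  bm F -> bm (fun x => \int[m2]_y F (x, y)).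
Proof.
move=> bF; split; first by apply: meas_Rint; exact: (proj1 bF).
have [mF [M FM]] := bF.
exists (M * fine (m2 setT)) => x; apply: Rint_bound => //.
exact: (proj1 (bm_pair1 x bF)).
Qed.

(* The library's sigma-finite structure on [m1 \x m2] is shadowed by the one for subprobabilities,
   hence this copy. *)
Definition prodm d1 d2 (T1 : measurableType d1) (T2 : measurableType d2) (R : realType)
  (m1 : {sigma_finite_measure set T1 -> \bar R}) (m2 : {sigma_finite_measure set T2 -> \bar R}) :
  set (T1 * T2) -> \bar R := (m1 \x m2)%E.

Section prodm.
Context d1 d2 (T1 : measurableType d1) (T2 : measurableType d2) (R : realType).
Variables (m1 : {sigma_finite_measure set T1 -> \bar R}) (m2 : {sigma_finite_measure set T2 -> \bar R}).

HB.instance Definition _ := Measure.on (prodm m1 m2).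

Let prodm_sigma_finite : sigma_finite setT (prodm m1 m2).
Proof.
have /sigma_finiteP[F [TF ndF Foo]] := sigma_finiteT m1.
have /sigma_finiteP[G [TG ndG Goo]] := sigma_finiteT m2.
exists (fun n => F n `*` G n) => [|n].
  apply/seteqP; split => // -[x y] _.
  have [i _ Fx] : (\bigcup_n F n) x by rewrite -TF.
  have [j _ Gy] : (\bigcup_n G n) y by rewrite -TG.
  exists (maxn i j) => //; split => /=.
  - by move: x Fx; apply/subsetPset/ndF/leq_maxl.
  - by move: y Gy; apply/subsetPset/ndG/leq_maxr.
have [mF Fn] := Foo n; have [mG Gn] := Goo n; split; first exact: measurableX.
by rewrite /prodm product_measure1E// lte_mul_pinfty// ge0_fin_numE.
Qed.

HB.instance Definition _ := Measure_isSigmaFinite.Build _ _ _ (prodm m1 m2)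
  prodm_sigma_finite.
End prodm.

(** The inner [Rintegral] sends infinite values to 0 through [fine]; the inner integrals are finite
    for almost every [x], so the outer integral does not notice. *)
Lemma Fubini_Rint1 d1 d2 (T1 : measurableType d1) (T2 : measurableType d2) (R : realType)
  (m1 : {sigma_finite_measure set T1 -> \bar R}) (m2 : {sigma_finite_measure set T2 -> \bar R})
  (F : T1 * T2 -> R) : Int (prodm m1 m2) F ->
  \int[(prodm m1 m2)]_z F z = \int[m1]_x \int[m2]_y F (x, y).
Proof.
move=> iF; rewrite /Rintegral -integral12_prod_meas1//; congr fine.
apply: ae_eq_integral => //.
- exact: (measurable_int m1 (integrable_fubini_F iF)).
- apply/measurable_EFinP; apply: meas_Rint.
  by apply/measurable_EFinP; exact: measurable_int iF.
have := ae_integrable1 iF; apply: filterS => x ix _.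
by rewrite fineK//; exact: integrable_fin_num.
Qed.

Lemma Fubini_Rint2 d1 d2 (T1 : measurableType d1) (T2 : measurableType d2) (R : realType)
  (m1 : {sigma_finite_measure set T1 -> \bar R}) (m2 : {sigma_finite_measure set T2 -> \bar R})
  (F : T1 * T2 -> R) : Int (prodm m1 m2) F ->
  \int[(prodm m1 m2)]_z F z = \int[m2]_y \int[m1]_x F (x, y).
Proof.
move=> iF; rewrite /Rintegral -integral21_prod_meas1//; congr fine.
apply: ae_eq_integral => //.
- exact: (measurable_fubini_G iF).
- apply/measurable_EFinP.
  apply: (@meas_Rint _ _ _ _ _ m1 (fun z => F (z.2, z.1))).
  apply: (@measurableT_comp _ _ _ _ _ _ F) => //.
    by apply/measurable_EFinP; exact: measurable_int iF.
  exact: measurable_swap.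
have := ae_integrable2 iF; apply: filterS => x ix _.
by rewrite fineK//; exact: integrable_fin_num.
Qed.

(** [prodm m1 m2] carries a sigma-finite structure only, so the bound on [F] is integrated first
    over [m2] and then over [m1]. *)
Lemma bm_int_prod d1 d2 (T1 : measurableType d1) (T2 : measurableType d2) (R : realType)
  (m1 : {finite_measure set T1 -> \bar R}) (m2 : {finite_measure set T2 -> \bar R})
  (F : T1 * T2 -> R) : bm F -> Int (prodm m1 m2) F.
Proof.
move=> bF; have [mF [M FM]] := bF.
apply/integrable12ltyP; first by apply/measurable_EFinP.
apply: (@le_lt_trans _ _ (\int[m1]_x (M%:E * m2 setT))%E).
  apply: ge0_le_integral => //.
  - by move=> x _; exact: integral_ge0.
  - apply: (@measurable_fun_fubini_tonelli_F _ _ _ _ _ _ (abse \o (EFin \o F))) => //.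
      by apply: measurableT_comp => //; exact/measurable_EFinP.
    by move=> x; rewrite /= lee_fin.
  move=> x _; rewrite -integral_cst//; apply: ge0_le_integral => //.
  - apply: measurableT_comp => //; apply/measurable_EFinP.
    exact: (proj1 (bm_pair1 x bF)).
  - by move=> y _ /=; rewrite lee_fin.
rewrite integral_cst// lte_mul_pinfty//.
- by rewrite mule_ge0// lee_fin (le_trans _ (FM point)).
- by rewrite fin_numM// fin_num_measure.
- by rewrite -ge0_fin_numE// fin_num_measure.
Qed.

Lemma bm_swap d1 d2 (T1 : measurableType d1) (T2 : measurableType d2) (R : realType)
  (m1 : {finite_measure set T1 -> \bar R}) (m2 : {finite_measure set T2 -> \bar R})
  (F : T1 -> T2 -> R) : bm (fun z => F z.1 z.2) ->
  \int[m1]_x \int[m2]_y F x y = \int[m2]_y \int[m1]_x F x y.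
Proof.
move=> bF; have iF := bm_int_prod m1 m2 bF.
by rewrite -(Fubini_Rint1 iF) (Fubini_Rint2 iF).
Qed.

Lemma Tonelli1 d1 d2 (T1 : measurableType d1) (T2 : measurableType d2) (R : realType)
  (m1 : {sigma_finite_measure set T1 -> \bar R}) (m2 : {sigma_finite_measure set T2 -> \bar R})
  (F : T1 * T2 -> \bar R) : measurable_fun setT F -> (forall z, 0 <= F z)%E ->
  (\int[(prodm m1 m2)]_z F z = \int[m1]_x \int[m2]_y F (x, y))%E.
Proof. by move=> mF F0; rewrite (fubini_tonelli1 F). Qed.

Lemma Tonelli2 d1 d2 (T1 : measurableType d1) (T2 : measurableType d2) (R : realType)
  (m1 : {sigma_finite_measure set T1 -> \bar R}) (m2 : {sigma_finite_measure set T2 -> \bar R})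
  (F : T1 * T2 -> \bar R) : measurable_fun setT F -> (forall z, 0 <= F z)%E ->
  (\int[(prodm m1 m2)]_z F z = \int[m2]_y \int[m1]_x F (x, y))%E.
Proof. by move=> mF F0; rewrite (fubini_tonelli2 F). Qed.

(** * Lebesgue measure, translations *)

(* [lebesgue_measure] lives on the display of [measurableTypeR]; this copy lives on the canonical
   measurable structure of [R]. *)
Definition lb (R : realType) : set R -> \bar R := @lebesgue_measure R.
Section lbm.
Variable R : realType.
Let lb0 : lb (set0 : set R) = 0%E.
Proof. exact: (@measure0 _ _ _ (@lebesgue_measure R)). Qed.

Let lb_ge0 (A : set R) : (0 <= lb A)%E.
Proof. exact: (@measure_ge0 _ _ _ (@lebesgue_measure R)). Qed.

Let lb_sigma : semi_sigma_additive (@lb R).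
Proof. exact: (@measure_semi_sigma_additive _ _ _ (@lebesgue_measure R)). Qed.

HB.instance Definition _ := isMeasure.Build _ _ _ (@lb R) lb0 lb_ge0 lb_sigma.
Let lb_sf : sigma_finite setT (@lb R).
Proof. exact: (@sigma_finiteT _ _ _ (@lebesgue_measure R)). Qed.

HB.instance Definition _ := @Measure_isSigmaFinite.Build _ _ _ (@lb R) lb_sf.
End lbm.
Arguments lb R : clear implicits.
Lemma lbE (R : realType) : lb R = @lebesgue_measure R :> (set R -> \bar R).
Proof. by []. Qed.

(** The identity from [measurableTypeR R] to [R] is measurable and carries one measure to the other,
    so this is a change of variables, done first for nonnegative functions. *)
Lemma lb_integral (R : realType) (D : set R) (f : R -> \bar R) : measurable D -> measurable_fun setT f ->
  (\int[@lebesgue_measure R]_(x in D) f x = \int[lb R]_(x in D) f x)%E.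
Proof.
move=> mD mf; wlog f0 : f mf / forall x, (0 <= f x)%E => [hw|].
  rewrite integralE [RHS]integralE !hw//; [exact: measurable_funeneg|exact: measurable_funepos].
have mid : measurable_fun setT (idfun : measurableTypeR R -> R).
  by move=> _ A mA; rewrite setTI; exact: mA.
exact/esym/(@ge0_integral_pushforward _ _ _ _ R _ mid lebesgue_measure D f mD (measurable_funTS mf) (fun y _ => f0 y)).
Qed.

Lemma leb_itv_lty (R : realType) (a b : R) : (lb R `[a, b] < +oo)%E.
Proof. by rewrite lbE lebesgue_measure_itv/=; case: ifP; rewrite ltry. Qed.

(** A finite measure on the whole line rather than an integral over a set: every [bm] function is
    integrable for it, so Fubini applies to all of them. *)
Definition lebI (R : realType) (a b : R) : {finite_measure set R -> \bar R} :=
  mfrestr (measurable_itv `[a, b]) (leb_itv_lty a b).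
(** Half-open intervals determine a measure that is finite on them. Invariance under translations
    and reflections thus reduces to the length of one preimage. *)
Lemma lb_unique (R : realType) (m : {measure set R -> \bar R}) :
  (forall a b : R, a < b -> m `]a, b]%classic = (b - a)%:E) ->
  forall A : set R, measurable A -> lb R A = m A.
Proof.
move=> H A mA.
have mid : measurable_fun setT (idfun : R -> measurableTypeR R).
  by move=> _ B mB; rewrite setTI; exact: mB.
pose m' := measure_function_pushforward__canonical__measure_function_Measure m mid.
apply: (@lebesgue_measure_unique R m') => // _ [[a b]] _ <- /=.
rewrite /pushforward preimage_id.
rewrite lebesgue_measure_itv/= lte_fin; case: ifPn => [/H -> //|].
rewrite -leNgt => ab; rewrite set_itv_ge ?measure0// bnd_simp -leNgt//.
Qed.

Lemma lb_itv_oc (R : realType) (a b : R) : a < b -> lb R `]a, b]%classic = (b - a)%:E.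
Proof. by move=> ab; rewrite lbE lebesgue_measure_itv/= lte_fin ab. Qed.

Lemma lb_itv_co (R : realType) (a b : R) : a < b -> lb R `[a, b[%classic = (b - a)%:E.
Proof. by move=> ab; rewrite lbE lebesgue_measure_itv/= lte_fin ab. Qed.

Lemma lb_push_ge0 (R : realType) (p : R -> R) (f : R -> \bar R) :
  measurable_fun setT p ->
  (forall a b : R, a < b -> lb R (p @^-1` `]a, b]%classic) = (b - a)%:E) ->
  measurable_fun setT f -> (forall x, 0 <= f x)%E ->
  (\int[lb R]_x f (p x) = \int[lb R]_x f x)%E.
Proof.
move=> mp H mf f0.
have E := @ge0_integral_pushforward _ _ _ _ R p mp (lb R) setT f measurableT mf (fun y _ => f0 y).
rewrite preimage_setT in E.
transitivity (\int[pushforward (lb R) p]_y f y)%E; first by rewrite E.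
apply: eq_measure_integral => A mA _; apply/esym.
exact: (@lb_unique R (measure_function_pushforward__canonical__measure_function_Measure (lb R) mp) H _ mA).
Qed.

Lemma shift_preim (R : realType) (c a b : R) : a < b ->
  lb R ((fun x => x + c) @^-1` `]a, b]%classic) = (b - a)%:E.
Proof.
move=> ab; rewrite [X in lb R X](_ : _ = `]a - c, b - c]%classic).
  by rewrite lb_itv_oc ?ltrD2r//; congr EFin; ring.
by apply/seteqP; split => x /=; rewrite !in_itv/= ltrBlDr lerBrDr.
Qed.

Lemma refl_preim (R : realType) (c a b : R) : a < b ->
  lb R ((fun x => c - x) @^-1` `]a, b]%classic) = (b - a)%:E.
Proof.
move=> ab; rewrite [X in lb R X](_ : _ = `[c - b, c - a[%classic).
  by rewrite lb_itv_co ?ltrD2l ?ltrN2//; congr EFin; ring.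
by apply/seteqP; split => x /=; rewrite !in_itv/= lerBlDr ltrBrDr ltrBrDr lerBlDr addrC andbC => /andP[? ?]; apply/andP; split; lra.
Qed.

Lemma lb_push (R : realType) (p : R -> R) (f : R -> R) :
  measurable_fun setT p ->
  (forall a b : R, a < b -> lb R (p @^-1` `]a, b]%classic) = (b - a)%:E) ->
  measurable_fun setT f -> \int[lb R]_x f (p x) = \int[lb R]_x f x.
Proof.
move=> mp H mf; rewrite /Rintegral; congr fine.
have mf' : measurable_fun setT (EFin \o f) by apply/measurable_EFinP.
rewrite integralE [RHS]integralE; congr (_ - _)%E.
- rewrite -[RHS](lb_push_ge0 mp H)//; [by apply: eq_integral => x _; rewrite ?funeposE|exact: measurable_funepos].
- rewrite -[RHS](lb_push_ge0 mp H)//; [by apply: eq_integral => x _; rewrite ?funenegE|exact: measurable_funeneg].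
Qed.

Lemma measurable_addr (R : realType) (c : R) : measurable_fun setT (fun x : R => x + c).
Proof. exact: measurable_funD. Qed.

Lemma measurable_rsub (R : realType) (c : R) : measurable_fun setT (fun x : R => c - x).
Proof. exact: measurable_funB. Qed.

Lemma lb_shift_ge0 (R : realType) (c : R) (f : R -> \bar R) :
  measurable_fun setT f -> (forall x, 0 <= f x)%E ->
  (\int[lb R]_x f (x + c)%R = \int[lb R]_x f x)%E.
Proof.
move=> mf f0; apply: (lb_push_ge0 (measurable_addr c)) => // a b ab.
exact: shift_preim.
Qed.

Lemma lb_shift (R : realType) (c : R) (f : R -> R) :
  measurable_fun setT f -> \int[lb R]_x f (x + c) = \int[lb R]_x f x.
Proof.
move=> mf; apply: (lb_push (measurable_addr c)) => // a b ab.
exact: shift_preim.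
Qed.

Lemma lb_refl (R : realType) (c : R) (f : R -> R) :
  measurable_fun setT f -> \int[lb R]_x f (c - x) = \int[lb R]_x f x.
Proof.
move=> mf; apply: (lb_push (measurable_rsub c)) => // a b ab.
exact: refl_preim.
Qed.

Lemma lb_push_int (R : realType) (p : R -> R) (f : R -> R) :
  measurable_fun setT p ->
  (forall a b : R, a < b -> lb R (p @^-1` `]a, b]%classic) = (b - a)%:E) ->
  Int (lb R) f -> Int (lb R) (fun x => f (p x)).
Proof.
move=> mp H /integrableP[mf foo]; apply/integrableP; split.
  by apply: (@measurableT_comp _ _ _ _ _ _ (EFin \o f)).
have E : (\int[lb R]_x (abse \o (EFin \o f)) (p x))%E = (\int[lb R]_x (abse \o (EFin \o f)) x)%E.
  have mg : measurable_fun setT (abse \o (EFin \o f)) by exact: measurableT_comp.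
  exact: (lb_push_ge0 mp H mg (fun x => abse_ge0 _)).
by apply: le_lt_trans foo; rewrite -E.
Qed.

Lemma lebI_setT (R : realType) (a b : R) : a <= b -> fine (lebI a b setT) = b - a.
Proof.
move=> ab; rewrite /lebI/= /mfrestr /mrestr setTI lbE lebesgue_measure_itv/= lte_fin.
by case: ltP => //= ba; rewrite (@le_anti _ _ a b) ?subrr// ab.
Qed.

(** [mfrestr mD moo] does not charge the complement of [D], and on subsets of [D] it is [m]. *)
Lemma frestr_integral d (T : measurableType d) (R : realType) (m : {measure set T -> \bar R})
  (D : set T) (mD : measurable D) (moo : (m D < +oo)%E) (f : T -> \bar R) :
  measurable_fun setT f -> (forall x, 0 <= f x)%E ->
  (\int[mfrestr mD moo]_x f x = \int[m]_(x in D) f x)%E.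
Proof.
move=> mf f0; rewrite -(setUv D) ge0_integral_setU//=; last 3 first.
- exact: measurableC.
- exact: measurable_funTS.
- exact/disj_setPCl.
rewrite [X in (_ + X)%E](_ : _ = 0%E); last first.
  apply: null_set_integral => //=; [exact: measurableC|exact: measurable_funTS|].
  by rewrite /mfrestr /mrestr setICl measure0.
rewrite adde0; apply: eq_measure_integral => A mA AD /=.
by rewrite /mfrestr /mrestr setIidl.
Qed.

Lemma lebI_integralE (R : realType) (a b : R) (f : R -> \bar R) : measurable_fun setT f ->
  (forall x, 0 <= f x)%E ->
  (\int[lebI a b]_x f x = \int[lb R]_(x in `[a, b]) f x)%E.
Proof. exact: frestr_integral. Qed.

Lemma lebI_int (R : realType) (a b : R) (f : R -> R) : bm f ->
  (lb R).-integrable `[a, b] (EFin \o f).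
Proof.
move=> bf; apply: measurable_bounded_integrable => //.
- exact: leb_itv_lty.
- exact: (measurable_funTS (proj1 bf)).
- exact: bm_bounded.
Qed.

Lemma lebI_Rint (R : realType) (a b : R) (f : R -> R) : measurable_fun setT f ->
  \int[lebI a b]_x f x = \int[lb R]_(x in `[a, b]) f x.
Proof.
move=> bf; rewrite /Rintegral; congr fine.
have mf : measurable_fun setT (EFin \o f) by apply/measurable_EFinP.
rewrite integralE [RHS]integralE; congr (_ - _)%E; apply: lebI_integralE => //.
- exact: measurable_funepos.
- exact: measurable_funeneg.
Qed.

Lemma lebI_ae (R : realType) (a b : R) (P : R -> Prop) :
  {ae (lb R), forall x, P x} -> {ae lebI a b, forall x, P x}.
Proof.
move=> [N [mN N0 PN]]; exists N; split => //=.
apply/eqP; rewrite /mfrestr /mrestr -measure_le0 -N0; apply: le_measure; rewrite ?inE//.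
exact: measurableI.
Qed.

Lemma lb2_shift_ge0 (R : realType) (c1 c2 : R) (f : R * R -> \bar R) :
  measurable_fun setT f -> (forall x, 0 <= f x)%E ->
  (\int[(prodm (lb R) (lb R))]_z f (z.1 + c1, z.2 + c2)%R = \int[(prodm (lb R) (lb R))]_z f z)%E.
Proof.
move=> mf f0.
have ms : measurable_fun setT (fun z : R * R => (z.1 + c1, z.2 + c2)).
  by apply: measurable_fun_pair => /=; apply: measurable_funD.
have mfs := measurableT_comp mf ms.
transitivity (\int[lb R]_x \int[lb R]_y f (x + c1, y + c2)%R)%E.
  by apply: (Tonelli1 (lb R) (lb R) (F := fun z => f (z.1 + c1, z.2 + c2)%R)).
transitivity (\int[lb R]_x \int[lb R]_y f (x, y))%E; last first.
  by apply/esym; apply: (Tonelli1 (lb R) (lb R) (F := f)).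
rewrite -[RHS](@lb_shift_ge0 _ c1)//; last 2 first.
- by apply: (measurable_fun_fubini_tonelli_F f).
- by move=> x; exact: integral_ge0.
apply: eq_integral => x _.
rewrite -(@lb_shift_ge0 _ c2 (fun y => f (x + c1, y)))//.
exact: (measurableT_comp mf (pair1_measurable _)).
Qed.

(** * Smooth compactly supported functions *)

(** Recursion on the derivative, with differentiability at each stage, lets the product rule and
    affine substitutions be iterated by induction on [n]; [CinfP] returns to [derive1n]. *)
Fixpoint Cn (R : realType) (n : nat) (f : R -> R) : Prop :=
  if n is n'.+1 then (forall x : R, derivable f x 1) /\ Cn n' (derive1 f) else True.

Definition Cinf (R : realType) (f : R -> R) : Prop := forall n, Cn n f.

Lemma CinfP (R : realType) (f : R -> R) :
  Cinf f <-> forall (n : nat) (x : R), derivable (derive1n n f) x 1.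
Proof.
split.
- move=> Cf n; move: f Cf; elim: n => [|n IH] f Cf x; first exact: (Cf 1%N).1.
  rewrite derive1Sn; apply: IH => m; exact: (Cf m.+1).2.
- move=> H n; move: f H; elim: n => [//|n IH] f H; split; first exact: (H 0%N).
  by apply: IH => m x; rewrite -derive1Sn; exact: H.
Qed.

Lemma CnW (R : realType) n (f : R -> R) : Cn n.+1 f -> Cn n f.
Proof. by elim: n f => [//|n IH] f [df Cf]; split => //; exact: IH. Qed.

Lemma is_derive1_derive (R : realType) (f : R -> R) (x : R) : derivable f x 1 ->
  is_derive x 1 f ((derive1 f) x).
Proof. by move=> df; rewrite derive1E; exact/derivableP. Qed.

Lemma derive1_val (R : realType) (f : R -> R) (x df : R) : is_derive x 1 f df -> (derive1 f) x = df.
Proof. by move=> H; rewrite derive1E derive_val. Qed.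

Lemma derive1_eq (R : realType) (f g : R -> R) :
  (forall x : R, is_derive x 1 f (g x)) -> (derive1 f) = g.
Proof. by move=> H; apply/funext => x; exact: derive1_val. Qed.

Lemma is_derive_fD (R : realType) (f g : R -> R) (x a b : R) :
  is_derive x 1 f a -> is_derive x 1 g b -> is_derive x 1 (fun y => f y + g y) (a + b).
Proof. by move=> H1 H2; exact: is_deriveD. Qed.

Lemma is_derive_fM (R : realType) (f g : R -> R) (x a b : R) :
  is_derive x 1 f a -> is_derive x 1 g b ->
  is_derive x 1 (fun y => f y * g y) (a * g x + f x * b).
Proof.
move=> H1 H2; apply: is_derive_eq.
by rewrite /GRing.scale/= addrC [g x * a]mulrC.
Qed.

Lemma is_derive_aff (R : realType) (k : R -> R) (c l x d : R) :
  is_derive (c + l * x) 1 k d -> is_derive x 1 (fun y => k (c + l * y)) (l * d).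
Proof.
move=> H.
have Hg : is_derive x 1 (fun y => c + l * y) l.
  have := is_derive_fD (is_derive_cst c x 1) (is_derive_fM (is_derive_cst l x 1) (is_derive_id x 1)).
  by rewrite (_ : 0 + (0 * x + l * 1) = l)//; ring.
by rewrite mulrC; exact: (@is_derive1_comp R k (fun y => c + l * y)).
Qed.

Lemma is_derive_sub (R : realType) (k : R -> R) (c x d : R) :
  is_derive (x - c) 1 k d -> is_derive x 1 (fun y => k (y - c)) d.
Proof.
move=> H; have := @is_derive_aff _ k (- c) 1 x d.
rewrite !mul1r addrC => /(_ H).
by rewrite (_ : (fun y => k (- c + 1 * y)) = (fun y => k (y - c)))//; apply/funext => y; rewrite mul1r addrC.
Qed.

Lemma is_derive_rsub (R : realType) (k : R -> R) (c x d : R) :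
  is_derive (c - x) 1 k d -> is_derive x 1 (fun y => k (c - y)) (- d).
Proof.
move=> H; have := @is_derive_aff _ k c (-1) x d.
rewrite !mulN1r => /(_ H).
by rewrite (_ : (fun y => k (c + -1 * y)) = (fun y => k (c - y)))//; apply/funext => y; rewrite mulN1r.
Qed.

Lemma CnD (R : realType) n (f g : R -> R) : Cn n f -> Cn n g -> Cn n (fun x => f x + g x).
Proof.
elim: n f g => [//|n IH] f g [df Cf] [dg Cg].
have H (x : R) : is_derive x 1 (fun x => f x + g x) ((derive1 f) x + (derive1 g) x).
  by apply: is_derive_fD; exact: is_derive1_derive.
by split => [x|]; [exact: (@ex_derive _ _ _ _ _ _ _ (H x))|rewrite (derive1_eq H); exact: IH].
Qed.

Lemma CnM (R : realType) n (f g : R -> R) : Cn n f -> Cn n g -> Cn n (fun x => f x * g x).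
Proof.
elim: n f g => [//|n IH] f g Cf' Cg'; have [df Cf] := Cf'; have [dg Cg] := Cg'.
have H (x : R) : is_derive x 1 (fun x => f x * g x) ((derive1 f) x * g x + f x * (derive1 g) x).
  by apply: is_derive_fM; exact: is_derive1_derive.
split => [x|]; first exact: (@ex_derive _ _ _ _ _ _ _ (H x)).
by rewrite (derive1_eq H); apply: CnD; apply: IH => //; exact: CnW.
Qed.

Lemma Cinf_cst (R : realType) (c : R) : Cinf (fun _ : R => c).
Proof.
move=> n; elim: n c => [//|n IH] c; split; first exact: derivable_cst.
have -> : (derive1 (fun _ : R => c)) = (fun _ => 0) by apply/funext => x; exact: derive1_cst.
exact: IH.
Qed.

Lemma Cinf_id (R : realType) : Cinf (fun x : R => x).
Proof.
case=> [|n]; first by [].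
split => [x|]; first exact: (@ex_derive _ _ _ _ _ _ _ (is_derive_id x 1)).
rewrite (@derive1_eq _ _ (fun => 1)); first exact: Cinf_cst.
Qed.

Lemma Cn_aff (R : realType) n (k : R -> R) (c l : R) : Cn n k -> Cn n (fun y => k (c + l * y)).
Proof.
elim: n k => [//|n IH] k [dk Ck].
have H (x : R) : is_derive x 1 (fun y => k (c + l * y)) (l * (derive1 k) (c + l * x)).
  by apply: is_derive_aff; exact: is_derive1_derive.
split => [x|]; first exact: (@ex_derive _ _ _ _ _ _ _ (H x)).
by rewrite (derive1_eq H); apply: CnM; [exact: Cinf_cst|exact: IH].
Qed.

Lemma Cinf_shift (R : realType) (k : R -> R) (c : R) : Cinf k -> Cinf (fun y => k (y - c)).
Proof.
move=> Ck n; rewrite (_ : (fun y => _) = fun y => k (- c + 1 * y)); first exact: Cn_aff.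
by apply/funext => y; rewrite mul1r addrC.
Qed.

Lemma CinfM (R : realType) (f g : R -> R) : Cinf f -> Cinf g -> Cinf (fun x => f x * g x).
Proof. by move=> Cf Cg n; exact: CnM. Qed.

Lemma Cinf_derive (R : realType) (f : R -> R) : Cinf f -> Cinf (derive1 f).
Proof. by move=> Cf n; exact: (Cf n.+1).2. Qed.

Lemma Cinf_derivable (R : realType) (f : R -> R) (x : R) : Cinf f -> derivable f x 1.
Proof. by move=> Cf; exact: (Cf 1%N).1. Qed.

Lemma derivable_cont (R : realType) (f : R -> R) : (forall x : R, derivable f x 1) -> continuous f.
Proof. by move=> df x; apply: differentiable_continuous; apply/derivable1_diffP. Qed.

Lemma Cinf_cont (R : realType) (f : R -> R) : Cinf f -> continuous f.
Proof. by move=> Cf; apply: derivable_cont => x; exact: Cinf_derivable. Qed.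

Definition supp_in (R : realType) (l u : R) (k : R -> R) : Prop :=
  forall x, x < l \/ u < x -> k x = 0.

Lemma supp_out (R : realType) (l u x : R) (k : R -> R) : supp_in l u k ->
  ~ (l <= x <= u) -> k x = 0.
Proof.
move=> sk xn; apply: sk; have [h|h] := ltP x l; first by left.
by right; rewrite ltNge; apply/negP => h'; apply: xn; rewrite h.
Qed.

(** The bounds of the support are explicit because translated and widened kernels must be seen to
    stay in a box inside [t > 0]. *)
Definition ker (R : realType) (l u : R) (k : R -> R) : Prop := Cinf k /\ supp_in l u k.

Lemma supp_in_derive (R : realType) (l u : R) (k : R -> R) : supp_in l u k -> supp_in l u (derive1 k).
Proof.
move=> sk x xlu; rewrite derive1E (@near_eq_derive _ _ _ k (cst 0)).
  by rewrite -derive1E derive1_cst.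
case: xlu => xlu.
- by near=> y; apply: sk; left; near: y; exact: lt_nbhsl.
- by near=> y; apply: sk; right; near: y; exact: lt_nbhsr.
Unshelve. all: by end_near. Qed.

Lemma ker_derive (R : realType) (l u : R) (k : R -> R) : ker l u k -> ker l u (derive1 k).
Proof. by case=> Ck sk; split; [exact: Cinf_derive|exact: supp_in_derive]. Qed.

Lemma ker_shift (R : realType) (l u c : R) (k : R -> R) : ker l u k ->
  ker (l + c) (u + c) (fun x => k (x - c)).
Proof.
case=> Ck sk; split; first exact: Cinf_shift.
by move=> x [h|h]; apply: sk; [left|right]; lra.
Qed.

Lemma kerW (R : realType) (l u l' u' : R) (k : R -> R) : l' <= l -> u <= u' ->
  ker l u k -> ker l' u' k.
Proof. by move=> ll uu [Ck sk]; split => // x [h|h]; apply: sk; [left|right]; lra. Qed.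

Lemma cont_supp_bm (R : realType) (l u : R) (k : R -> R) : continuous k -> supp_in l u k -> bm k.
Proof.
move=> ck sk; split; first exact: continuous_measurable_fun.
have [M [_ HM]] : bounded_set (k @` `[l, u]).
  apply: compact_bounded; apply: continuous_compact; last exact: segment_compact.
  exact: continuous_subspaceT.
exists (Num.max 0 (M + 1)) => x; case: (boolP ((l <= x) && (x <= u))) => [xlu|].
  rewrite le_max; apply/orP; right; apply: (HM (M + 1)); first by rewrite ltrDl.
  by exists x => //=; rewrite in_itv.
rewrite negb_and -!ltNge => /orP H; rewrite sk ?normr0 ?le_max ?lexx//.
Qed.

Lemma ker_bm (R : realType) (l u : R) (k : R -> R) : ker l u k -> bm k.
Proof. by case=> Ck sk; apply: (cont_supp_bm (Cinf_cont Ck) sk). Qed.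

(** * Mollification on the plane *)

Lemma supp_int (R : realType) (l u : R) (k : R -> R) : bm k -> supp_in l u k -> Int (lb R) k.
Proof.
move=> bk sk; rewrite (_ : k = k \_ `[l, u]); last first.
  apply/funext => x; rewrite patchE; case: ifPn => // /negP xlu; apply: sk.
  case: (ltP x l) => [|lx]; first by left.
  by case: (ltP u x) => [|xu]; [right|exfalso; apply: xlu; rewrite inE/= in_itv/= lx xu].
have := (integrable_mkcond (EFin \o k) (measurable_itv `[l, u])).1 (lebI_int l u bk).
by rewrite restrict_EFin.
Qed.

Lemma ker_int (R : realType) (l u : R) (k : R -> R) : ker l u k -> Int (lb R) k.
Proof. by move=> kk; apply: supp_int (ker_bm kk) (proj2 kk). Qed.

Lemma int_norm d (T : measurableType d) (R : realType)
  (m : {measure set T -> \bar R}) (f : T -> R) : Int m f -> Int m (fun x => `|f x|).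
Proof. by move=> /integrable_norm. Qed.

Lemma int_shift (R : realType) (c : R) (f : R -> R) : Int (lb R) f -> Int (lb R) (fun x => f (x - c)).
Proof.
move=> If; apply: (lb_push_int (p := fun x => x - c)) => //; first exact: (measurable_addr (- c)).
by move=> a b ab; exact: shift_preim.
Qed.

Lemma int_tensor d1 d2 (T1 : measurableType d1) (T2 : measurableType d2) (R : realType)
  (m1 : {sigma_finite_measure set T1 -> \bar R}) (m2 : {sigma_finite_measure set T2 -> \bar R})
  (f : T1 -> R) (g : T2 -> R) : Int m1 f -> Int m2 g ->
  Int (prodm m1 m2) (fun z => f z.1 * g z.2).
Proof.
move=> If Ig.
have mf : measurable_fun setT f by apply/measurable_EFinP; exact: measurable_int If.
have mg : measurable_fun setT g by apply/measurable_EFinP; exact: measurable_int Ig.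
apply/integrable12ltyP.
  apply/measurable_EFinP; apply: measurable_funM.
    exact: (measurableT_comp mf measurable_fst).
  exact: (measurableT_comp mg measurable_snd).
have E x : (\int[m2]_y `|(f x * g y)%:E| =
    `|f x|%:E * (\int[m2]_y `|(g y)%:E|))%E.
  rewrite -ge0_integralZl//; last first.
    by apply/measurable_EFinP; apply: measurableT_comp.
  by apply: eq_integral => y _ /=; rewrite normrM EFinM.
under eq_integral do rewrite E.
have /integrableP[_ Ig'] := Ig; have /integrableP[_ If'] := If.
rewrite ge0_integralZr//; last 2 first.
- by apply/measurable_EFinP; apply: measurableT_comp.
- exact: integral_ge0.
by apply: lte_mul_pinfty => //; [exact: integral_ge0|rewrite ge0_fin_numE//; exact: integral_ge0].
Qed.

Lemma Rint_tensor d1 d2 (T1 : measurableType d1) (T2 : measurableType d2) (R : realType)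
  (m1 : {sigma_finite_measure set T1 -> \bar R}) (m2 : {sigma_finite_measure set T2 -> \bar R})
  (f : T1 -> R) (g : T2 -> R) : Int m1 f -> Int m2 g ->
  \int[(prodm m1 m2)]_z (f z.1 * g z.2) = (\int[m1]_x f x) * (\int[m2]_y g y).
Proof.
move=> If Ig; rewrite (Fubini_Rint1 (int_tensor If Ig))/=.
by under eq_Rintegral do rewrite RintegralZl//; rewrite RintegralZr.
Qed.

(** Differentiation under the integral sign, dominated by [M * |w|] with [M] a bound of the
    derivative of [k]. The abstract [p] lets it serve both coordinates of the plane and the
    potential [slide]. *)
Lemma conv_derive d (T : measurableType d) (R : realType) (m : {measure set T -> \bar R})
  (p w : T -> R) (k : R -> R) (l u : R) (t : R) :
  ker l u k -> measurable_fun setT p -> Int m w ->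
  is_derive t 1 (fun t => \int[m]_z (k (p z - t) * w z))
    (- \int[m]_z (derive1 k (p z - t) * w z)).
Proof.
move=> kk mp Iw.
have bmk (h : R -> R) s : bm h -> bm (fun z => h (p z - s)).
  by move=> bh; apply: (bm_comp bh); exact: measurable_funB.
have bk := ker_bm kk.
have bk' := ker_bm (ker_derive kk).
have [_ [M HM]] := bk'.
pose f := fun (s : R) (z : T) => k (p z - s) * w z.
have D (s : R) (z : T) : is_derive s 1 (f ^~ z) (- (derive1 k (p z - s)) * w z).
  have H := is_derive_fM (is_derive_rsub (is_derive1_derive (@Cinf_derivable _ _ (p z - s) (proj1 kk)))) (is_derive_cst (w z) s 1).
  by rewrite mulr0 addr0 in H.
have I0 : `]t - 1, t + 1[%classic t by rewrite /= in_itv/=; lra.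
have intf s : `]t - 1, t + 1[%classic s -> Int m (f s).
  by move=> _; apply: int_bmM => //; exact: bmk.
have derf s z : `]t - 1, t + 1[%classic s -> setT z -> derivable (f ^~ z) s 1.
  by move=> _ _; exact: (@ex_derive _ _ _ _ _ _ _ (D s z)).
have d1 s z : partial1of2 f s z = - (derive1 k (p z - s)) * w z.
  by rewrite /partial1of2; exact: derive1_val.
pose G := fun z => M * `|w z|.
have M0 : 0 <= M by rewrite (le_trans _ (HM 0)).
have G0 z : 0 <= G z by rewrite mulr_ge0.
have IG : Int m G.
  apply: (int_bmM (f := fun=> M)) => //; [exact: bm_cst|exact: int_norm].
have GU s z : `]t - 1, t + 1[%classic s -> setT z -> `|partial1of2 f s z| <= G z.
  by move=> _ _; rewrite d1 normrM normrN ler_wpM2r.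
have H1 := derivable_under_integral measurableT I0 intf derf G0 IG GU.
have H2 := differentiation_under_integral measurableT I0 intf derf G0 IG GU.
rewrite (_ : - _ = derive1 (fun t => \int[m]_z (k (p z - t) * w z)) t).
  exact: is_derive1_derive.
rewrite H2 -mulN1r -RintegralZl//; last by apply: int_bmM => //; exact: bmk.
by apply: eq_Rintegral => z _; rewrite d1 mulN1r mulNr.
Qed.

(** The kernel is moved to [(t, x)] without reflection, so a value of [moll] is a test integral
    against a translated kernel; the price is a minus sign in each derivative. *)
Definition moll (R : realType) (k1 k2 : R -> R) (u : R * R -> R) (t x : R) : R :=
  \int[(prodm (lb R) (lb R))]_z (k1 (z.1 - t) * (k2 (z.2 - x) * u z)).

Lemma bm_fst_shift (R : realType) (k : R -> R) (t : R) : bm k -> bm (fun z : R * R => k (z.1 - t)).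
Proof. by move=> bk; apply: (bm_comp bk); exact: measurable_funB. Qed.

Lemma bm_snd_shift (R : realType) (k : R -> R) (t : R) : bm k -> bm (fun z : R * R => k (z.2 - t)).
Proof. by move=> bk; apply: (bm_comp bk); exact: measurable_funB. Qed.

Lemma moll_int (R : realType) (k1 k2 : R -> R) (u : R * R -> R) (t x : R) : bm k1 -> bm k2 ->
  Int (prodm (lb R) (lb R)) u ->
  Int (prodm (lb R) (lb R)) (fun z => k1 (z.1 - t) * (k2 (z.2 - x) * u z)).
Proof.
move=> b1 b2 Iu; apply: int_bmM; first exact: bm_fst_shift.
by apply: int_bmM => //; exact: bm_snd_shift.
Qed.

Lemma moll_derive1 (R : realType) (l1 u1 : R) (k1 k2 : R -> R) (u : R * R -> R) (t x : R) :
  ker l1 u1 k1 -> bm k2 -> Int (prodm (lb R) (lb R)) u ->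
  is_derive t 1 (fun t => moll k1 k2 u t x) (- moll (derive1 k1) k2 u t x).
Proof.
move=> kk bk2 Iu; apply: (@conv_derive _ _ _ (prodm (lb R) (lb R)) fst ( fun z => k2 (z.2 - x) * u z) _ _ _ _ kk) => //.
by apply: int_bmM => //; exact: bm_snd_shift.
Qed.

Lemma mollC (R : realType) (k1 k2 : R -> R) (u : R * R -> R) (t x : R) :
  moll k1 k2 u t x = \int[(prodm (lb R) (lb R))]_z (k2 (z.2 - x) * (k1 (z.1 - t) * u z)).
Proof. by apply: eq_Rintegral => z _; rewrite mulrCA. Qed.

Lemma moll_derive2 (R : realType) (l2 u2 : R) (k1 k2 : R -> R) (u : R * R -> R) (t x : R) :
  bm k1 -> ker l2 u2 k2 -> Int (prodm (lb R) (lb R)) u ->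
  is_derive x 1 (fun x => moll k1 k2 u t x) (- moll k1 (derive1 k2) u t x).
Proof.
move=> bk1 kk Iu; rewrite mollC (_ : (fun x => moll _ _ _ _ _) = fun x => \int[(prodm (lb R) (lb R))]_z (k2 (z.2 - x) * (k1 (z.1 - t) * u z))).
  apply: (@conv_derive _ _ _ (prodm (lb R) (lb R)) snd ( fun z => k1 (z.1 - t) * u z) _ _ _ _ kk) => //.
  by apply: int_bmM => //; exact: bm_fst_shift.
by apply/funext => y; exact: mollC.
Qed.

Lemma moll_shift2 (R : realType) (k1 k2 : R -> R) (u : R * R -> R) (t x y : R) :
  moll k1 (fun z => k2 (z - y)) u t x = moll k1 k2 u t (x + y).
Proof. by apply: eq_Rintegral => z _; rewrite (_ : z.2 - x - y = z.2 - (x + y))//; ring. Qed.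

Lemma moll_sub2 (R : realType) (k1 k2 k3 : R -> R) (u : R * R -> R) (t x : R) :
  bm k1 -> bm k2 -> bm k3 -> Int (prodm (lb R) (lb R)) u ->
  moll k1 (fun z => k2 z - k3 z) u t x = moll k1 k2 u t x - moll k1 k3 u t x.
Proof.
move=> b1 b2 b3 Iu; rewrite -RintegralB//; [|exact: moll_int..].
by apply: eq_Rintegral => z _; ring.
Qed.

(** Only the masses of the kernels enter: with unit masses the bound of [u] is kept, and a factor of
    mass [O(y)] makes the result [O(y)]. *)
Lemma moll_bound (R : realType) (k1 k2 : R -> R) (u : R * R -> R) (t x M n1 n2 : R) :
  bm k1 -> bm k2 -> Int (lb R) k1 -> Int (lb R) k2 ->
  Int (prodm (lb R) (lb R)) u -> (forall z, `|u z| <= M) ->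
  \int[lb R]_s `|k1 s| <= n1 -> \int[lb R]_s `|k2 s| <= n2 ->
  `|moll k1 k2 u t x| <= M * (n1 * n2).
Proof.
move=> b1 b2 I1 I2 Iu HM N1 N2.
have M0 : 0 <= M by rewrite (le_trans _ (HM (0, 0))).
have J1 := int_norm (int_shift t I1); have J2 := int_norm (int_shift x I2).
have IT := int_tensor J1 J2.
rewrite (le_trans (le_normr_Rintegral _ _))//; first exact: moll_int.
apply: (@le_trans _ _ (\int[(prodm (lb R) (lb R))]_z (M * (`|k1 (z.1 - t)| * `|k2 (z.2 - x)|)))).
  apply: le_Rintegral => //.
  - by apply: int_norm; exact: moll_int.
  - exact: (int_bmM (f := fun=> M) (bm_cst _ _) IT).
  - move=> z _; rewrite !normrM mulrA mulrC; apply: ler_wpM2r; [by rewrite mulr_ge0|exact: HM].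
rewrite RintegralZl//; apply: ler_wpM2l => //.
rewrite (Rint_tensor J1 J2).
have S (k : R -> R) c : bm k -> \int[lb R]_y `|k (y - c)| = \int[lb R]_y `|k y|.
  by move=> bk; apply: (lb_shift (- c) (f := fun y => `|k y|)); exact: (proj1 (bm_norm bk)).
by rewrite !S//; apply: ler_pM => //; apply: Rintegral_ge0.
Qed.

Lemma bm_moll (R : realType) (k1 k2 : R -> R) (u : R * R -> R) :
  bm k1 -> bm k2 -> Int (lb R) k1 -> Int (lb R) k2 ->
  Int (prodm (lb R) (lb R)) u -> bm u -> bm (fun q : R * R => moll k1 k2 u q.1 q.2).
Proof.
move=> b1 b2 I1 I2 Iu [mu [M HM]]; split.
  pose F := fun r : (R * R) * (R * R) => k1 (r.2.1 - r.1.1) * (k2 (r.2.2 - r.1.2) * u r.2).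
  suff mF : measurable_fun setT F by exact: (meas_Rint (prodm (lb R) (lb R)) mF).
  apply: measurable_funM; last apply: measurable_funM.
  - apply: (measurableT_comp (proj1 b1)); apply: measurable_funB.
      exact: (measurableT_comp measurable_fst measurable_snd).
    exact: (measurableT_comp measurable_fst measurable_fst).
  - apply: (measurableT_comp (proj1 b2)); apply: measurable_funB.
      exact: (measurableT_comp measurable_snd measurable_snd).
    exact: (measurableT_comp measurable_snd measurable_fst).
  - exact: (measurableT_comp mu measurable_snd).
exists (M * (\int[lb R]_s `|k1 s| * \int[lb R]_s `|k2 s|)) => q.
exact: moll_bound.
Qed.

(** * The div-curl identity for mollified fields *)

Lemma lebI_le_in (R : realType) (p q : R) (f g : R -> R) : bm f -> bm g ->
  (forall x, p <= x <= q -> f x <= g x) ->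
  \int[lebI p q]_x f x <= \int[lebI p q]_x g x.
Proof.
move=> bf bg fg; rewrite !lebI_Rint; [|exact: (proj1 bg)|exact: (proj1 bf)].
apply: le_Rintegral => //; first exact: lebI_int.
  exact: lebI_int.
Qed.

Lemma lebI_le_lb (R : realType) (p q : R) (f : R -> R) : bm f -> Int (lb R) f ->
  (forall x, 0 <= f x) -> \int[lebI p q]_x f x <= \int[lb R]_x f x.
Proof.
move=> bf If f0; rewrite lebI_Rint; last exact: (proj1 bf).
have If' := integrableS measurableT (measurable_itv `[p, q]) (@subsetT _ _) If.
apply: fine_le; [exact: integrable_fin_num|exact: integrable_fin_num|].
apply: ge0_subset_integral => //; first exact: measurable_int If.
by move=> x _; rewrite lee_fin.
Qed.

Lemma Rint_le d (T : measurableType d) (R : realType) (m : {finite_measure set T -> \bar R})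
  (f g : T -> R) : bm f -> bm g -> (forall x, f x <= g x) ->
  \int[m]_x f x <= \int[m]_x g x.
Proof. by move=> bf bg fg; apply: le_Rintegral => //; exact: bm_int. Qed.

Lemma Rint_le_cst d (T : measurableType d) (R : realType) (m : {finite_measure set T -> \bar R})
  (f : T -> R) (M : R) : bm f -> (forall x, f x <= M) ->
  \int[m]_x f x <= M * fine (m setT).
Proof.
move=> bf fg; rewrite -(Rintegral_cst m measurableT M).
exact: (Rint_le m bf (bm_cst _ M)).
Qed.

Lemma lebI_FTC (R : realType) (p q : R) (F g : R -> R) : p < q ->
  (forall x : R, is_derive x 1 F (g x)) -> continuous g ->
  \int[lebI p q]_x g x = F q - F p.
Proof.
move=> pq dF cg; have mg : measurable_fun setT g by exact: continuous_measurable_fun.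
have cF : continuous F.
  by apply: derivable_cont => x; exact: (@ex_derive _ _ _ _ _ _ _ (dF x)).
rewrite lebI_Rint// /Rintegral -(@lb_integral _ `[p, q])//; last by apply/measurable_EFinP.
rewrite (@continuous_FTC2 _ g F)//.
- exact: continuous_subspaceT.
- split=> [x _||]; first exact: (@ex_derive _ _ _ _ _ _ _ (dF x)).
    by apply: cvg_at_right_filter; exact: cF.
  by apply: cvg_at_left_filter; exact: cF.
- by move=> x _; exact: derive1_val.
Qed.

Lemma conv_mass_le (R : realType) (p q s n : R) (f : R -> R) : bm f -> Int (lb R) f ->
  (forall x, 0 <= f x) -> \int[lb R]_x f x <= n -> \int[lebI p q]_x f (s - x) <= n.
Proof.
move=> bf If f0 fn.
have bf' : bm (fun x : R => f (s - x)) by apply: (bm_comp bf); exact: measurable_rsub.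
have If' : Int (lb R) (fun x : R => f (s - x)).
  apply: (lb_push_int (p := fun x => s - x)) => //; first exact: measurable_rsub.
  by move=> a b ab; exact: refl_preim.
apply: le_trans (lebI_le_lb p q bf' If' _) _ => //.
by rewrite lb_refl//; exact: (proj1 bf).
Qed.

(** At a single point the mollified measure may be as large as the kernels; integrated over the
    centre [(t, x)] it costs only the kernel masses times the total mass of [nu]. This is Fubini,
    and it makes the div-curl bound uniform in the scale. *)
Lemma conv_mass2_le d (T : measurableType d) (R : realType) (nu : {finite_measure set T -> \bar R})
  (pi1 pi2 : T -> R) (f1 f2 : R -> R) (p1 q1 p2 q2 n1 n2 : R) :
  measurable_fun setT pi1 -> measurable_fun setT pi2 ->
  bm f1 -> bm f2 -> Int (lb R) f1 -> Int (lb R) f2 ->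
  (forall x, 0 <= f1 x) -> (forall x, 0 <= f2 x) ->
  \int[lb R]_x f1 x <= n1 -> \int[lb R]_x f2 x <= n2 ->
  \int[lebI p1 q1]_t \int[lebI p2 q2]_x \int[nu]_z (f1 (pi1 z - t) * f2 (pi2 z - x))
    <= n1 * n2 * fine (nu setT).
Proof.
move=> m1 m2 b1 b2 I1 I2 f10 f20 N1 N2.
have n20 : 0 <= n2 by rewrite (le_trans _ N2)//; exact: Rintegral_ge0.
have B1 : bm (fun w : R * T => f1 (pi1 w.2 - w.1)).
  apply: (bm_comp b1); apply: measurable_funB => //.
  exact: (measurableT_comp m1 measurable_snd).
have B2 : bm (fun w : R * T => f2 (pi2 w.2 - w.1)).
  apply: (bm_comp b2); apply: measurable_funB => //.
  exact: (measurableT_comp m2 measurable_snd).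
have B1' t : bm (fun z : T => f1 (pi1 z - t)) by exact: (bm_pair1 t B1).
have B2' t : bm (fun z : T => f2 (pi2 z - t)) by exact: (bm_pair1 t B2).
have B3 : bm (fun w : (R * R) * T => f1 (pi1 w.2 - w.1.1) * f2 (pi2 w.2 - w.1.2)).
  apply: bmM.
    apply: (bm_comp (p := fun w : (R * R) * T => (w.1.1, w.2)) B1).
    apply: measurable_fun_pair => //.
    exact: (measurableT_comp measurable_fst measurable_fst).
  apply: (bm_comp (p := fun w : (R * R) * T => (w.1.2, w.2)) B2).
  apply: measurable_fun_pair => //.
  exact: (measurableT_comp measurable_snd measurable_fst).
have B4 : bm (fun w : R * R => \int[nu]_z (f1 (pi1 z - w.1) * f2 (pi2 z - w.2))).
  exact: (bm_Rint nu B3).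
have B5 : bm (fun t : R => \int[lebI p2 q2]_x \int[nu]_z (f1 (pi1 z - t) * f2 (pi2 z - x))).
  exact: (bm_Rint (lebI p2 q2) B4).
have B6 : bm (fun t : R => \int[nu]_z (f1 (pi1 z - t) * n2)).
  apply: (bm_Rint nu (F := fun w : R * T => f1 (pi1 w.2 - w.1) * n2)).
  by apply: bmM => //; exact: bm_cst.
apply: (@le_trans _ _ (\int[lebI p1 q1]_t \int[nu]_z (f1 (pi1 z - t) * n2))).
  apply: Rint_le => // t.
  rewrite (bm_swap (lebI p2 q2) nu (F := fun (x : R) (z : T) => f1 (pi1 z - t) * f2 (pi2 z - x))); last first.
    by apply: bmM => //; apply: (bm_comp (p := snd) (B1' t)).
  have B7 : bm (fun y => f1 (pi1 y - t) * (\int[lebI p2 q2]_x f2 (pi2 y - x))).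
    apply: bmM => //.
    apply: (bm_Rint (lebI p2 q2) (F := fun w : T * R => f2 (pi2 w.1 - w.2))).
    by apply: (bm_comp (p := fun w : T * R => (w.2, w.1)) B2); exact: measurable_swap.
  have E y : \int[lebI p2 q2]_x (f1 (pi1 y - t) * f2 (pi2 y - x)) =
       f1 (pi1 y - t) * (\int[lebI p2 q2]_x f2 (pi2 y - x)).
    by rewrite RintegralZl//; apply: bm_int; exact: (bm_pair2 y B2).
  under eq_Rintegral do rewrite E.
  apply: Rint_le => //; first by apply: bmM => //; exact: bm_cst.
  by move=> z; apply: ler_wpM2l => //; exact: conv_mass_le.
rewrite (bm_swap (lebI p1 q1) nu (F := fun (t : R) (z : T) => f1 (pi1 z - t) * n2)); last first.
  by apply: bmM => //; exact: bm_cst.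
apply: Rint_le_cst.
  apply: (bm_Rint (lebI p1 q1) (F := fun w : T * R => f1 (pi1 w.1 - w.2) * n2)).
  apply: bmM; last exact: bm_cst.
  by apply: (bm_comp (p := fun w : T * R => (w.2, w.1)) B1); exact: measurable_swap.
move=> z; rewrite RintegralZr//; last by apply: bm_int; exact: (bm_pair2 z B1).
by apply: ler_wpM2r => //; exact: conv_mass_le.
Qed.

(* [d_t a + d_x b] is bounded by [S] times the image of [nu] under [(pi1, pi2)]; test functions are
   tensor products, which is all that mollification needs. *)
Definition weak_eq d (T : measurableType d) (R : realType)
  (nu : {finite_measure set T -> \bar R}) (pi1 pi2 : T -> R) (S P1 Q1 P2 Q2 : R)
  (a b : R * R -> R) : Prop :=
  forall k1 k2 : R -> R, ker P1 Q1 k1 -> ker P2 Q2 k2 ->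
  `| \int[prodm (lb R) (lb R)]_z (derive1 k1 z.1 * (k2 z.2 * a z)) +
     \int[prodm (lb R) (lb R)]_z (k1 z.1 * (derive1 k2 z.2 * b z)) |
  <= S * \int[nu]_q (`|k1 (pi1 q)| * `|k2 (pi2 q)|).

(** The translated kernels are themselves admissible test functions; the four inequalities keep
    their supports in the box. *)
Lemma weak_moll d (T : measurableType d) (R : realType)
  (nu : {finite_measure set T -> \bar R}) (pi1 pi2 : T -> R) (S P1 Q1 P2 Q2 : R)
  (a b : R * R -> R) (l1 u1 l2 u2 : R) (k1 k2 : R -> R) (t x : R) :
  weak_eq nu pi1 pi2 S P1 Q1 P2 Q2 a b -> ker l1 u1 k1 -> ker l2 u2 k2 ->
  P1 <= l1 + t -> u1 + t <= Q1 -> P2 <= l2 + x -> u2 + x <= Q2 ->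
  `|moll (derive1 k1) k2 a t x + moll k1 (derive1 k2) b t x| <=
  S * \int[nu]_q (`|k1 (pi1 q - t)| * `|k2 (pi2 q - x)|).
Proof.
move=> W kk1 kk2 h1 h2 h3 h4.
have D (k : R -> R) l u c : ker l u k -> derive1 (fun z => k (z - c)) = fun z => derive1 k (z - c).
  move=> [Ck _]; apply: derive1_eq => z; apply: is_derive_sub.
  exact/is_derive1_derive/Cinf_derivable.
have := W _ _ (kerW h1 h2 (ker_shift t kk1)) (kerW h3 h4 (ker_shift x kk2)).
by rewrite (D _ _ _ _ kk1) (D _ _ _ _ kk2).
Qed.

Lemma is_derive_fN (R : realType) (f : R -> R) (x a : R) :
  is_derive x 1 f a -> is_derive x 1 (fun y => - f y) (- a).
Proof. by move=> H; exact: is_deriveN. Qed.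

Lemma derivable_of (R : realType) (f : R -> R) (x a : R) : is_derive x 1 f a -> derivable f x 1.
Proof. by move=> H; exact: (@ex_derive _ _ _ _ _ _ _ H). Qed.

Lemma RintD_bm d (T : measurableType d) (R : realType) (m : {finite_measure set T -> \bar R})
  (f g : T -> R) : bm f -> bm g ->
  \int[m]_x (f x + g x) = \int[m]_x f x + \int[m]_x g x.
Proof. by move=> bf bg; rewrite RintegralD//; exact: bm_int. Qed.

Lemma RintZ_bm d (T : measurableType d) (R : realType) (m : {finite_measure set T -> \bar R})
  (c : R) (f : T -> R) : bm f -> \int[m]_x (c * f x) = c * \int[m]_x f x.
Proof. by move=> bf; rewrite RintegralZl//; exact: bm_int. Qed.

Lemma Rint2D d1 d2 (T1 : measurableType d1) (T2 : measurableType d2) (R : realType)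
  (m1 : {finite_measure set T1 -> \bar R}) (m2 : {finite_measure set T2 -> \bar R})
  (F G : T1 -> T2 -> R) : bm (fun z => F z.1 z.2) -> bm (fun z => G z.1 z.2) ->
  \int[m1]_x \int[m2]_y (F x y + G x y) =
  \int[m1]_x \int[m2]_y F x y + \int[m1]_x \int[m2]_y G x y.
Proof.
move=> bF bG; rewrite -RintD_bm; [|exact: (bm_Rint m2 bF)|exact: (bm_Rint m2 bG)].
by apply: eq_Rintegral => x _; rewrite RintD_bm; [|exact: (bm_pair1 x bF)|exact: (bm_pair1 x bG)].
Qed.

Lemma Rint2Z d1 d2 (T1 : measurableType d1) (T2 : measurableType d2) (R : realType)
  (m1 : {finite_measure set T1 -> \bar R}) (m2 : {finite_measure set T2 -> \bar R})
  (c : R) (F : T1 -> T2 -> R) : bm (fun z => F z.1 z.2) ->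
  \int[m1]_x \int[m2]_y (c * F x y) = c * \int[m1]_x \int[m2]_y F x y.
Proof.
move=> bF; rewrite -RintZ_bm; last exact: (bm_Rint m2 bF).
by apply: eq_Rintegral => x _; rewrite RintZ_bm//; exact: (bm_pair1 x bF).
Qed.

Lemma lebI2_abs_le (R : realType) (p1 q1 p2 q2 : R) (H G : R -> R -> R) :
  bm (fun z => H z.1 z.2) -> bm (fun z => G z.1 z.2) ->
  (forall t x, p1 <= t <= q1 -> p2 <= x <= q2 -> `|H t x| <= G t x) ->
  `|\int[lebI p1 q1]_t \int[lebI p2 q2]_x H t x| <= \int[lebI p1 q1]_t \int[lebI p2 q2]_x G t x.
Proof.
move=> bH bG HG.
have bH' := bm_Rint (lebI p2 q2) bH; have bG' := bm_Rint (lebI p2 q2) bG.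
rewrite (le_trans (le_normr_Rintegral _ _))//; first exact: bm_int.
apply: lebI_le_in => //; first exact: (bm_norm bH').
move=> t tpq; rewrite (le_trans (le_normr_Rintegral _ _))//.
  exact: (bm_int _ (bm_pair1 t bH)).
apply: lebI_le_in; [exact: (bm_norm (bm_pair1 t bH))|exact: (bm_pair1 t bG)|].
by move=> x; exact: HG.
Qed.

Definition bdd_int (R : realType) (M : R) (u : R * R -> R) : Prop :=
  [/\ bm u, Int (prodm (lb R) (lb R)) u & forall z, `|u z| <= M].

Definition mdiff (R : realType) (e1 e2 : R -> R) (y : R) (u : R * R -> R) (t x : R) : R :=
  moll e1 e2 u t (x + y) - moll e1 e2 u t x.

Lemma lebI2_bound (R : realType) (p1 q1 p2 q2 B : R) (G : R -> R -> R) :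
  p1 < q1 -> bm (fun z => G z.1 z.2) -> (forall t, `|\int[lebI p2 q2]_x G t x| <= B) ->
  `|\int[lebI p1 q1]_t \int[lebI p2 q2]_x G t x| <= B * (q1 - p1).
Proof.
move=> pq bG GB; rewrite (_ : q1 - p1 = fine (lebI p1 q1 setT)); last by rewrite lebI_setT// ltW.
apply: Rint_bound => //.
exact: (proj1 (bm_Rint (lebI p2 q2) bG)).
Qed.

(** Write [Du] for [mdiff e1 e2 y u] and let [Rr] be the potential with [d_x Rr = Da0]. The wedge is
    [d_x (Rr Db1) + d_t (Rr Da1)] plus divergence terms. The first two integrate to boundary values
    of size [O(y)]. Each of the others is a product of a bounded field with a divergence tested
    against a kernel of mass [O(y)], or of [Rr] with a divergence tested against a kernel of bounded
    mass. *)
Lemma divcurl_moll d (T : measurableType d) (R : realType)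
  (nu : {finite_measure set T -> \bar R}) (pi1 pi2 : T -> R) (S p1 q1 p2 q2 r M y c : R)
  (a0 b0 a1 b1 : R * R -> R) (e1 e2 ka : R -> R) :
  measurable_fun setT pi1 -> measurable_fun setT pi2 -> 0 <= S ->
  bdd_int M a0 -> bdd_int M b0 -> bdd_int M a1 -> bdd_int M b1 ->
  weak_eq nu pi1 pi2 S (p1 - r) (q1 + r) (p2 - r) (q2 + r) a0 b0 ->
  weak_eq nu pi1 pi2 S (p1 - r) (q1 + r) (p2 - r) (q2 + r) a1 b1 ->
  p1 < q1 -> p2 < q2 -> 0 <= y -> c + y <= r ->
  ker (- c) c e1 -> ker (- c) c e2 -> ker (- c) (c + y) ka ->
  (forall z, derive1 ka z = e2 z - e2 (z - y)) ->
  \int[lb R]_s `|e1 s| <= 1 -> \int[lb R]_s `|e2 s| <= 1 -> \int[lb R]_s `|ka s| <= y ->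
  `| \int[lebI p1 q1]_t \int[lebI p2 q2]_x
      (mdiff e1 e2 y a0 t x * mdiff e1 e2 y b1 t x - mdiff e1 e2 y b0 t x * mdiff e1 e2 y a1 t x) |
  <= (4 * M ^+ 2 * (q1 - p1 + (q2 - p2)) + 4 * M * S * fine (nu setT)) * y.
Proof.
move=> mp1 mp2 S0 Na0 Nb0 Na1 Nb1 W0 W1 pq1 pq2 y0 cyr ke1 ke2 kka dka n1 n2 nk.
(* The supports [[- c, c]] and [[- c, c + y]], moved to a centre in the rectangle, stay within the
   margin [r]. *)
have aux t x : p1 <= t <= q1 -> p2 <= x <= q2 ->
    [/\ p1 - r <= - c + t, c + t <= q1 + r, p2 - r <= - c + x & c + y + x <= q2 + r].
  by clear -y0 cyr; move=> h1 h2; split; lra.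
have ke1' := ker_derive ke1; have kka' := ker_derive kka; have kka'' := ker_derive kka'.
have B1 := ker_bm ke1; have B2 := ker_bm ke2; have Bk := ker_bm kka.
have B1' := ker_bm ke1'; have Bk' := ker_bm kka'; have Bk'' := ker_bm kka''.
have I1 := ker_int ke1; have I2 := ker_int ke2; have Ik := ker_int kka.
have I1' := ker_int ke1'; have Ik' := ker_int kka'; have Ik'' := ker_int kka''.
have M0 : 0 <= M by case: Na0 => _ _ H; rewrite (le_trans _ (H (0, 0))).
(* Through [ka] the increment of a mollified field becomes one mollification, by the derivative of a
   kernel. *)
have DE (u : R * R -> R) (t x : R) : bdd_int M u -> mdiff e1 e2 y u t x = - moll e1 (derive1 ka) u t x.
  move=> [bu Iu _]; rewrite (_ : derive1 ka = fun z => e2 z - e2 (z - y)); last exact/funext.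
  rewrite moll_sub2//; last by apply: (bm_comp B2); exact: (measurable_addr (- y)).
  by rewrite moll_shift2 opprB.
have Dx (u : R * R -> R) (t x : R) : bdd_int M u ->
    is_derive x 1 (fun x => mdiff e1 e2 y u t x) (moll e1 (derive1 (derive1 ka)) u t x).
  move=> Nu; rewrite (_ : (fun x => _) = fun x => - moll e1 (derive1 ka) u t x); last first.
    by apply/funext => z; exact: DE.
  rewrite -[moll _ _ _ _ _]opprK; apply: is_derive_fN.
  by case: Nu => bu Iu _; exact: (moll_derive2 _ _ B1 kka' Iu).
have Dt (u : R * R -> R) (t x : R) : bdd_int M u ->
    is_derive t 1 (fun t => mdiff e1 e2 y u t x) (moll (derive1 e1) (derive1 ka) u t x).
  move=> Nu; rewrite (_ : (fun t => _) = fun t => - moll e1 (derive1 ka) u t x); last first.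
    by apply/funext => z; exact: DE.
  rewrite -[moll _ _ _ _ _]opprK; apply: is_derive_fN.
  by case: Nu => bu Iu _; exact: (moll_derive1 _ _ ke1 Bk' Iu).
have Db (u : R * R -> R) (t x : R) : bdd_int M u -> `|mdiff e1 e2 y u t x| <= 2 * M.
  move=> [bu Iu HM]; rewrite /mdiff (le_trans (ler_normB _ _))//.
  have H (s : R) := moll_bound t s B1 B2 I1 I2 Iu HM n1 n2.
  by have := H (x + y); have := H x; lra.
(* [Rr] is a primitive of [Da0] in [x], and its size is [M * y] because [ka] has mass at most
   [y]. *)
pose Rr := moll e1 ka a0.
have Rb (t x : R) : `|Rr t x| <= M * y.
  by case: Na0 => bu Iu HM; have := moll_bound t x B1 Bk I1 Ik Iu HM n1 nk; rewrite mul1r.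
have Rx (t x : R) : is_derive x 1 (fun x => Rr t x) (mdiff e1 e2 y a0 t x).
  by rewrite DE//; case: Na0 => bu Iu _; exact: (moll_derive2 _ _ B1 kka Iu).
have Rt (t x : R) : is_derive t 1 (fun t => Rr t x) (- moll (derive1 e1) ka a0 t x).
  by case: Na0 => bu Iu _; exact: (moll_derive1 _ _ ke1 Bk Iu).
have bmR : bm (fun q : R * R => Rr q.1 q.2).
  by case: Na0 => bu Iu _; exact: bm_moll.
have bmd (u : R * R -> R) : bdd_int M u -> bm (fun q : R * R => mdiff e1 e2 y u q.1 q.2).
  move=> [bu Iu _]; apply: bmB; last exact: bm_moll.
  apply: (bm_comp (p := fun q : R * R => (q.1, q.2 + y)) (bm_moll B1 B2 I1 I2 Iu bu)).
  by apply: measurable_fun_pair => //; apply: measurable_funD.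
have bme (u : R * R -> R) : bdd_int M u -> bm (fun q : R * R => moll e1 (derive1 (derive1 ka)) u q.1 q.2).
  by move=> [bu Iu _]; exact: bm_moll.
have bme1 (u : R * R -> R) : bdd_int M u -> bm (fun q : R * R => moll (derive1 e1) (derive1 ka) u q.1 q.2).
  by move=> [bu Iu _]; exact: bm_moll.
have bme2 (u : R * R -> R) : bdd_int M u -> bm (fun q : R * R => moll (derive1 e1) ka u q.1 q.2).
  by move=> [bu Iu _]; exact: bm_moll.
have bme3 (u : R * R -> R) : bdd_int M u -> bm (fun q : R * R => moll e1 (derive1 ka) u q.1 q.2).
  by move=> [bu Iu _]; exact: bm_moll.
pose G1 (t x : R) := mdiff e1 e2 y a0 t x * mdiff e1 e2 y b1 t x
  + Rr t x * moll e1 (derive1 (derive1 ka)) b1 t x.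
pose G2 (t x : R) := - moll (derive1 e1) ka a0 t x * mdiff e1 e2 y a1 t x
  + Rr t x * moll (derive1 e1) (derive1 ka) a1 t x.
(* [E0] and [E1] are the two weak equations tested with [e1] and [ka], respectively with [e1] and
   [derive1 ka]; only these terms see the measure. *)
pose E0 (t x : R) := moll (derive1 e1) ka a0 t x + moll e1 (derive1 ka) b0 t x.
pose E1 (t x : R) := moll (derive1 e1) (derive1 ka) a1 t x + moll e1 (derive1 (derive1 ka)) b1 t x.
pose H (t x : R) := E0 t x * mdiff e1 e2 y a1 t x - Rr t x * E1 t x.
have PE (t x : R) : mdiff e1 e2 y a0 t x * mdiff e1 e2 y b1 t x
    - mdiff e1 e2 y b0 t x * mdiff e1 e2 y a1 t x = (G1 t x + G2 t x) + H t x.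
  by rewrite /H /G1 /G2 /E0 /E1 (DE b0)//; ring.
have bG1 : bm (fun q : R * R => G1 q.1 q.2).
  by apply: bmD; apply: bmM => //; [exact: bmd|exact: bmd|exact: bme].
have bG2 : bm (fun q : R * R => G2 q.1 q.2).
  apply: bmD; apply: bmM => //; [apply: bmN; exact: bme2|exact: bmd|exact: bme1].
have bE0 : bm (fun q : R * R => E0 q.1 q.2) by apply: bmD; [exact: bme2|exact: bme3].
have bE1 : bm (fun q : R * R => E1 q.1 q.2) by apply: bmD; [exact: bme1|exact: bme].
have bH : bm (fun q : R * R => H q.1 q.2).
  by apply: bmB; apply: bmM => //; exact: bmd.
rewrite (_ : \int[_]_t _ = \int[lebI p1 q1]_t \int[lebI p2 q2]_x ((G1 t x + G2 t x) + H t x)); last first.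
  by apply: eq_Rintegral => t _; apply: eq_Rintegral => x _; exact: PE.
rewrite Rint2D//; last by apply: bmD.
rewrite Rint2D//.
have V0 : 0 <= fine (nu setT) by exact: fine_ge0.
have Fb (u : R * R -> R) (t x : R) : bdd_int M u -> `|Rr t x * mdiff e1 e2 y u t x| <= 2 * M ^+ 2 * y.
  move=> Nu; rewrite normrM (_ : _ * y = (M * y) * (2 * M)); last by ring.
  by apply: ler_pM => //; exact: Db.
(* For every [t] there are two boundary values of [Rr Db1], each at most [M * y] times [2 * M]. *)
have T1 : `|\int[lebI p1 q1]_t \int[lebI p2 q2]_x G1 t x| <= 4 * M ^+ 2 * y * (q1 - p1).
  apply: lebI2_bound => // t.
  have dG (x : R) : is_derive x 1 (fun x => Rr t x * mdiff e1 e2 y b1 t x) (G1 t x).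
    exact: (is_derive_fM (Rx t x) (Dx b1 t x Nb1)).
  have cG : continuous (G1 t).
    case: (Nb1) => bu Iu _; apply: derivable_cont => x.
    exact: (derivable_of (is_derive_fD (is_derive_fM (Dx a0 t x Na0) (Dx b1 t x Nb1))
      (is_derive_fM (Rx t x) (moll_derive2 t x B1 kka'' Iu)))).
  rewrite (lebI_FTC pq2 dG cG) (le_trans (ler_normB _ _))//.
  by have := Fb _ t q2 Nb1; have := Fb _ t p2 Nb1; lra.
have T2 : `|\int[lebI p1 q1]_t \int[lebI p2 q2]_x G2 t x| <= 4 * M ^+ 2 * y * (q2 - p2).
  have bG2' : bm (fun q : R * R => G2 q.2 q.1).
    exact: (bm_comp (p := fun q : R * R => (q.2, q.1)) bG2 (@measurable_swap _ _ _ _)).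
  rewrite (bm_swap (lebI p1 q1) (lebI p2 q2) (F := G2) bG2).
  apply: (lebI2_bound (G := fun x t : R => G2 t x) pq2 bG2').
  move=> x.
  have dG (t : R) : is_derive t 1 (fun t => Rr t x * mdiff e1 e2 y a1 t x) (G2 t x).
    exact: (is_derive_fM (Rt t x) (Dt a1 t x Na1)).
  have cG : continuous (G2 ^~ x).
    case: (Na1) => bu Iu _; case: (Na0) => bu0 Iu0 _; apply: derivable_cont => t.
    exact: (derivable_of (is_derive_fD
      (is_derive_fM (is_derive_fN (moll_derive1 t x ke1' Bk Iu0)) (Dt a1 t x Na1))
      (is_derive_fM (Rt t x) (moll_derive1 t x ke1' Bk' Iu)))).
  rewrite (lebI_FTC pq1 dG cG) (le_trans (ler_normB _ _))//.
  by have := Fb _ q1 x Na1; have := Fb _ p1 x Na1; lra.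
have T3 : `|\int[lebI p1 q1]_t \int[lebI p2 q2]_x H t x| <= 4 * M * S * fine (nu setT) * y.
  pose N (k : R -> R) (t x : R) := \int[nu]_q (`|e1 (pi1 q - t)| * `|k (pi2 q - x)|).
  have bN (k : R -> R) : bm k -> bm (fun z : R * R => N k z.1 z.2).
    move=> bk; apply: (bm_Rint nu (F := fun w : (R * R) * T => `|e1 (pi1 w.2 - w.1.1)| * `|k (pi2 w.2 - w.1.2)|)).
    apply: bmM; apply: bm_norm.
      apply: (bm_comp B1); apply: measurable_funB.
        exact: (measurableT_comp mp1 measurable_snd).
      exact: (measurableT_comp measurable_fst measurable_fst).
    apply: (bm_comp bk); apply: measurable_funB.
      exact: (measurableT_comp mp2 measurable_snd).
    exact: (measurableT_comp measurable_snd measurable_fst).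
  (* [derive1 ka] has mass at most 2 and not [O(y)]; the factor [y] of this term comes from [Rr],
     which multiplies it. *)
  have nk' : \int[lb R]_s `|derive1 ka s| <= 2.
    have I3 : Int (lb R) (fun s => e2 (s - y)) by exact: int_shift.
    apply: (@le_trans _ _ (\int[lb R]_s (`|e2 s| + `|e2 (s - y)|))).
      apply: le_Rintegral => //; [exact: int_norm|by apply: intD; exact: int_norm|].
      by move=> s _; rewrite dka ler_normB.
    rewrite RintegralD//; [|exact: int_norm|exact: (int_norm I3)].
    rewrite (lb_shift (- y) (f := fun s => `|e2 s|)); last exact: (proj1 (bm_norm B2)).
    by rewrite (_ : 2 = 1 + 1)//; apply: lerD.
  have C1 := conv_mass2_le nu p1 q1 p2 q2 mp1 mp2 (bm_norm B1) (bm_norm Bk) (int_norm I1) (int_norm Ik)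
    (fun x => normr_ge0 _) (fun x => normr_ge0 _) n1 nk.
  have C2 := conv_mass2_le nu p1 q1 p2 q2 mp1 mp2 (bm_norm B1) (bm_norm Bk') (int_norm I1) (int_norm Ik')
    (fun x => normr_ge0 _) (fun x => normr_ge0 _) n1 nk'.
  have le1 := lebI2_abs_le (p1 := p1) (q1 := q1) (p2 := p2) (q2 := q2) (H := H)
    (G := fun (t x : R) => 2 * M * S * N ka t x + M * y * S * N (derive1 ka) t x) bH.
  apply: (le_trans (le1 _ _)).
  - by apply: bmD; apply: bmM; [exact: bm_cst|exact: bN|exact: bm_cst|exact: bN].
  - move=> t x tpq xpq; rewrite (le_trans (ler_normB _ _))// !normrM.
    have [g1 g2 g3 g4] := aux t x tpq xpq.
    have h0 : `|E0 t x| <= S * N ka t x.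
      exact: (weak_moll W0 ke1 kka).
    have h1 : `|E1 t x| <= S * N (derive1 ka) t x.
      exact: (weak_moll W1 ke1 kka').
    apply: lerD.
      rewrite (_ : 2 * M * S * _ = (S * N ka t x) * (2 * M)); last by ring.
      by apply: ler_pM => //; exact: Db.
    rewrite (_ : M * y * S * _ = (M * y) * (S * N (derive1 ka) t x)); last by ring.
    by apply: ler_pM.
  rewrite Rint2D//; last 2 first.
  - by apply: bmM; [exact: bm_cst|exact: bN].
  - by apply: bmM; [exact: bm_cst|exact: bN].
  rewrite !Rint2Z//; [|exact: bN|exact: bN].
  rewrite (_ : 4 * M * S * fine (nu setT) * y =
     2 * M * S * (1 * y * fine (nu setT)) + M * y * S * (1 * 2 * fine (nu setT))); last by ring.
  apply: lerD; apply: ler_wpM2l => //.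
  - by rewrite !mulr_ge0.
  - by rewrite !mulr_ge0.
rewrite (le_trans (ler_normD _ _))//.
rewrite (_ : (4 * M ^+ 2 * (q1 - p1 + (q2 - p2)) + 4 * M * S * fine (nu [set: T])) * y =
  4 * M ^+ 2 * y * (q1 - p1) + 4 * M ^+ 2 * y * (q2 - p2) + 4 * M * S * fine (nu [set: T]) * y); last by ring.
apply: lerD => //; rewrite (le_trans (ler_normD _ _))//.
exact: lerD.
Qed.

(** * Removing the mollification *)

Lemma cvg_seq_at_right (R : realType) (u : R^nat) : (forall n, 0 < u n) ->
  u n @[n --> \oo] --> 0 -> u n @[n --> \oo] --> 0^'+.
Proof.
move=> u0 cu A A0; have := cu _ A0.
by rewrite /nbhs/=; apply: filterS => n /=; apply.
Qed.

Lemma cvg_harm (R : realType) (c : R) : c / n.+1%:R @[n --> \oo] --> 0.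
Proof.
by rewrite -(mulr0 c); apply: cvgM; [exact: cvg_cst|exact: cvg_harmonic].
Qed.

(** The height [B (n + 1)], against a support of width of order [1 / (n + 1)], bounds the kernels by
    averages over balls, as Lebesgue differentiation requires. *)
Definition moll_seq (R : realType) (c B : R) (e : nat -> R -> R) : Prop :=
  forall n, [/\ ker (- (c / n.+1%:R)) (c / n.+1%:R) (e n), forall z, 0 <= e n z,
    \int[lb R]_z e n z = 1 & forall z, e n z <= B * n.+1%:R].

Lemma Rint_abs_le d (T : measurableType d) (R : realType) (m : {measure set T -> \bar R})
  (f : T -> R) : Int m f -> (`|\int[m]_x f x|%:E <= \int[m]_x `|f x|%:E)%E.
Proof.
move=> If; rewrite EFin_normr_Rintegral//; apply: le_abse_integral => //.
exact: measurable_int If.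
Qed.

Lemma bm_locally_int (R : realType) (g : R -> R) : bm g -> locally_integrable [set: R] g.
Proof.
move=> [mg [M gM]]; split => //; first exact: openT.
move=> K _ cK; apply: (@le_lt_trans _ _ (\int[lebesgue_measure]_(x in K) M%:E)%E).
  apply: ge0_le_integral => //.
  - exact: compact_measurable.
  - apply: measurable_funTS; apply/measurable_EFinP; exact: (measurableT_comp _ mg).
  - by move=> x _; rewrite lee_fin.
rewrite integral_cst//; last exact: compact_measurable.
apply: lte_mul_pinfty => //; first by rewrite lee_fin (le_trans _ (gM 0)).
exact: compact_finite_measure.
Qed.

Lemma moll_seq_cvg_pt (R : realType) (c B : R) (e : nat -> R -> R) (g : R -> R) (t : R) :
  0 < c -> 0 <= B -> moll_seq c B e -> bm g -> lebesgue_pt g t ->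
  \int[lb R]_s (e n (s - t) * g s) @[n --> \oo] --> g t.
Proof.
move=> c0 B0 He bg Hg.
(* Twice the radius of the support, so that the closed support lies in the open ball. The ball has
   length [4 c / (n + 1)], which times the height [B (n + 1)] gives the constant [4 c B]. *)
pose r n : R := (2 * c) / n.+1%:R.
have r0 n : 0 < r n by rewrite divr_gt0// mulr_gt0.
have cr : davg g t (r n) @[n --> \oo] --> 0%E.
  have h := cvg_seq_at_right r0 (cvg_harm (2 * c)).
  exact: (cvg_comp _ _ h Hg).
have bgt : bm (fun s => `|g s - g t|) by apply: bm_norm; apply: bmB => //; exact: bm_cst.
have key n : (`| (\int[lb R]_s (e n (s - t) * g s)) - g t |%:E <= (4 * c * B)%:E * davg g t (r n))%E.
  have [ke e0 e1 eB] := He n.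
  have Ie := ker_int ke; have be := ker_bm ke.
  have bs : bm (fun s : R => e n (s - t)) by apply: (bm_comp be); exact: (measurable_addr (- t)).
  have Is : Int (lb R) (fun s => e n (s - t)) by exact: int_shift.
  have I1 : Int (lb R) (fun s => e n (s - t) * g s).
    rewrite (_ : (fun s => _) = fun s => g s * e n (s - t)); last by apply/funext => s; rewrite mulrC.
    exact: int_bmM.
  have I2 : Int (lb R) (fun s => e n (s - t) * g t).
    rewrite (_ : (fun s => _) = fun s => g t * e n (s - t)); last by apply/funext => s; rewrite mulrC.
    exact: (int_bmM (f := fun=> g t) (bm_cst _ _) Is).
  have E1 : \int[lb R]_s (e n (s - t) * g t) = g t.
    by rewrite RintegralZr// (lb_shift (- t))// ?e1 ?mul1r//; exact: (proj1 be).
  rewrite -{1}E1 -RintegralB//.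
  apply: (le_trans (Rint_abs_le (intB I1 I2))).
  have mb : measurable (ball t (r n)) by exact: measurable_ball.
  apply: (@le_trans _ _ (\int[lb R]_(s in ball t (r n)) ((B * n.+1%:R)%:E * `|g s - g t|%:E))%E).
    rewrite [leRHS]integral_mkcond/=; apply: ge0_le_integral => //.
    - apply/measurable_EFinP; 
      exact: (proj1 (bm_norm (bmB (bmM bs bg) (bmM bs (bm_cst _ (g t)))))).
    - apply: (measurable_restrictT _ mb).1; apply: measurable_funTS.
      apply/measurable_EFinP; exact: (proj1 (bmM (bm_cst _ (B * n.+1%:R)) bgt)).
    - move=> s _; rewrite patchE -mulrBr normrM ger0_norm//; case: ifPn => [_|].
        by rewrite -EFinM lee_fin ler_wpM2r.
      rewrite notin_setE => nb; rewrite (proj2 ke) ?mul0r//.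
      move: nb; rewrite /ball/= => /negP; rewrite -leNgt => rts.
      have hc : c / n.+1%:R < r n.
        by rewrite /r ltr_pM2r ?invr_gt0// ltr_pMl// ltr1n.
      move: rts; rewrite ler_normr => /orP[h|h]; [left|right].
        by rewrite ltrNr opprB; exact: lt_le_trans hc h.
      by rewrite opprB in h; exact: lt_le_trans hc h.
  rewrite ge0_integralZl//; last 2 first.
  - by apply: measurable_funTS; apply/measurable_EFinP; exact: (proj1 bgt).
  - by rewrite lee_fin mulr_ge0.
  rewrite /davg /iavg -lb_integral//; last by apply/measurable_EFinP; exact: (proj1 bgt).
  rewrite (lebesgue_measure_ball _ (ltW (r0 n))) muleA.
  rewrite inver ifF; last by rewrite gt_eqF// mulrn_wgt0.
  rewrite -EFinM le_eqVlt; apply/orP; left; apply/eqP; congr (_ * _)%E.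
  congr EFin; rewrite /r; field.
  by rewrite gt_eqF//= gt_eqF.
have c2 : ((4 * c * B)%:E * davg g t (r n))%E @[n --> \oo] --> 0%E.
  by rewrite -(mule0 (4 * c * B)%:E); apply: cvgeZl.
have c3 : (`| (\int[lb R]_s (e n (s - t) * g s)) - g t |%:E)%E @[n --> \oo] --> 0%E.
  apply: squeeze_cvge c2; last exact: cvg_cst.
  by apply: nearW => n; rewrite key andbT lee_fin.
have c4 := fine_cvg c3.
by apply/subr_cvg0; apply: norm_cvg0; exact: c4.
Qed.

Lemma lb_ae (R : realType) (P : R -> Prop) :
  {ae (@lebesgue_measure R), forall x, P x} -> {ae lb R, forall x, P x}.
Proof. by move=> [A [mA A0 PA]]; exists A. Qed.

Lemma lb_ae_shift (R : realType) (P : R -> Prop) (y : R) :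
  {ae lb R, forall x, P x} -> {ae lb R, forall x, P (x + y)}.
Proof.
move=> [A [mA A0 PA]]; exists ((fun x => x + y) @^-1` A).
have my := measurable_addr y.
have mA' : measurable ((fun x : R => x + y) @^-1` A) by rewrite -[X in measurable X]setTI; exact: my.
split => //; last by move=> x; exact: PA.
rewrite /= -A0; apply/esym.
apply: (@lb_unique R (measure_function_pushforward__canonical__measure_function_Measure (lb R) my)) => //.
by move=> a b ab; exact: shift_preim.
Qed.

Lemma moll_seq_cvg_ae (R : realType) (c B : R) (e : nat -> R -> R) (g : R -> R) :
  0 < c -> 0 <= B -> moll_seq c B e -> bm g ->
  {ae lb R, forall t, \int[lb R]_s (e n (s - t) * g s) @[n --> \oo] --> g t}.
Proof.
move=> c0 B0 He bg; apply: lb_ae.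
have [A [mA A0 HA]] := lebesgue_differentiation (bm_locally_int bg).
exists A; split => // t Ht; apply: HA => Hg; apply: Ht.
exact: (moll_seq_cvg_pt c0 B0 He bg).
Qed.

Lemma DCT_bm d (T : measurableType d) (R : realType) (m : {finite_measure set T -> \bar R})
  (F : nat -> T -> R) (G : T -> R) (M : R) :
  (forall n, measurable_fun setT (F n)) -> (forall n x, `|F n x| <= M) -> measurable_fun setT G ->
  {ae m, forall x, F n x @[n --> \oo] --> G x} ->
  \int[m]_x F n x @[n --> \oo] --> \int[m]_x G x.
Proof.
move=> mF FM mG FG.
have H1 n : measurable_fun setT (fun x => (F n x)%:E) by apply/measurable_EFinP.
have H2 : measurable_fun setT (fun x => (G x)%:E) by apply/measurable_EFinP.
have H3 : {ae m, forall x, setT x -> (F n x)%:E @[n --> \oo] --> (G x)%:E}.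
  by apply: filterS FG => x h _; apply: cvg_EFin => //; exact: nearW.
have H4 : m.-integrable setT (EFin \o (fun=> M)) by exact: (bm_int m (bm_cst _ M)).
have H5 : {ae m, forall x n, setT x -> (`|(F n x)%:E| <= (EFin \o (fun=> M)) x)%E}.
  by apply: aeW => x n _; rewrite /= lee_fin.
have [iG _ H6] := dominated_convergence measurableT H1 H2 H3 H4 H5.
apply: fine_cvg; rewrite fineK; last exact: integrable_fin_num.
exact: H6.
Qed.

(** Dominated convergence in the inner variable for each [t], then in the outer one. Convergence
    almost everywhere on each line of constant [t] is what one-dimensional differentiation
    provides. *)
Lemma lim_step2 d1 d2 (T1 : measurableType d1) (T2 : measurableType d2) (R : realType)
  (m1 : {finite_measure set T1 -> \bar R}) (m2 : {finite_measure set T2 -> \bar R})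
  (F : nat -> T1 -> T2 -> R) (G : T1 -> T2 -> R) (M : R) :
  (forall n, bm (fun z => F n z.1 z.2)) -> (forall n t x, `|F n t x| <= M) ->
  bm (fun z => G z.1 z.2) ->
  (forall t, {ae m2, forall x, F n t x @[n --> \oo] --> G t x}) ->
  \int[m1]_t \int[m2]_x F n t x @[n --> \oo] --> \int[m1]_t \int[m2]_x G t x.
Proof.
move=> bF FM bG FG.
apply: (DCT_bm (M := M * fine (m2 setT))).
- by move=> n; exact: (proj1 (bm_Rint m2 (bF n))).
- by move=> n t; apply: Rint_bound => //; exact: (proj1 (bm_pair1 t (bF n))).
- exact: (proj1 (bm_Rint m2 bG)).
- apply: aeW => t; apply: (DCT_bm (M := M)) => //.
  + by move=> n; exact: (proj1 (bm_pair1 t (bF n))).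
  + exact: (proj1 (bm_pair1 t bG)).
Qed.

Lemma lim_step1 d1 d2 (T1 : measurableType d1) (T2 : measurableType d2) (R : realType)
  (m1 : {finite_measure set T1 -> \bar R}) (m2 : {finite_measure set T2 -> \bar R})
  (F : nat -> T1 -> T2 -> R) (G : T1 -> T2 -> R) (M : R) :
  (forall n, bm (fun z => F n z.1 z.2)) -> (forall n t x, `|F n t x| <= M) ->
  bm (fun z => G z.1 z.2) ->
  (forall x, {ae m1, forall t, F n t x @[n --> \oo] --> G t x}) ->
  \int[m1]_t \int[m2]_x F n t x @[n --> \oo] --> \int[m1]_t \int[m2]_x G t x.
Proof.
move=> bF FM bG FG; rewrite (bm_swap m1 m2 bG).
under eq_fun do rewrite (bm_swap m1 m2 (bF _)).
have sw (H : T1 -> T2 -> R) : bm (fun z => H z.1 z.2) -> bm (fun z : T2 * T1 => H z.2 z.1).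
  by move=> bH; exact: (bm_comp (p := fun q : T2 * T1 => (q.2, q.1)) bH (@measurable_swap _ _ _ _)).
apply: (lim_step2 (F := fun n x t => F n t x) (G := fun x t => G t x) (M := M)) => //.
- by move=> n; exact: sw.
- exact: sw.
Qed.

Lemma cvg_norm_le (R : realType) (u : R^nat) (l K : R) :
  u n @[n --> \oo] --> l -> (\forall n \near \oo, `|u n| <= K) -> `|l| <= K.
Proof.
move=> ul uK; apply: (ler_cvg_to (cvg_norm ul) (@cvg_cst R K nat \oo _)) => //.
Qed.

(** Mollification in [x] alone is the intermediate stage: when the two mollifiers are removed one at
    a time, Lebesgue differentiation on the line suffices. *)
Definition sec_moll (R : realType) (k : R -> R) (u : R * R -> R) (t x : R) : R :=
  \int[lb R]_s (k (s - x) * u (t, s)).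

Lemma sec_moll_int (R : realType) (k : R -> R) (u : R * R -> R) (t x : R) :
  Int (lb R) k -> bm u -> Int (lb R) (fun s => k (s - x) * u (t, s)).
Proof.
move=> Ik bu; rewrite (_ : (fun s => _) = fun s => u (t, s) * k (s - x)); last first.
  by apply/funext => s; rewrite mulrC.
by apply: int_bmM; [exact: (bm_pair1 t bu)|exact: int_shift].
Qed.

Lemma moll_sec (R : realType) (k1 k2 : R -> R) (u : R * R -> R) (t x : R) :
  bm k1 -> bm k2 -> Int (lb R) k2 -> bm u -> Int (prodm (lb R) (lb R)) u ->
  moll k1 k2 u t x = \int[lb R]_s (k1 (s - t) * sec_moll k2 u s x).
Proof.
move=> b1 b2 I2 bu Iu; rewrite /moll (Fubini_Rint1 (moll_int t x b1 b2 Iu))/=.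
by apply: eq_Rintegral => s _; rewrite RintegralZl//; exact: sec_moll_int.
Qed.

Lemma sec_moll_bound (R : realType) (k : R -> R) (u : R * R -> R) (M t x : R) :
  bm k -> Int (lb R) k -> bm u -> (forall z, `|u z| <= M) ->
  `|sec_moll k u t x| <= M * \int[lb R]_s `|k s|.
Proof.
move=> bk Ik bu HM; have Is := sec_moll_int t x Ik bu.
rewrite (le_trans (le_normr_Rintegral _ Is))//.
rewrite -(lb_shift (- x) (proj1 (bm_norm bk))) -RintegralZl//; last exact: (int_norm (int_shift x Ik)).
apply: le_Rintegral => //; first exact: int_norm.
- by apply: (int_bmM (f := fun=> M)); [exact: bm_cst|exact: (int_norm (int_shift x Ik))].
- by move=> s _; rewrite normrM mulrC ler_wpM2r.
Qed.

Lemma bm_sec_moll (R : realType) (k : R -> R) (u : R * R -> R) :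
  bm k -> Int (lb R) k -> bm u -> bm (fun q : R * R => sec_moll k u q.1 q.2).
Proof.
move=> bk Ik bu; split.
  pose F := fun r : (R * R) * R => k (r.2 - r.1.2) * u (r.1.1, r.2).
  suff mF : measurable_fun setT F by exact: (meas_Rint (lb R) mF).
  apply: measurable_funM.
    apply: (measurableT_comp (proj1 bk)); apply: measurable_funB => //.
    exact: (measurableT_comp measurable_snd measurable_fst).
  apply: (measurableT_comp (proj1 bu)); apply: measurable_fun_pair => //.
  exact: (measurableT_comp measurable_fst measurable_fst).
have [_ [M HM]] := bu; exists (M * \int[lb R]_s `|k s|) => q.
exact: sec_moll_bound.
Qed.

Definition xdiff (R : realType) (u : R -> R -> R) (y t x : R) : R := u t (x + y) - u t x.

Lemma bm_xdiff (R : realType) (u : R -> R -> R) (y : R) : bm (fun q => u q.1 q.2) ->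
  bm (fun q => xdiff u y q.1 q.2).
Proof.
move=> bu; apply: bmB => //.
apply: (bm_comp (p := fun q : R * R => (q.1, q.2 + y)) bu).
by apply: measurable_fun_pair => //; apply: measurable_funD.
Qed.

Lemma xdiff_bound (R : realType) (u : R -> R -> R) (y t x M : R) :
  (forall s z, `|u s z| <= M) -> `|xdiff u y t x| <= 2 * M.
Proof.
move=> uM; rewrite (le_trans (ler_normB _ _))//.
by have := uM t (x + y); have := uM t x; lra.
Qed.

Definition xwedge (R : realType) (a0 b0 a1 b1 : R -> R -> R) (y t x : R) : R :=
  xdiff a0 y t x * xdiff b1 y t x - xdiff b0 y t x * xdiff a1 y t x.

Lemma bm_xwedge (R : realType) (a0 b0 a1 b1 : R -> R -> R) (y : R) :
  bm (fun q => a0 q.1 q.2) -> bm (fun q => b0 q.1 q.2) ->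
  bm (fun q => a1 q.1 q.2) -> bm (fun q => b1 q.1 q.2) ->
  bm (fun q => xwedge a0 b0 a1 b1 y q.1 q.2).
Proof. by move=> *; apply: bmB; apply: bmM; exact: bm_xdiff. Qed.

Lemma xwedge_bound (R : realType) (a0 b0 a1 b1 : R -> R -> R) (y t x M : R) :
  (forall s z, `|a0 s z| <= M) -> (forall s z, `|b0 s z| <= M) ->
  (forall s z, `|a1 s z| <= M) -> (forall s z, `|b1 s z| <= M) ->
  `|xwedge a0 b0 a1 b1 y t x| <= 8 * M ^+ 2.
Proof.
move=> h1 h2 h3 h4; rewrite (le_trans (ler_normB _ _))// !normrM.
rewrite (_ : 8 * M ^+ 2 = (2 * M) * (2 * M) + (2 * M) * (2 * M)); last by ring.
by apply: lerD; apply: ler_pM => //; exact: xdiff_bound.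
Qed.

Lemma xdiff_cvg (R : realType) (u : nat -> R -> R -> R) (v : R -> R -> R) (y t x : R) :
  u n t (x + y) @[n --> \oo] --> v t (x + y) -> u n t x @[n --> \oo] --> v t x ->
  xdiff (u n) y t x @[n --> \oo] --> xdiff v y t x.
Proof. by move=> h1 h2; apply: cvgB. Qed.

Lemma xwedge_cvg (R : realType) (a0 b0 a1 b1 : nat -> R -> R -> R) (c0 d0 c1 d1 : R -> R -> R) (y t x : R) :
  xdiff (a0 n) y t x @[n --> \oo] --> xdiff c0 y t x ->
  xdiff (b0 n) y t x @[n --> \oo] --> xdiff d0 y t x ->
  xdiff (a1 n) y t x @[n --> \oo] --> xdiff c1 y t x ->
  xdiff (b1 n) y t x @[n --> \oo] --> xdiff d1 y t x ->
  xwedge (a0 n) (b0 n) (a1 n) (b1 n) y t x @[n --> \oo] --> xwedge c0 d0 c1 d1 y t x.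
Proof. by move=> h1 h2 h3 h4; apply: cvgB; apply: cvgM. Qed.

(** The wedge is quadratic, so weak limits would not do; convergence almost everywhere with uniform
    bounds is used instead. With [n2] fixed the mollifier in [t] is removed, then the one in [x].
    The bound is assumed from some [N] on, once the supports are small enough for the margin. *)
Lemma xwedge_moll_lim (R : realType) (e : nat -> R -> R) (c B M K y p1 q1 p2 q2 : R)
  (a0 b0 a1 b1 : R * R -> R) :
  0 < c -> 0 <= B -> moll_seq c B e ->
  bdd_int M a0 -> bdd_int M b0 -> bdd_int M a1 -> bdd_int M b1 ->
  (exists N, forall n1 n2, (N <= n1)%N -> (N <= n2)%N ->
    `|\int[lebI p1 q1]_t \int[lebI p2 q2]_x
       xwedge (moll (e n1) (e n2) a0) (moll (e n1) (e n2) b0)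
              (moll (e n1) (e n2) a1) (moll (e n1) (e n2) b1) y t x| <= K) ->
  `|\int[lebI p1 q1]_t \int[lebI p2 q2]_x
     xwedge (curry a0) (curry b0) (curry a1) (curry b1) y t x| <= K.
Proof.
move=> c0 B0 He Na0 Nb0 Na1 Nb1 [N HN].
have be n : bm (e n) by have [ke _ _ _] := He n; exact: (ker_bm ke).
have Ie n : Int (lb R) (e n) by have [ke _ _ _] := He n; exact: (ker_int ke).
have ne n : \int[lb R]_s `|e n s| <= 1.
  have [_ e0 e1 _] := He n; rewrite -e1 le_eqVlt; apply/orP; left; apply/eqP.
  by apply: eq_Rintegral => s _; rewrite ger0_norm.
have bmo (u : R * R -> R) n1 n2 : bdd_int M u -> bm (fun q : R * R => moll (e n1) (e n2) u q.1 q.2).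
  by move=> [bu Iu _]; exact: bm_moll.
have mb (u : R * R -> R) n1 n2 (t x : R) : bdd_int M u -> `|moll (e n1) (e n2) u t x| <= M.
  move=> [bu Iu HM].
  by have := moll_bound t x (be n1) (be n2) (Ie n1) (Ie n2) Iu HM (ne n1) (ne n2); rewrite !mulr1.
have bse (u : R * R -> R) n2 : bdd_int M u -> bm (fun q : R * R => sec_moll (e n2) u q.1 q.2).
  by move=> [bu _ _]; exact: bm_sec_moll.
have M0 : 0 <= M by case: Na0 => _ _ H; rewrite (le_trans _ (H (0, 0))).
have sb (u : R * R -> R) n2 (t x : R) : bdd_int M u -> `|sec_moll (e n2) u t x| <= M.
  move=> [bu _ HM]; rewrite (le_trans (sec_moll_bound t x (be n2) (Ie n2) bu HM))//.
  exact: ler_piMr.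
have bcu (u : R * R -> R) : bdd_int M u -> bm (fun q : R * R => curry u q.1 q.2).
  by move=> [bu _ _]; rewrite (_ : (fun q => _) = u)//; apply/funext => -[].
(* For fixed [x], [sec_moll (e n2) u] is a bounded function of [t], and [moll] is its mollification
   in [t]. *)
have c1 (u : R * R -> R) n2 (x : R) : bdd_int M u ->
    {ae lb R, forall t, moll (e n) (e n2) u t x @[n --> \oo] --> sec_moll (e n2) u t x}.
  move=> Nu; have bg : bm (fun s => sec_moll (e n2) u s x) by exact: (bm_pair2 x (bse u n2 Nu)).
  have := moll_seq_cvg_ae c0 B0 He bg; apply: filterS => t.
  by case: Nu => bu Iu _; under [X in X @ _ --> _ -> _]eq_fun do rewrite -moll_sec//.
have c2 (u : R * R -> R) (t : R) : bdd_int M u ->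
    {ae lb R, forall x, sec_moll (e n) u t x @[n --> \oo] --> curry u t x}.
  by move=> [bu _ _]; exact: (moll_seq_cvg_ae c0 B0 He (bm_pair1 t bu)).
have d1 (u : R * R -> R) n2 (x : R) : bdd_int M u ->
    {ae lebI p1 q1, forall t, xdiff (moll (e n) (e n2) u) y t x @[n --> \oo] -->
       xdiff (sec_moll (e n2) u) y t x}.
  move=> Nu; apply: lebI_ae; apply: filterS2 (c1 u n2 (x + y) Nu) (c1 u n2 x Nu) => t h1 h2.
  exact: (xdiff_cvg (u := fun n => moll (e n) (e n2) u)).
(* The increment requires convergence at [x + y] as well, hence the translated null set. *)
have d2 (u : R * R -> R) (t : R) : bdd_int M u ->
    {ae lebI p2 q2, forall x, xdiff (sec_moll (e n) u) y t x @[n --> \oo] --> xdiff (curry u) y t x}.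
  move=> Nu; apply: lebI_ae; apply: filterS2 (lb_ae_shift y (c2 u t Nu)) (c2 u t Nu) => x h1 h2.
  exact: (xdiff_cvg (u := fun n => sec_moll (e n) u)).
have st1 n2 : (N <= n2)%N -> `|\int[lebI p1 q1]_t \int[lebI p2 q2]_x
   xwedge (sec_moll (e n2) a0) (sec_moll (e n2) b0) (sec_moll (e n2) a1) (sec_moll (e n2) b1) y t x| <= K.
  move=> Nn2; apply: (cvg_norm_le (u := fun n1 => \int[lebI p1 q1]_t \int[lebI p2 q2]_x
       xwedge (moll (e n1) (e n2) a0) (moll (e n1) (e n2) b0)
              (moll (e n1) (e n2) a1) (moll (e n1) (e n2) b1) y t x)); last first.
    by exists N => // n1 Nn1; exact: HN.
  apply: (lim_step1 (M := 8 * M ^+ 2)).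
  - by move=> n; apply: bm_xwedge; exact: bmo.
  - by move=> n t x; apply: xwedge_bound => s z; exact: mb.
  - by apply: bm_xwedge; exact: bse.
  - move=> x; have h1 := d1 a0 n2 x Na0; have h2 := d1 b0 n2 x Nb0.
    have h3 := d1 a1 n2 x Na1; have h4 := d1 b1 n2 x Nb1.
    apply: filterS2 (filterI h1 h2) (filterI h3 h4) => t [g1 g2] [g3 g4].
    exact: (xwedge_cvg (a0 := fun n => moll (e n) (e n2) a0) (b0 := fun n => moll (e n) (e n2) b0)
      (a1 := fun n => moll (e n) (e n2) a1) (b1 := fun n => moll (e n) (e n2) b1)).
apply: (cvg_norm_le (u := fun n2 => \int[lebI p1 q1]_t \int[lebI p2 q2]_x
   xwedge (sec_moll (e n2) a0) (sec_moll (e n2) b0) (sec_moll (e n2) a1) (sec_moll (e n2) b1) y t x)); last first.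
  by exists N.
apply: (lim_step2 (M := 8 * M ^+ 2)).
- by move=> n; apply: bm_xwedge; exact: bse.
- by move=> n t x; apply: xwedge_bound => s z; exact: sb.
- by apply: bm_xwedge; exact: bcu.
- move=> t; have h1 := d2 a0 t Na0; have h2 := d2 b0 t Nb0.
  have h3 := d2 a1 t Na1; have h4 := d2 b1 t Nb1.
  apply: filterS2 (filterI h1 h2) (filterI h3 h4) => x [g1 g2] [g3 g4].
  exact: (xwedge_cvg (a0 := fun n => sec_moll (e n) a0) (b0 := fun n => sec_moll (e n) b0)
    (a1 := fun n => sec_moll (e n) a1) (b1 := fun n => sec_moll (e n) b1)).
Qed.

(** * Construction of the kernels: the potential and the approximate identity *)

Lemma Cinf_neg (R : realType) (k : R -> R) : Cinf k -> Cinf (fun y => k (- y)).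
Proof.
move=> Ck n; rewrite (_ : (fun y => _) = fun y => k (0 + -1 * y)); first exact: Cn_aff.
by apply/funext => y; rewrite add0r mulN1r.
Qed.

Lemma ker_neg (R : realType) (c : R) (k : R -> R) : ker (- c) c k -> ker (- c) c (fun y => k (- y)).
Proof.
move=> [Ck sk]; split; first exact: Cinf_neg.
by move=> x [h|h]; apply: sk; [right|left]; lra.
Qed.

(* The potential: its derivative is the increment [k z - k (z - y)], its mass is [O(y)]. *)
Definition slide (R : realType) (y : R) (k : R -> R) (z : R) : R := \int[lebI 0 y]_s k (z - s).

(** This is [conv_derive] on [lebI 0 y] for the reflected kernel [k (- z)]. Reflection changes the
    sign of the derivative and cancels the minus sign of [conv_derive]. *)
Lemma slide_derive (R : realType) (y c : R) (k : R -> R) (z : R) : ker (- c) c k ->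
  is_derive z 1 (slide y k) (slide y (derive1 k) z).
Proof.
move=> kk; have kn := ker_neg kk.
have E (v : R) : derive1 (fun y => k (- y)) v = - derive1 k (- v).
  apply: derive1_val.
  have H : is_derive (0 - v) 1 k (derive1 k (- v)).
    by rewrite sub0r; apply: is_derive1_derive; apply: Cinf_derivable; exact: (proj1 kk).
  have := is_derive_rsub H.
  by rewrite (_ : (fun y => k (0 - y)) = fun y => k (- y))//; apply/funext => w; rewrite sub0r.
have I1 : Int (lebI 0 y) (fun=> 1 : R) by exact: (bm_int _ (bm_cst _ 1)).
have H := @conv_derive _ _ _ (lebI 0 y) idfun (fun=> 1) _ _ _ z kn (@measurable_id _ _ _) I1.
have E1 : (fun t => \int[lebI 0 y]_s (k (- (s - t)) * 1)) = slide y k.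
  by apply/funext => t; apply: eq_Rintegral => s _; rewrite mulr1 opprB.
rewrite -E1; apply: (is_derive_eq H).
rewrite -mulN1r -RintZ_bm; last first.
  apply: bmM; last exact: bm_cst.
  by apply: (bm_comp (ker_bm (ker_derive kn))); exact: (measurable_addr (- z)).
by apply: eq_Rintegral => s _; rewrite E mulr1 mulN1r opprK opprB.
Qed.

Lemma slide_Cinf (R : realType) (y c : R) (k : R -> R) : ker (- c) c k -> Cinf (slide y k).
Proof.
move=> kk n; elim: n k kk => [//|n IH] k kk; split.
  by move=> x; exact: (derivable_of (slide_derive y x kk)).
have -> : derive1 (slide y k) = slide y (derive1 k).
  by apply: derive1_eq => x; exact: slide_derive kk.
by apply: IH; exact: ker_derive.
Qed.

Lemma slide_supp (R : realType) (y c : R) (k : R -> R) : ker (- c) c k ->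
  supp_in (- c) (c + y) (slide y k).
Proof.
move=> kk x hx; rewrite /slide lebI_Rint; last first.
  by apply: (proj1 (bm_comp (ker_bm kk) _)); exact: measurable_rsub.
rewrite (_ : \int[_]_(s in _) _ = \int[lb R]_(s in `[0, y]) 0); first by rewrite Rintegral_cst// mul0r.
apply: eq_Rintegral => s; rewrite inE/= in_itv/= => /andP[s0 sy].
by apply: (proj2 kk); case: hx => h; [left|right]; lra.
Qed.

(** By Fubini, each [s] in [[0, y]] contributes the mass of one translate of [k], which is at most
    1. *)
Lemma slide_mass (R : realType) (y c : R) (k : R -> R) : 0 < y -> ker (- c) c k ->
  (forall z, 0 <= k z) -> \int[lb R]_z k z <= 1 -> \int[lb R]_z `|slide y k z| <= y.
Proof.
move=> y0 kk k0 k1; have bk := ker_bm kk; have Ik := ker_int kk.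
have sl0 z : 0 <= slide y k z by apply: Rintegral_ge0.
have ks : ker (- c) (c + y) (slide y k) by split; [exact: slide_Cinf kk|exact: slide_supp].
have bs := ker_bm ks.
have -> : \int[lb R]_z `|slide y k z| = \int[lebI (- c) (c + y)]_z slide y k z.
  rewrite lebI_Rint; last exact: (proj1 bs).
  rewrite [RHS]Rintegral_mkcond; apply: eq_Rintegral => z _; rewrite ger0_norm// patchE.
  case: ifPn => // /negP nz; apply: (proj2 ks).
  case: (ltP z (- c)) => [|h1]; first by left.
  by case: (ltP (c + y) z) => [|h2]; [right|exfalso; apply: nz; rewrite inE/= in_itv/= h1 h2].
have bk2 : bm (fun w : R * R => k (w.1 - w.2)) by apply: (bm_comp bk); exact: measurable_funB.
rewrite /slide (bm_swap (lebI (- c) (c + y)) (lebI 0 y) (F := fun z s : R => k (z - s)) bk2).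
rewrite -[leRHS]mul1r -[X in _ * X]subr0 -(lebI_setT (ltW y0)).
apply: Rint_le_cst.
  apply: (bm_Rint (lebI (- c) (c + y)) (F := fun w : R * R => k (w.2 - w.1))).
  exact: (bm_comp (p := fun q : R * R => (q.2, q.1)) bk2 (@measurable_swap _ _ _ _)).
move=> s; have bsh : bm (fun z : R => k (z - s)) by exact: (bm_pair2 s bk2).
rewrite (le_trans (lebI_le_lb _ _ bsh (int_shift s Ik) (fun z => k0 _)))//.
by rewrite (lb_shift (- s) (proj1 bk)).
Qed.

(** The derivative of [k (z - s)] in [z] is minus its derivative in [s], so the integral over
    [[0, y]] reduces to its end points. *)
Lemma slide_derive1 (R : realType) (y c : R) (k : R -> R) : 0 < y -> ker (- c) c k ->
  forall z, derive1 (slide y k) z = k z - k (z - y).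
Proof.
move=> y0 kk z; rewrite (derive1_val (slide_derive y z kk)).
have kk' := ker_derive kk.
have dF (s : R) : is_derive s 1 (fun s => - k (z - s)) (derive1 k (z - s)).
  rewrite -[derive1 k _]opprK; apply: is_derive_fN; apply: is_derive_rsub.
  by apply: is_derive1_derive; apply: Cinf_derivable; exact: (proj1 kk).
have cF : continuous (fun s : R => derive1 k (z - s)).
  apply: derivable_cont => s.
  apply: (@derivable_of _ _ _ (- derive1 (derive1 k) (z - s))); apply: is_derive_rsub.
  by apply: is_derive1_derive; apply: Cinf_derivable; exact: (proj1 kk').
by rewrite /slide (lebI_FTC y0 dF cF) subr0 opprK addrC.
Qed.

(** Dilates of [q] divided by their masses. Near 0 the values of [q] are at least half of [q 0];
    this bounds the masses from below and thereby the heights from above. *)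
Lemma moll_seq_exists (R : realType) (q : R -> R) (c : R) : ker (- c) c q ->
  (forall z, 0 <= q z) -> 0 < q 0 -> exists B e, 0 <= B /\ moll_seq c B e.
Proof.
move=> kq q0 qp; have bq := ker_bm kq; have Iq := ker_int kq.
have [_ [Sq HS]] := bq.
have cq := Cinf_cont (proj1 kq).
have q2 : 0 < q 0 / 2 by rewrite divr_gt0.
have [d d0 Hd] : exists2 d : R, 0 < d & forall z, `|z| <= d -> q 0 / 2 <= q z.
  have /cvgrPdist_le /(_ _ q2) := cq 0.
  move=> [d /= d0 H]; exists (d / 2); first by rewrite divr_gt0.
  move=> z zd; have := H z; rewrite /= sub0r normrN => /(_ (le_lt_trans zd _)).
  have -> : d / 2 < d by lra.
  move=> /(_ isT) h; have := ler_norm (q 0 - q z); move: h; clear; lra.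
have N0 n : 0 < (n.+1%:R : R) by rewrite ltr0n.
pose k n (z : R) := q (0 + n.+1%:R * z).
have kk n : ker (- (c / n.+1%:R)) (c / n.+1%:R) (k n).
  split; first by move=> m; apply: Cn_aff; exact: (proj1 kq).
  move=> x hx; rewrite /k add0r; apply: (proj2 kq); case: hx => h; [left|right].
    by rewrite mulrC -ltr_pdivlMr// mulNr.
  by rewrite mulrC -ltr_pdivrMr.
pose m n := \int[lb R]_z k n z.
(* On [|x| <= d / (n + 1)] the dilate is at least [q 0 / 2], and this interval has length
   [2 d / (n + 1)]. *)
have m_ge n : q 0 * d / n.+1%:R <= m n.
  have bk := ker_bm (kk n); have Ik := ker_int (kk n).
  apply: le_trans (lebI_le_lb (- (d / n.+1%:R)) (d / n.+1%:R) bk Ik (fun z => q0 _)).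
  have dn : - (d / n.+1%:R) <= d / n.+1%:R by rewrite ge0_cp// divr_ge0// ltW.
  apply: (@le_trans _ _ (\int[lebI (- (d / n.+1%:R)) (d / n.+1%:R)]_x (q 0 / 2))).
    rewrite Rintegral_cst// lebI_setT// le_eqVlt; apply/orP; left; apply/eqP.
    by field; rewrite gt_eqF.
  apply: lebI_le_in => //; first exact: bm_cst.
  move=> x /andP[h1 h2]; apply: Hd; rewrite add0r normrM (gtr0_norm (N0 n)) mulrC -ler_pdivlMr//.
  by rewrite ler_norml h1 h2.
have m0 n : 0 < m n by apply: lt_le_trans (m_ge n); rewrite divr_gt0// mulr_gt0.
exists (Sq / (q 0 * d)), (fun n z => (m n)^-1 * k n z).
have Sq0 : 0 <= Sq by rewrite (le_trans _ (HS 0)).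
split; first by rewrite divr_ge0// mulr_ge0// ltW.
move=> n; split.
- split; first by apply: CinfM; [exact: Cinf_cst|exact: (proj1 (kk n))].
  by move=> x hx; rewrite (proj2 (kk n) _ hx) mulr0.
- by move=> z; apply: mulr_ge0; [rewrite invr_ge0 ltW|exact: q0].
- by rewrite RintegralZl//; [rewrite mulVf// gt_eqF|exact: ker_int (kk n)].
- move=> z; rewrite (_ : _ * n.+1%:R = (q 0 * d / n.+1%:R)^-1 * Sq); last first.
    by field; rewrite !gt_eqF.
  have g0 : 0 < q 0 * d / n.+1%:R by rewrite divr_gt0// mulr_gt0.
  apply: ler_pM => //; [by rewrite invr_ge0 ltW|exact: q0|by rewrite lef_pV2 ?posrE|].
  exact: le_trans (ler_norm _) (HS _).
Qed.

(** * Div-curl estimates for bounded fields *)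

Lemma divcurl_x d (T : measurableType d) (R : realType)
  (nu : {finite_measure set T -> \bar R}) (pi1 pi2 : T -> R) (S p1 q1 p2 q2 r M y c : R)
  (q : R -> R) (a0 b0 a1 b1 : R * R -> R) :
  ker (- c) c q -> 0 < c -> (forall z, 0 <= q z) -> 0 < q 0 ->
  measurable_fun setT pi1 -> measurable_fun setT pi2 -> 0 <= S ->
  bdd_int M a0 -> bdd_int M b0 -> bdd_int M a1 -> bdd_int M b1 ->
  weak_eq nu pi1 pi2 S (p1 - r) (q1 + r) (p2 - r) (q2 + r) a0 b0 ->
  weak_eq nu pi1 pi2 S (p1 - r) (q1 + r) (p2 - r) (q2 + r) a1 b1 ->
  p1 < q1 -> p2 < q2 -> 0 < y -> y < r ->
  `| \int[lebI p1 q1]_t \int[lebI p2 q2]_x xwedge (curry a0) (curry b0) (curry a1) (curry b1) y t x |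
  <= (4 * M ^+ 2 * (q1 - p1 + (q2 - p2)) + 4 * M * S * fine (nu setT)) * y.
Proof.
move=> kq c0 q0 qp m1 m2 S0 Na0 Nb0 Na1 Nb1 W0 W1 pq1 pq2 y0 yr.
have [B [e [B0 He]]] := moll_seq_exists kq q0 qp.
apply: (xwedge_moll_lim c0 B0 He Na0 Nb0 Na1 Nb1).
have ry : 0 < r - y by rewrite subr_gt0.
(* The radius [c / (N + 1)] of the kernels plus the increment [y] must fit in the margin [r]; the
   room comes from [y < r]. *)
have [N _ HN] := (cvgrPdist_le _ _).1 (cvg_harm c) _ ry.
have cN : c / N.+1%:R + y <= r.
  have := HN N (leqnn N); rewrite /= sub0r normrN.
  by rewrite ger0_norm ?divr_ge0 ?(ltW c0)//; move=> h; rewrite -lerBrDr.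
exists N => n1 n2 Nn1 Nn2.
have mono n : (N <= n)%N -> c / n.+1%:R <= c / N.+1%:R.
  by move=> Nn; rewrite ler_pM2l// lef_pV2 ?posrE ?ltr0n// ler_nat.
have [ke1 e10 i1 _] := He n1; have [ke2 e20 i2 _] := He n2.
have ke1' := kerW (l' := - (c / N.+1%:R)) (u' := c / N.+1%:R) _ (mono n1 Nn1) ke1.
have ke2' := kerW (l' := - (c / N.+1%:R)) (u' := c / N.+1%:R) _ (mono n2 Nn2) ke2.
have {}ke1' := ke1' ltac:(by rewrite lerN2; exact: mono).
have {}ke2' := ke2' ltac:(by rewrite lerN2; exact: mono).
have ni (k : R -> R) : (forall z, 0 <= k z) -> \int[lb R]_z k z = 1 -> \int[lb R]_z `|k z| <= 1.
  move=> k0 <-; rewrite le_eqVlt; apply/orP; left; apply/eqP.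
  by apply: eq_Rintegral => z _; rewrite ger0_norm.
have kka : ker (- (c / N.+1%:R)) (c / N.+1%:R + y) (slide y (e n2)).
  by split; [exact: slide_Cinf ke2'|exact: slide_supp].
apply: (divcurl_moll m1 m2 S0 Na0 Nb0 Na1 Nb1 W0 W1 pq1 pq2 (ltW y0) cN ke1' ke2' kka).
- exact: slide_derive1 y0 ke2'.
- exact: ni.
- exact: ni.
- by apply: slide_mass y0 ke2' e20 _; rewrite i2.
Qed.

Lemma int_swap2 (R : realType) (F : R * R -> R) : Int (prodm (lb R) (lb R)) F ->
  Int (prodm (lb R) (lb R)) (fun z => F (z.2, z.1)).
Proof.
move=> /integrableP[mF Foo].
have ms : measurable_fun setT (fun z : R * R => (z.2, z.1)) by exact: measurable_swap.
have mFs : measurable_fun setT (EFin \o (fun z => F (z.2, z.1))) by exact: (measurableT_comp mF ms).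
have mA : measurable_fun setT (abse \o (EFin \o F)) by exact: measurableT_comp.
have mAs : measurable_fun setT (abse \o (EFin \o (fun z => F (z.2, z.1)))) by exact: measurableT_comp.
apply/integrableP; split=> //.
rewrite (Tonelli2 (lb R) (lb R) mAs (fun z => abse_ge0 _)).
by rewrite (Tonelli1 (lb R) (lb R) mA (fun z => abse_ge0 _)) in Foo.
Qed.

Lemma Rint_swap2 (R : realType) (F : R * R -> R) : Int (prodm (lb R) (lb R)) F ->
  \int[prodm (lb R) (lb R)]_z F (z.2, z.1) = \int[prodm (lb R) (lb R)]_z F z.
Proof. by move=> iF; rewrite (Fubini_Rint2 (int_swap2 iF)) (Fubini_Rint1 iF). Qed.

Lemma bdd_int_swap (R : realType) (M : R) (u : R * R -> R) : bdd_int M u ->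
  bdd_int M (fun z => u (z.2, z.1)).
Proof.
move=> [bu Iu HM]; split => //; last exact: int_swap2.
exact: (bm_comp (p := fun q : R * R => (q.2, q.1)) bu (@measurable_swap _ _ _ _)).
Qed.

(** Exchanging the coordinates exchanges density and flux, together with the two projections of
    [nu]. *)
Lemma weak_eq_swap d (T : measurableType d) (R : realType)
  (nu : {finite_measure set T -> \bar R}) (pi1 pi2 : T -> R) (S P1 Q1 P2 Q2 : R)
  (a b : R * R -> R) :
  Int (prodm (lb R) (lb R)) a -> Int (prodm (lb R) (lb R)) b ->
  weak_eq nu pi1 pi2 S P1 Q1 P2 Q2 a b ->
  weak_eq nu pi2 pi1 S P2 Q2 P1 Q1 (fun z => b (z.2, z.1)) (fun z => a (z.2, z.1)).
Proof.
move=> Ia Ib W k1 k2 kk1 kk2; have := W k2 k1 kk2 kk1.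
have bf (k : R -> R) : bm k -> bm (fun z : R * R => k z.1) by move=> bk; exact: (bm_comp bk).
have bs (k : R -> R) : bm k -> bm (fun z : R * R => k z.2) by move=> bk; exact: (bm_comp bk).
have B1 := ker_bm kk1; have B2 := ker_bm kk2.
have B1' := ker_bm (ker_derive kk1); have B2' := ker_bm (ker_derive kk2).
have I1 : Int (prodm (lb R) (lb R)) (fun z => derive1 k2 z.1 * (k1 z.2 * a z)).
  by apply: int_bmM; [exact: bf|apply: int_bmM => //; exact: bs].
have I2 : Int (prodm (lb R) (lb R)) (fun z => k2 z.1 * (derive1 k1 z.2 * b z)).
  by apply: int_bmM; [exact: bf|apply: int_bmM => //; exact: bs].
rewrite -(Rint_swap2 I1) -(Rint_swap2 I2)/= addrC.
rewrite (_ : \int[nu]_q (`|k2 (pi1 q)| * `|k1 (pi2 q)|) =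
  \int[nu]_q (`|k1 (pi2 q)| * `|k2 (pi1 q)|)); last by apply: eq_Rintegral => q _; rewrite mulrC.
congr (`| _ + _ | <= _); apply: eq_Rintegral => z _; ring.
Qed.

Definition tdiff (R : realType) (u : R -> R -> R) (y t x : R) : R := u (t + y) x - u t x.

Definition twedge (R : realType) (a0 b0 a1 b1 : R -> R -> R) (y t x : R) : R :=
  tdiff a0 y t x * tdiff b1 y t x - tdiff b0 y t x * tdiff a1 y t x.

Lemma bm_curry (R : realType) (u : R * R -> R) : bm u -> bm (fun q : R * R => curry u q.1 q.2).
Proof. by move=> bu; rewrite (_ : (fun q => _) = u)//; apply/funext => -[]. Qed.

(** This is [divcurl_x] in exchanged coordinates with the flux as density. The wedge only changes
    sign, and the constant is symmetric in the two sides of the rectangle. *)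
Lemma divcurl_t d (T : measurableType d) (R : realType)
  (nu : {finite_measure set T -> \bar R}) (pi1 pi2 : T -> R) (S p1 q1 p2 q2 r M y c : R)
  (q : R -> R) (a0 b0 a1 b1 : R * R -> R) :
  ker (- c) c q -> 0 < c -> (forall z, 0 <= q z) -> 0 < q 0 ->
  measurable_fun setT pi1 -> measurable_fun setT pi2 -> 0 <= S ->
  bdd_int M a0 -> bdd_int M b0 -> bdd_int M a1 -> bdd_int M b1 ->
  weak_eq nu pi1 pi2 S (p1 - r) (q1 + r) (p2 - r) (q2 + r) a0 b0 ->
  weak_eq nu pi1 pi2 S (p1 - r) (q1 + r) (p2 - r) (q2 + r) a1 b1 ->
  p1 < q1 -> p2 < q2 -> 0 < y -> y < r ->
  `| \int[lebI p1 q1]_t \int[lebI p2 q2]_x twedge (curry a0) (curry b0) (curry a1) (curry b1) y t x |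
  <= (4 * M ^+ 2 * (q1 - p1 + (q2 - p2)) + 4 * M * S * fine (nu setT)) * y.
Proof.
move=> kq c0 q0 qp m1 m2 S0 Na0 Nb0 Na1 Nb1 W0 W1 pq1 pq2 y0 yr.
have [_ Ia0 _] := Na0; have [_ Ib0 _] := Nb0; have [_ Ia1 _] := Na1; have [_ Ib1 _] := Nb1.
have H := divcurl_x kq c0 q0 qp m2 m1 S0 (bdd_int_swap Nb0) (bdd_int_swap Na0)
  (bdd_int_swap Nb1) (bdd_int_swap Na1) (weak_eq_swap Ia0 Ib0 W0) (weak_eq_swap Ia1 Ib1 W1)
  pq2 pq1 y0 yr.
rewrite [X in (4 * M ^+ 2 * X + _) * _]addrC; apply: le_trans H.
have bcs (u : R * R -> R) : bdd_int M u -> bm (fun q : R * R => curry (fun z => u (z.2, z.1)) q.1 q.2).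
  by move=> Nu; apply: bm_curry; have [bu _ _] := bdd_int_swap Nu.
have bx := bm_xwedge y (bcs b0 Nb0) (bcs a0 Na0) (bcs b1 Nb1) (bcs a1 Na1).
rewrite (bm_swap (lebI p2 q2) (lebI p1 q1) bx) le_eqVlt; apply/orP; left; apply/eqP.
rewrite -[RHS]normrN; congr `| _ |; rewrite -mulN1r -Rint2Z; last first.
  exact: (bm_comp (p := fun q : R * R => (q.2, q.1)) bx (@measurable_swap _ _ _ _)).
apply: eq_Rintegral => t _; apply: eq_Rintegral => x _.
by rewrite /twedge /tdiff /xwedge /xdiff /curry/=; ring.
Qed.

(** * Products of Lebesgue measures: from [leb] to [lb] *)

Lemma push_prod d1 d1' d2 d2' (T1 : measurableType d1) (T1' : measurableType d1')
  (T2 : measurableType d2) (T2' : measurableType d2') (R : realType)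
  (m1 : {sigma_finite_measure set T1 -> \bar R}) (m1' : {sigma_finite_measure set T1' -> \bar R})
  (m2 : {sigma_finite_measure set T2 -> \bar R}) (m2' : {sigma_finite_measure set T2' -> \bar R})
  (i1 : T1 -> T1') (i2 : T2 -> T2') :
  measurable_fun setT i1 -> measurable_fun setT i2 ->
  (forall A, measurable A -> m1' A = m1 (i1 @^-1` A)) ->
  (forall A, measurable A -> m2' A = m2 (i2 @^-1` A)) ->
  forall A, measurable A ->
  prodm m1' m2' A = prodm m1 m2 ((fun z => (i1 z.1, i2 z.2)) @^-1` A).
Proof.
move=> mi1 mi2 H1 H2 A mA.
have mi : measurable_fun setT (fun z : T1 * T2 => (i1 z.1, i2 z.2)).
  by apply: measurable_fun_pair; [exact: (measurableT_comp mi1 measurable_fst)|exact: (measurableT_comp mi2 measurable_snd)].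
pose m' := measure_function_pushforward__canonical__measure_function_Measure (prodm m1 m2) mi.
apply: (@product_measure_unique _ _ _ _ _ m1' m2' m') => // B C mB mC.
rewrite [LHS](_ : _ = prodm m1 m2 ((i1 @^-1` B) `*` (i2 @^-1` C)))//.
rewrite /prodm product_measure1E ?H1 ?H2//.
  by rewrite -[X in measurable X]setTI; exact: mi1.
by rewrite -[X in measurable X]setTI; exact: mi2.
Qed.

Lemma push_integral_ge0 d1 d1' (T1 : measurableType d1) (T1' : measurableType d1') (R : realType)
  (m1 : {measure set T1 -> \bar R}) (m1' : {measure set T1' -> \bar R}) (i : T1 -> T1')
  (F : T1' -> \bar R) :
  measurable_fun setT i -> (forall A, measurable A -> m1' A = m1 (i @^-1` A)) ->
  measurable_fun setT F -> (forall x, 0 <= F x)%E ->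
  (\int[m1]_x F (i x) = \int[m1']_x F x)%E.
Proof.
move=> mi H mF F0.
have E := @ge0_integral_pushforward _ _ _ _ R i mi m1 setT F measurableT mF (fun y _ => F0 y).
rewrite preimage_setT in E.
transitivity (\int[pushforward m1 i]_y F y)%E; first by rewrite E.
by apply: eq_measure_integral => A mA _; rewrite H.
Qed.

Lemma push_Rint d1 d1' (T1 : measurableType d1) (T1' : measurableType d1') (R : realType)
  (m1 : {measure set T1 -> \bar R}) (m1' : {measure set T1' -> \bar R}) (i : T1 -> T1')
  (F : T1' -> R) :
  measurable_fun setT i -> (forall A, measurable A -> m1' A = m1 (i @^-1` A)) ->
  measurable_fun setT F -> \int[m1]_x F (i x) = \int[m1']_x F x.
Proof.
move=> mi H mF; rewrite /Rintegral; congr fine.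
have mF' : measurable_fun setT (EFin \o F) by apply/measurable_EFinP.
rewrite integralE [RHS]integralE; congr (_ - _)%E.
- rewrite -(push_integral_ge0 mi H)//; [by apply: eq_integral => x _; rewrite ?funeposE|exact: measurable_funepos].
- rewrite -(push_integral_ge0 mi H)//; [by apply: eq_integral => x _; rewrite ?funenegE|exact: measurable_funeneg].
Qed.

(** Both types have the same points and the same measurable sets under different declared
    structures. Measurability of the identity lets image measures carry integrals and null sets
    across, one factor at a time. *)
Lemma mid1 (R : realType) : measurable_fun setT (fun x : measurableTypeR R => (x : R)).
Proof. by move=> _ A mA; rewrite setTI; exact: mA. Qed.

Lemma mid1' (R : realType) : measurable_fun setT (fun x : R => (x : measurableTypeR R)).
Proof. by move=> _ A mA; rewrite setTI; exact: mA. Qed.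

Definition lb2 (R : realType) := prodm (lb R) (lb R).
Definition lb3 (R : realType) := prodm (prodm (lb R) (lb R)) (lb R).
Definition lb4 (R : realType) := prodm (prodm (prodm (lb R) (lb R)) (lb R)) (lb R).

Arguments lb2 R : clear implicits.
Arguments lb3 R : clear implicits.
Arguments lb4 R : clear implicits.

Lemma mid2 (R : realType) :
  measurable_fun setT (fun z : measurableTypeR R * measurableTypeR R => (z : R * R)).
Proof.
rewrite (_ : (fun z => _) = fun z : measurableTypeR R * measurableTypeR R => ((z.1 : R), (z.2 : R))).
  apply: measurable_fun_pair.
    exact: (measurableT_comp (@mid1 R) measurable_fst).
  exact: (measurableT_comp (@mid1 R) measurable_snd).
by apply/funext => -[].
Qed.

Lemma mid2' (R : realType) :
  measurable_fun setT (fun z : R * R => (z : measurableTypeR R * measurableTypeR R)).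
Proof.
rewrite (_ : (fun z => _) = fun z : R * R => ((z.1 : measurableTypeR R), (z.2 : measurableTypeR R))).
  apply: measurable_fun_pair.
    exact: (measurableT_comp (@mid1' R) measurable_fst).
  exact: (measurableT_comp (@mid1' R) measurable_snd).
by apply/funext => -[].
Qed.

Lemma mid3 (R : realType) : measurable_fun setT
  (fun z : measurableTypeR R * measurableTypeR R * measurableTypeR R => (z : R * R * R)).
Proof.
rewrite (_ : (fun z => _) = fun z : measurableTypeR R * measurableTypeR R * measurableTypeR R => ((z.1 : R * R), (z.2 : R))).
  apply: measurable_fun_pair.
    exact: (measurableT_comp (@mid2 R) measurable_fst).
  exact: (measurableT_comp (@mid1 R) measurable_snd).
by apply/funext => -[].
Qed.

Lemma mid3' (R : realType) : measurable_fun setT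
  (fun z : R * R * R => (z : measurableTypeR R * measurableTypeR R * measurableTypeR R)).
Proof.
rewrite (_ : (fun z => _) = fun z : R * R * R => ((z.1 : measurableTypeR R * measurableTypeR R), (z.2 : measurableTypeR R))).
  apply: measurable_fun_pair.
    exact: (measurableT_comp (@mid2' R) measurable_fst).
  exact: (measurableT_comp (@mid1' R) measurable_snd).
by apply/funext => -[].
Qed.

Lemma mid4' (R : realType) : measurable_fun setT
  (fun z : R * R * R * R => (z : measurableTypeR R * measurableTypeR R * measurableTypeR R * measurableTypeR R)).
Proof.
rewrite (_ : (fun z => _) = fun z : R * R * R * R =>
   ((z.1 : measurableTypeR R * measurableTypeR R * measurableTypeR R), (z.2 : measurableTypeR R))).
  apply: measurable_fun_pair.
    exact: (measurableT_comp (@mid3' R) measurable_fst).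
  exact: (measurableT_comp (@mid1' R) measurable_snd).
by apply/funext => -[].
Qed.

Lemma leb2E (R : realType) : leb2 R = prodm lebesgue_measure lebesgue_measure.
Proof. by []. Qed.

Lemma leb3E (R : realType) :
  leb3 R = prodm (prodm lebesgue_measure lebesgue_measure) lebesgue_measure.
Proof. by []. Qed.

Lemma leb4E (R : realType) :
  leb4 R = prodm (prodm (prodm lebesgue_measure lebesgue_measure) lebesgue_measure) lebesgue_measure.
Proof. by []. Qed.

Lemma pair_preimage (T1 T2 : Type) (A : set (T1 * T2)) : (fun z => (z.1, z.2)) @^-1` A = A.
Proof. by apply/seteqP; split => -[]. Qed.

Lemma leb2_lb2 (R : realType) (A : set (R * R)) : measurable A -> lb2 R A = leb2 R A.
Proof.
move=> mA; have := @push_prod _ _ _ _ (measurableTypeR R) R (measurableTypeR R) R R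
  lebesgue_measure (lb R) lebesgue_measure (lb R) _ _ (@mid1 R) (@mid1 R)
  (fun _ _ => erefl) (fun _ _ => erefl) A mA.
move=> E; apply: (etrans E).
by rewrite leb2E; congr (prodm _ _ _); exact: pair_preimage.
Qed.

Lemma leb3_lb3 (R : realType) (A : set (R * R * R)) : measurable A -> lb3 R A = leb3 R A.
Proof.
move=> mA; have := @push_prod _ _ _ _ (measurableTypeR R * measurableTypeR R)%type (R * R)%type
  (measurableTypeR R) R R
  (prodm lebesgue_measure lebesgue_measure) (lb2 R) lebesgue_measure (lb R) _ _ (@mid2 R) (@mid1 R)
  (@leb2_lb2 R) (fun _ _ => erefl) A mA.
move=> E; apply: (etrans E).
by rewrite leb3E; congr (prodm _ _ _); exact: pair_preimage.
Qed.

Lemma leb4_lb4 (R : realType) (A : set (R * R * R * R)) : measurable A -> lb4 R A = leb4 R A.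
Proof.
move=> mA; have := @push_prod _ _ _ _ (measurableTypeR R * measurableTypeR R * measurableTypeR R)%type (R * R * R)%type
  (measurableTypeR R) R R
  (prodm (prodm lebesgue_measure lebesgue_measure) lebesgue_measure) (lb3 R) lebesgue_measure (lb R) _ _ (@mid3 R) (@mid1 R)
  (@leb3_lb3 R) (fun _ _ => erefl) A mA.
move=> E; apply: (etrans E).
by rewrite leb4E; congr (prodm _ _ _); exact: pair_preimage.
Qed.

Lemma leb_Rint (R : realType) (F : R -> R) : measurable_fun setT F ->
  Rintegral (leb R) setT F = \int[lb R]_x F x.
Proof.
move=> mF; rewrite /Rintegral -(@lb_integral _ setT)//; exact/measurable_EFinP.
Qed.

Lemma leb2_integral_ge0 (R : realType) (F : R * R -> \bar R) (K : set (R * R)) :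
  measurable K -> measurable_fun setT F -> (forall x, 0 <= F x)%E ->
  (\int[leb2 R]_(z in K) F z = \int[lb2 R]_(z in K) F z)%E.
Proof.
move=> mK mF F0; rewrite [LHS]integral_mkcond [RHS]integral_mkcond.
apply: (@push_integral_ge0 _ _ (measurableTypeR R * measurableTypeR R)%type (R * R)%type R
  (prodm lebesgue_measure lebesgue_measure) (lb2 R) _ _ (@mid2 R) (@leb2_lb2 R)).
- by apply: (measurable_restrictT _ mK).1; exact: measurable_funTS.
- by move=> x; rewrite patchE; case: ifP.
Qed.

Lemma leb3_Rint (R : realType) (F : R * R * R -> R) : measurable_fun setT F ->
  Rintegral (leb3 R) setT F = \int[lb3 R]_x F x.
Proof.
exact: (@push_Rint _ _ (measurableTypeR R * measurableTypeR R * measurableTypeR R)%type (R * R * R)%type R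
  (prodm (prodm lebesgue_measure lebesgue_measure) lebesgue_measure) (lb3 R) _ _ (@mid3 R) (@leb3_lb3 R)).
Qed.

Lemma leb3_ae (R : realType) (P : R * R * R -> Prop) :
  {ae leb3 R, forall p, P p} -> {ae lb3 R, forall p, P p}.
Proof.
move=> [A [mA A0 HA]].
have mA' : measurable (A : set (R * R * R)).
  by have := @mid3' R measurableT A mA; rewrite setTI.
by exists A; split => //; rewrite leb3_lb3.
Qed.

Lemma leb4_ae (R : realType) (P : R * R * R * R -> Prop) :
  {ae leb4 R, forall p, P p} -> {ae lb4 R, forall p, P p}.
Proof.
move=> [A [mA A0 HA]].
have mA' : measurable (A : set (R * R * R * R)).
  by have := @mid4' R measurableT A mA; rewrite setTI.
by exists A; split => //; rewrite leb4_lb4.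
Qed.

(** * From the kinetic equation to the moment equations *)

Definition tens (R : realType) (k1 k2 k3 : R -> R) (p : R * R * R) : R :=
  k1 p.1.1 * k2 p.1.2 * k3 p.2.

Lemma is_derive_cstl (R : realType) (c : R) (k : R -> R) (x d : R) :
  is_derive x 1 k d -> is_derive x 1 (fun y => c * k y) (c * d).
Proof.
move=> H; have := is_derive_fM (is_derive_cst c x 1) H.
by rewrite mul0r add0r.
Qed.

Lemma is_derive_cstr (R : realType) (c : R) (k : R -> R) (x d : R) :
  is_derive x 1 k d -> is_derive x 1 (fun y => k y * c) (d * c).
Proof.
move=> H; have := is_derive_fM H (is_derive_cst c x 1).
by rewrite mulr0 addr0.
Qed.

Lemma tens_isd (R : realType) (k1 k2 k3 : R -> R) (p : R * R * R) :
  Cinf k1 -> Cinf k2 -> Cinf k3 ->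
  [/\ is_derive p.1.1 1 (fun s => tens k1 k2 k3 (s, p.1.2, p.2)) (tens (derive1 k1) k2 k3 p),
      is_derive p.1.2 1 (fun s => tens k1 k2 k3 (p.1.1, s, p.2)) (tens k1 (derive1 k2) k3 p) &
      is_derive p.2 1 (fun s => tens k1 k2 k3 (p.1.1, p.1.2, s)) (tens k1 k2 (derive1 k3) p)].
Proof.
have D (k : R -> R) (x : R) : Cinf k -> is_derive x 1 k (derive1 k x).
  by move=> Ck; apply: is_derive1_derive; exact: Cinf_derivable.
move=> C1 C2 C3; rewrite /tens/=; split.
- exact: (is_derive_cstr _ (is_derive_cstr _ (D _ _ C1))).
- exact: (is_derive_cstr _ (is_derive_cstl _ (D _ _ C2))).
- exact: (is_derive_cstl _ (D _ _ C3)).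
Qed.

Lemma pd_tens (R : realType) (k1 k2 k3 : R -> R) :
  Cinf k1 -> Cinf k2 -> Cinf k3 ->
  [/\ pd Dt (tens k1 k2 k3) = tens (derive1 k1) k2 k3,
      pd Dx (tens k1 k2 k3) = tens k1 (derive1 k2) k3 &
      pd Dv (tens k1 k2 k3) = tens k1 k2 (derive1 k3)].
Proof.
move=> C1 C2 C3; split; apply/funext => p; have [h1 h2 h3] := tens_isd p C1 C2 C3.
- exact: (derive1_val h1).
- exact: (derive1_val h2).
- exact: (derive1_val h3).
Qed.

(** Tensor products of smooth functions are stable under every partial derivative, so [smooth3]
    reduces to facts in one variable. *)
Lemma iter_pd_tens (R : realType) (ds : seq dir) (k1 k2 k3 : R -> R) :
  Cinf k1 -> Cinf k2 -> Cinf k3 -> exists l1 l2 l3,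
  [/\ Cinf l1, Cinf l2, Cinf l3 & iter_pd ds (tens k1 k2 k3) = tens l1 l2 l3].
Proof.
move=> C1 C2 C3; elim: ds => [|d ds [l1 [l2 [l3 [D1 D2 D3 E]]]]]; first by exists k1, k2, k3.
rewrite /= -/(iter_pd ds _) E; have [E1 E2 E3] := pd_tens D1 D2 D3.
case: d.
- by exists (derive1 l1), l2, l3; split=> //; exact: Cinf_derive.
- by exists l1, (derive1 l2), l3; split=> //; exact: Cinf_derive.
- by exists l1, l2, (derive1 l3); split=> //; exact: Cinf_derive.
Qed.

Lemma ker_derive1n (R : realType) (l u : R) (k : R -> R) n : ker l u k -> ker l u (derive1n n k).
Proof. by move=> kk; elim: n => [//|n IH]; rewrite derive1nS; exact: ker_derive. Qed.

Lemma iter_pdv_tens (R : realType) n (l u : R) (k1 k2 k3 : R -> R) :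
  Cinf k1 -> Cinf k2 -> ker l u k3 ->
  iter_pd (nseq n Dv) (tens k1 k2 k3) = tens k1 k2 (derive1n n k3).
Proof.
move=> C1 C2 C3; elim: n => [//|n IH].
rewrite derive1nS [LHS]/= -/(iter_pd (nseq n Dv) _) IH.
by have [_ _ ->] := pd_tens C1 C2 (proj1 (ker_derive1n n C3)).
Qed.

Lemma tens_cont (R : realType) (k1 k2 k3 : R -> R) :
  continuous k1 -> continuous k2 -> continuous k3 -> continuous (tens k1 k2 k3).
Proof.
move=> c1 c2 c3 p; rewrite /tens; apply: cvgM; first apply: cvgM.
- apply: (@cvg_comp _ _ _ (fun q : R * R * R => q.1.1) k1 _ (nbhs p.1.1)); last exact: c1.
  by apply: (@cvg_comp _ _ _ fst fst _ (nbhs p.1)); exact: cvg_fst.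
- apply: (@cvg_comp _ _ _ (fun q : R * R * R => q.1.2) k2 _ (nbhs p.1.2)); last exact: c2.
  by apply: (@cvg_comp _ _ _ fst snd _ (nbhs p.1)); [exact: cvg_fst|exact: cvg_snd].
- apply: (@cvg_comp _ _ _ snd k3 _ (nbhs p.2)); last exact: c3.
  exact: cvg_snd.
Qed.

Definition box3 (R : realType) (P1 Q1 P2 Q2 L : R) : set (R * R * R) :=
  (`[P1, Q1] `*` `[P2, Q2]) `*` `[- L, L].

Lemma box3_out (R : realType) (P1 Q1 P2 Q2 L : R) (p : R * R * R) :
  ~ box3 P1 Q1 P2 Q2 L p ->
  [\/ p.1.1 < P1 \/ Q1 < p.1.1, p.1.2 < P2 \/ Q2 < p.1.2 | p.2 < - L \/ L < p.2].
Proof.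
move=> H.
case: (ltP p.1.1 P1) => h1; first by apply: Or31; left.
case: (ltP Q1 p.1.1) => h2; first by apply: Or31; right.
case: (ltP p.1.2 P2) => h3; first by apply: Or32; left.
case: (ltP Q2 p.1.2) => h4; first by apply: Or32; right.
case: (ltP p.2 (- L)) => h5; first by apply: Or33; left.
case: (ltP L p.2) => h6; first by apply: Or33; right.
by exfalso; apply: H; split; [split|]; rewrite /= in_itv/= ?h1 ?h2 ?h3 ?h4 ?h5 ?h6.
Qed.

Lemma box3_compact (R : realType) (P1 Q1 P2 Q2 L : R) : compact (box3 P1 Q1 P2 Q2 L).
Proof. by apply: compact_setX; [apply: compact_setX|]; exact: segment_compact. Qed.

Lemma box3_measurable (R : realType) (P1 Q1 P2 Q2 L : R) : measurable (box3 P1 Q1 P2 Q2 L).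
Proof. by apply: measurableX; [apply: measurableX|]; exact: measurable_itv. Qed.

Lemma tens_out (R : realType) (P1 Q1 P2 Q2 L : R) (k1 k2 k3 : R -> R) (p : R * R * R) :
  supp_in P1 Q1 k1 -> supp_in P2 Q2 k2 -> supp_in (- L) L k3 ->
  ~ box3 P1 Q1 P2 Q2 L p -> tens k1 k2 k3 p = 0.
Proof.
move=> s1 s2 s3 /box3_out[h|h|h]; rewrite /tens.
- by rewrite (s1 _ h) !mul0r.
- by rewrite (s2 _ h) mulr0 mul0r.
- by rewrite (s3 _ h) mulr0.
Qed.

Lemma box3_Omega (R : realType) (P1 Q1 P2 Q2 L : R) : 0 < P1 ->
  box3 P1 Q1 P2 Q2 L `<=` Omega3 R.
Proof.
by move=> P0 p [[/=]]; rewrite !in_itv/= => /andP[h _] _ _; exact: lt_le_trans P0 h.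
Qed.

Lemma tens_test (R : realType) (P1 Q1 P2 Q2 L : R) (k1 k2 k3 : R -> R) : 0 < P1 ->
  ker P1 Q1 k1 -> ker P2 Q2 k2 -> ker (- L) L k3 -> test_fun3 (tens k1 k2 k3).
Proof.
move=> P0 [C1 s1] [C2 s2] [C3 s3]; split.
  move=> ds; have [l1 [l2 [l3 [D1 D2 D3 ->]]]] := iter_pd_tens ds C1 C2 C3.
  split; first by apply: tens_cont; exact: Cinf_cont.
  move=> d p; have [h1 h2 h3] := tens_isd p D1 D2 D3.
  by case: d; [exact: (derivable_of h1)|exact: (derivable_of h2)|exact: (derivable_of h3)].
exists (box3 P1 Q1 P2 Q2 L); split; [exact: box3_compact|exact: box3_Omega|].
by move=> p; exact: tens_out.
Qed.

Lemma bm_tens (R : realType) (k1 k2 k3 : R -> R) : bm k1 -> bm k2 -> bm k3 -> bm (tens k1 k2 k3).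
Proof.
move=> b1 b2 b3; apply: bmM; first apply: bmM.
- exact: (bm_comp b1 (measurableT_comp measurable_fst measurable_fst)).
- exact: (bm_comp b2 (measurableT_comp measurable_snd measurable_fst)).
- exact: (bm_comp b3 measurable_snd).
Qed.

Lemma restr_int d (T : measurableType d) (R : realType) (m : {measure set T -> \bar R})
  (D : set T) (H : T -> R) : measurable D -> (m D < +oo)%E -> bm H ->
  (forall x, ~ D x -> H x = 0) -> Int m H.
Proof.
move=> mD moo bH H0.
have I1 : m.-integrable D (EFin \o H).
  apply: measurable_bounded_integrable => //; [exact: (measurable_funTS (proj1 bH))|exact: bm_bounded].
have := (integrable_mkcond _ mD).1 I1; rewrite restrict_EFin.
rewrite (_ : H \_ D = H)//; apply/funext => x; rewrite patchE; case: ifPn => // /negP xD.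
by rewrite H0// => Dx; apply: xD; rewrite inE.
Qed.

(** The two measures may be infinite on the whole space. On [D] their sum is finite, and there it
    dominates the total variation of the signed measure [m1 - m2]. *)
Lemma two_measure_bound d (T : measurableType d) (R : realType) (m1 m2 : {measure set T -> \bar R})
  (D : set T) (mD : measurable D) (moo : (measure_add m1 m2 D < +oo)%E) (H G : T -> R) (S : R) :
  bm H -> bm G -> (forall x, ~ D x -> H x = 0) -> (forall x, `|H x| <= S * G x) ->
  `|\int[m1]_x H x| + `|\int[m2]_x H x| <= S * \int[mfrestr mD moo]_x G x.
Proof.
move=> bH bG H0 HG.
have moo' : (m1 D + m2 D < +oo)%E by rewrite -measure_addE.
have o1 : (m1 D < +oo)%E by apply: le_lt_trans moo'; rewrite leeDl.
have o2 : (m2 D < +oo)%E by apply: le_lt_trans moo'; rewrite leeDr.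
have I1 := restr_int mD o1 bH H0; have I2 := restr_int mD o2 bH H0.
have bN := bm_norm bH.
have N0 x : ~ D x -> `|H x| = 0 by move=> /H0 ->; rewrite normr0.
have mN : measurable_fun setT (fun x => `|H x|%:E) by apply/measurable_EFinP; exact: (proj1 bN).
apply: (@le_trans _ _ (\int[mfrestr mD moo]_x `|H x|)); last first.
  rewrite -RintZ_bm//; apply: Rint_le => //; apply: bmM => //; exact: bm_cst.
have J1 := restr_int mD o1 bN N0; have J2 := restr_int mD o2 bN N0.
apply: (le_trans (lerD (le_normr_Rintegral measurableT I1) (le_normr_Rintegral measurableT I2))).
rewrite -lee_fin EFinD /Rintegral !fineK; last 3 first.
- by apply: integrable_fin_num => //; exact: (bm_int (mfrestr mD moo) bN).
- exact: integrable_fin_num.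
- exact: integrable_fin_num.
have E : (\int[mfrestr mD moo]_x `|H x|%:E = \int[measure_add m1 m2]_x `|H x|%:E)%E.
  rewrite frestr_integral//.
  rewrite [LHS]integral_mkcond; apply: eq_integral => x _; rewrite patchE; case: ifPn => // /negP xD.
  by rewrite N0// => Dx; apply: xD; rewrite inE.
by rewrite E ge0_integral_measure_add.
Qed.

(** For [0 <= C] this is the projection of [x] onto [[- C, C]]; written with absolute values it is
    measurable by composition. *)
Definition clamp (R : realType) (C x : R) : R := (`|x + C| - `|x - C|) / 2.

Lemma clamp_bound (R : realType) (C x : R) : 0 <= C -> `|clamp C x| <= C.
Proof.
move=> C0; rewrite /clamp normrM (@gtr0_norm _ 2^-1) ?invr_gt0// ler_pdivrMr//.
have h := ler_dist_dist (x + C) (x - C).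
rewrite (le_trans h)// (_ : x + C - (x - C) = C * 2); last by ring.
by rewrite ger0_norm// mulr_ge0.
Qed.

Lemma clamp_id (R : realType) (C x : R) : `|x| <= C -> clamp C x = x.
Proof.
rewrite ler_norml => /andP[h1 h2]; rewrite /clamp ger0_norm; last by lra.
by rewrite ler0_norm; [field|lra].
Qed.

Lemma clamp_mono (R : realType) (C x y : R) : 0 <= C -> x <= y -> clamp C x <= clamp C y.
Proof.
move=> C0 xy; rewrite /clamp ler_pM2r ?invr_gt0//.
have [h1|h1] := leP 0 (x + C); have [h2|h2] := leP 0 (x - C);
have [h3|h3] := leP 0 (y + C); have [h4|h4] := leP 0 (y - C);
rewrite ?(ger0_norm h1) ?(ger0_norm h2) ?(ger0_norm h3) ?(ger0_norm h4)
  ?(ltr0_norm h1) ?(ltr0_norm h2) ?(ltr0_norm h3) ?(ltr0_norm h4); lra.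
Qed.

(* Truncation is monotone, so it does not spoil the sign condition on the increments. *)
Lemma clamp_sign (R : realType) (C a b c d : R) : 0 <= C -> 0 <= (a - b) * (c - d) ->
  0 <= (clamp C a - clamp C b) * (clamp C c - clamp C d).
Proof.
move=> C0 H.
have [ab|ab|ab] := ltgtP a b; last by rewrite ab subrr mul0r.
- have cd : c <= d.
    by rewrite leNgt; apply/negP => dc; move: H; rewrite nmulr_rge0 ?subr_lt0// subr_le0 leNgt dc.
  by rewrite mulr_le0// subr_le0; apply: clamp_mono => //; exact: ltW.
- have dc : d <= c.
    by rewrite leNgt; apply/negP => cd; move: H; rewrite pmulr_rge0 ?subr_gt0// subr_ge0 leNgt cd.
  by rewrite mulr_ge0// subr_ge0; apply: clamp_mono => //; exact: ltW.
Qed.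

(** Cut in value and in [(t, x)] but not in [v], where the weights already have compact support. The
    result is bounded at every point of the whole space. *)
Definition fbox (R : realType) (C P1 Q1 P2 Q2 : R) (f : R * R * R -> R) : R * R * R -> R :=
  (fun p => clamp C (f p)) \_ ((`[P1, Q1] `*` `[P2, Q2]) `*` setT).

Lemma measurable_Omega3 (R : realType) : measurable (Omega3 R : set (R * R * R)).
Proof.
rewrite [X in measurable X](_ : _ = (fun p : R * R * R => p.1.1) @^-1` `]0, +oo[); last first.
  by apply/seteqP; split => p /=; rewrite in_itv/= andbT.
rewrite -[X in measurable X]setTI.
exact: (measurableT_comp measurable_fst measurable_fst).
Qed.

Lemma bm_fbox (R : realType) (C P1 Q1 P2 Q2 : R) (f : R * R * R -> R) : 0 <= C -> 0 < P1 ->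
  measurable_fun (Omega3 R) f -> bm (fbox C P1 Q1 P2 Q2 f).
Proof.
move=> C0 P0 mf.
have mD : measurable ((`[P1, Q1] `*` `[P2, Q2]) `*` setT : set (R * R * R)).
  by apply: measurableX => //; apply: measurableX; exact: measurable_itv.
split.
  apply: (measurable_restrictT _ mD).1.
  have mf' : measurable_fun ((`[P1, Q1] `*` `[P2, Q2]) `*` setT) f.
    apply: measurable_funS mf; first exact: measurable_Omega3.
    by move=> p [[/=]]; rewrite in_itv/= => /andP[h _] _ _; exact: lt_le_trans P0 h.
  rewrite /clamp; apply: measurable_funM => //; apply: measurable_funB;
    apply: measurableT_comp => //; [exact: measurable_funD|exact: measurable_funB].
exists C => p; rewrite /fbox patchE; case: ifP => _; first exact: clamp_bound.
by rewrite normr0.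
Qed.

Lemma fbox_in (R : realType) (C P1 Q1 P2 Q2 t x v : R) (f : R * R * R -> R) :
  P1 <= t <= Q1 -> P2 <= x <= Q2 -> fbox C P1 Q1 P2 Q2 f (t, x, v) = clamp C (f (t, x, v)).
Proof.
move=> h1 h2; rewrite /fbox patchE ifT//; apply/mem_set; split => //.
Qed.

Lemma fbox_out (R : realType) (C P1 Q1 P2 Q2 : R) (f : R * R * R -> R) (p : R * R * R) :
  [\/ p.1.1 < P1 \/ Q1 < p.1.1 | p.1.2 < P2 \/ Q2 < p.1.2] -> fbox C P1 Q1 P2 Q2 f p = 0.
Proof.
move=> h; rewrite /fbox patchE ifF//; apply/negbTE; rewrite notin_setE => -[[]] /=.
rewrite !in_itv/= => /andP[a1 a2] /andP[a3 a4] _.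
by case: h => -[h|h]; move: h; apply/negP; rewrite -leNgt.
Qed.

(** * Moments in [v] and their weak equations *)

Definition mom (R : realType) (g : R * R * R -> R) (h : R -> R) (z : R * R) : R :=
  \int[lb R]_v (g (z, v) * h v).

Lemma mom_int (R : realType) (g : R * R * R -> R) (h : R -> R) (z : R * R) :
  bm g -> Int (lb R) h -> Int (lb R) (fun v => g (z, v) * h v).
Proof. by move=> bg Ih; apply: int_bmM => //; exact: (bm_pair1 z bg). Qed.

Lemma mom_bound (R : realType) (C : R) (g : R * R * R -> R) (h : R -> R) (z : R * R) :
  bm g -> (forall p, `|g p| <= C) -> Int (lb R) h -> `|mom g h z| <= C * \int[lb R]_v `|h v|.
Proof.
move=> bg gC Ih; rewrite (le_trans (le_normr_Rintegral _ (mom_int z bg Ih)))//.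
rewrite -RintegralZl//; last exact: int_norm.
apply: le_Rintegral => //.
- exact: (int_norm (mom_int z bg Ih)).
- by apply: (int_bmM (f := fun=> C)); [exact: bm_cst|exact: int_norm].
- by move=> v _; rewrite normrM ler_wpM2r.
Qed.

Lemma bm_mom (R : realType) (g : R * R * R -> R) (h : R -> R) :
  bm g -> bm h -> Int (lb R) h -> bm (mom g h).
Proof.
move=> bg bh Ih; split.
  apply: (meas_Rint (lb R) (F := fun p : R * R * R => g p * h p.2)).
  by apply: measurable_funM; [exact: (proj1 bg)|exact: (measurableT_comp (proj1 bh) measurable_snd)].
have [_ [C gC]] := bg; exists (C * \int[lb R]_v `|h v|) => z; exact: mom_bound.
Qed.

Lemma supp2_int (R : realType) (P1 Q1 P2 Q2 : R) (u : R * R -> R) : bm u ->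
  (forall z, [\/ z.1 < P1 \/ Q1 < z.1 | z.2 < P2 \/ Q2 < z.2] -> u z = 0) ->
  Int (prodm (lb R) (lb R)) u.
Proof.
move=> bu u0.
have I (a b : R) : Int (lb R) (\1_`[a, b]%classic : R -> R).
  apply: (supp_int (l := a) (u := b)); first by apply: bm_indic; exact: measurable_itv.
  move=> x h; rewrite indicE memNset//= in_itv/= => /andP[h1 h2].
  by case: h => h; move: h; apply/negP; rewrite -leNgt.
have -> : u = fun z => u z * (\1_`[P1, Q1]%classic z.1 * \1_`[P2, Q2]%classic z.2).
  apply/funext => z; rewrite !indicE.
  case: (boolP (z.1 \in `[P1, Q1]%classic)) => [|/negP n1]; last first.
    rewrite /= mul0r mulr0 u0//; left.
    case: (ltP z.1 P1) => h1; first by left.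
    by case: (ltP Q1 z.1) => h2; [right|exfalso; apply: n1; rewrite inE/= in_itv/= h1 h2].
  case: (boolP (z.2 \in `[P2, Q2]%classic)) => [|/negP n1]; last first.
    rewrite /= !mulr0 u0//; right.
    case: (ltP z.2 P2) => h1; first by left.
    by case: (ltP Q2 z.2) => h2; [right|exfalso; apply: n1; rewrite inE/= in_itv/= h1 h2].
  by rewrite /= !mulr1.
by apply: int_bmM => //; exact: (int_tensor (I P1 Q1) (I P2 Q2)).
Qed.

Lemma mom_fbox_bdd (R : realType) (C M P1 Q1 P2 Q2 : R) (f : R * R * R -> R) (h : R -> R) :
  0 <= C -> 0 < P1 -> measurable_fun (Omega3 R) f -> bm h -> Int (lb R) h ->
  C * \int[lb R]_v `|h v| <= M -> bdd_int M (mom (fbox C P1 Q1 P2 Q2 f) h).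
Proof.
move=> C0 P0 mf bh Ih hM; have bf := bm_fbox Q1 P2 Q2 C0 P0 mf.
have bu := bm_mom bf bh Ih; split => //.
  apply: (supp2_int (P1 := P1) (Q1 := Q1) (P2 := P2) (Q2 := Q2)) => // z hz.
  rewrite /mom (_ : (fun v => _) = fun=> 0).
    by rewrite Rintegral_cst// mul0r.
  by apply/funext => v; rewrite fbox_out// mul0r.
move=> z; apply: le_trans hM; apply: mom_bound => // p.
rewrite /fbox patchE; case: ifP => _; first exact: clamp_bound.
by rewrite normr0.
Qed.

Lemma int_tens (R : realType) (k1 k2 k3 : R -> R) :
  Int (lb R) k1 -> Int (lb R) k2 -> Int (lb R) k3 -> Int (lb3 R) (tens k1 k2 k3).
Proof. by move=> I1 I2 I3; exact: (int_tensor (int_tensor I1 I2) I3). Qed.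

Lemma Rint_tens (R : realType) (k1 k2 k3 : R -> R) (g : R * R * R -> R) :
  bm g -> Int (lb R) k1 -> Int (lb R) k2 -> Int (lb R) k3 ->
  \int[lb3 R]_p (g p * tens k1 k2 k3 p) =
  \int[prodm (lb R) (lb R)]_z (k1 z.1 * (k2 z.2 * mom g k3 z)).
Proof.
move=> bg I1 I2 I3.
have I := int_bmM bg (int_tens I1 I2 I3).
rewrite /lb3 (Fubini_Rint1 I); apply: eq_Rintegral => z _.
rewrite mulrA -RintegralZl//; last exact: mom_int.
by apply: eq_Rintegral => v _; rewrite /tens/=; ring.
Qed.

(** The test function is a tensor product, so all [gamma] derivatives fall on [th], where [S] bounds
    them, and [k1], [k2] stay undifferentiated. On the support of the test function, [f] and its
    truncation agree almost everywhere. The weight [a' th] of the flux is only continuous, but the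
    equation never differentiates it. *)
Lemma kinetic_weak (R : realType) (a : R -> R) (gamma : nat)
  (mu1 mu2 : {measure set (R * R * R) -> \bar R}) (f : R * R * R -> R)
  (C P1 Q1 P2 Q2 L S : R) (th : R -> R)
  (moo : (measure_add mu1 mu2 (box3 P1 Q1 P2 Q2 L) < +oo)%E) :
  0 <= C -> 0 < P1 -> continuous (derive1 a) -> measurable_fun (Omega3 R) f ->
  {ae leb3 R, forall p, Omega3 R p -> `|f p| <= C} ->
  kinetic_eq a gamma mu1 mu2 f -> ker (- L) L th ->
  (forall v, `|derive1n gamma th v| <= S) ->
  weak_eq (mfrestr (box3_measurable P1 Q1 P2 Q2 L) moo) (fun p => p.1.1) (fun p => p.1.2)
    S P1 Q1 P2 Q2 (mom (fbox C P1 Q1 P2 Q2 f) th)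
    (mom (fbox C P1 Q1 P2 Q2 f) (fun v => derive1 a v * th v)).
Proof.
move=> C0 P0 ca mf fC kin kth thS k1 k2 kk1 kk2.
set g := fbox C P1 Q1 P2 Q2 f; pose h (v : R) : R := derive1 a v * th v.
have bg : bm g by exact: bm_fbox.
have sh : supp_in (- L) L h by move=> v hv; rewrite /h (proj2 kth _ hv) mulr0.
have ch : continuous h by move=> v; apply: cvgM; [exact: ca|exact: (Cinf_cont (proj1 kth))].
have bh : bm h := cont_supp_bm ch sh.
have Ih : Int (lb R) h := supp_int bh sh.
have B1 := ker_bm kk1; have B2 := ker_bm kk2; have B3 := ker_bm kth.
have I1 := ker_int kk1; have I2 := ker_int kk2; have I3 := ker_int kth.
have kk1' := ker_derive kk1; have kk2' := ker_derive kk2.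
have B1' := ker_bm kk1'; have B2' := ker_bm kk2'.
have I1' := ker_int kk1'; have I2' := ker_int kk2'.
rewrite -(Rint_tens bg I1' I2 I3) -(Rint_tens bg I1 I2' Ih).
rewrite -RintegralD//; last 2 first.
- exact: (int_bmM bg (int_tens I1' I2 I3)).
- exact: (int_bmM bg (int_tens I1 I2' Ih)).
have := kin _ (tens_test P0 kk1 kk2 kth).
have [-> -> _] := pd_tens (proj1 kk1) (proj1 kk2) (proj1 kth).
rewrite (iter_pdv_tens gamma (proj1 kk1) (proj1 kk2) kth).
(* [f] is measurable on [t > 0] only. Restricting it to [D] makes the integrand measurable on the
   whole space without changing it, since [w] vanishes off [D]. *)
pose D : set (R * R * R) := (`[P1, Q1] `*` `[P2, Q2]) `*` setT.
pose w (p : R * R * R) : R := tens (derive1 k1) k2 th p + tens k1 (derive1 k2) h p.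
have mD : measurable D by apply: measurableX => //; apply: measurableX; exact: measurable_itv.
have w0 p : ~ D p -> w p = 0.
  move=> nD.
  have nB : ~ box3 P1 Q1 P2 Q2 L p by move=> [hp _]; apply: nD; split.
  rewrite /w (tens_out (proj2 kk1') (proj2 kk2) (proj2 kth) nB).
  by rewrite (tens_out (proj2 kk1) (proj2 kk2') sh nB) addr0.
have bw : bm w by apply: bmD; exact: bm_tens.
have mfD : measurable_fun setT (f \_ D).
  apply: (measurable_restrictT _ mD).1.
  apply: measurable_funS mf.
    rewrite [X in measurable X](_ : _ = (fun p : R * R * R => p.1.1) @^-1` `]0, +oo[); last first.
      by apply/seteqP; split => p /=; rewrite in_itv/= andbT.
    rewrite -[X in measurable X]setTI.
    exact: (measurableT_comp measurable_fst measurable_fst).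
  by move=> p [[/=]]; rewrite in_itv/= => /andP[hp _] _ _; exact: lt_le_trans P0 hp.
have mfw : measurable_fun setT (fun p => (f \_ D) p * w p).
  by apply: measurable_funM => //; exact: (proj1 bw).
rewrite (_ : (fun p => f p * _) = fun p => (f \_ D) p * w p); last first.
  apply/funext => p; rewrite patchE; case: ifPn => [_|]; first by rewrite /w /h /tens; ring.
  rewrite notin_setE => nD; rewrite mul0r; have := w0 p nD; rewrite /w /h /tens => wp.
  rewrite (_ : _ + _ = 0) ?mulr0//; rewrite -wp; ring.
rewrite leb3_Rint//.
rewrite (_ : \int[lb3 R]_x ((f \_ D) x * w x) = \int[lb3 R]_x (g x * w x)); last first.
  rewrite /Rintegral; congr fine; apply: ae_eq_integral => //.
  - exact/measurable_EFinP.
  - by apply/measurable_EFinP; apply: measurable_funM; [exact: (proj1 bg)|exact: (proj1 bw)].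
  have := leb3_ae fC; apply: filterS => p fp _; congr EFin.
  rewrite /g /fbox !patchE; case: ifPn => // pD; rewrite clamp_id//.
  apply: fp; move: pD; rewrite inE => -[[]] /=; rewrite in_itv/= => /andP[hp _] _ _.
  exact: lt_le_trans P0 hp.
rewrite (_ : \int[lb3 R]_z (g z * tens (derive1 k1) k2 th z + g z * tens k1 (derive1 k2) (fun v => derive1 a v * th v) z) = \int[lb3 R]_x (g x * w x)); last first.
  by apply: eq_Rintegral => p _; rewrite /w mulrDr.
(* The sign [(-1) ^+ gamma] disappears in the absolute value, and the integrals against [mu1] and
   [mu2] are bounded separately. *)
move=> E; rewrite -normrN E normrM normrX normrN1 expr1n mul1r.
apply: (le_trans (ler_normB _ _)).
have kg := ker_derive1n gamma kth; have bk := ker_bm kg.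
apply: (two_measure_bound (box3_measurable P1 Q1 P2 Q2 L) moo
  (G := fun p => `|k1 p.1.1| * `|k2 p.1.2|)).
- exact: bm_tens.
- apply: bmM; apply: bm_norm.
    exact: (bm_comp B1 (measurableT_comp measurable_fst measurable_fst)).
  exact: (bm_comp B2 (measurableT_comp measurable_snd measurable_fst)).
- by move=> p; apply: tens_out; [exact: (proj2 kk1)|exact: (proj2 kk2)|exact: (proj2 kg)].
- by move=> p; rewrite /tens !normrM mulrC; apply: ler_wpM2r => //; rewrite mulr_ge0.
Qed.

(** * The quadratic lower bound *)

Lemma bm_Rint_w d1 d2 (T1 : measurableType d1) (T2 : measurableType d2) (R : realType)
  (m2 : {sigma_finite_measure set T2 -> \bar R}) (b : T1 * T2 -> R) (k : T2 -> R) :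
  bm b -> Int m2 k -> bm (fun x => \int[m2]_y (k y * b (x, y))).
Proof.
move=> bb Ik.
have mk : measurable_fun setT k by apply/measurable_EFinP; exact: measurable_int Ik.
split.
  apply: (meas_Rint m2 (F := fun z : T1 * T2 => k z.2 * b z)).
  by apply: measurable_funM; [exact: (measurableT_comp mk measurable_snd)|exact: (proj1 bb)].
have [_ [M HM]] := bb; exists (M * \int[m2]_y `|k y|) => x.
have I : Int m2 (fun y => k y * b (x, y)).
  rewrite (_ : (fun y => _) = fun y => b (x, y) * k y); last by apply/funext => y; rewrite mulrC.
  by apply: int_bmM => //; exact: (bm_pair1 x bb).
rewrite (le_trans (le_normr_Rintegral _ I))// -RintegralZl//; last exact: int_norm.
apply: le_Rintegral => //.
- exact: int_norm.
- by apply: (int_bmM (f := fun=> M)); [exact: bm_cst|exact: int_norm].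
- by move=> y _; rewrite normrM mulrC ler_wpM2r.
Qed.

Lemma int_Mbm d (T : measurableType d) (R : realType)
  (m : {measure set T -> \bar R}) (f u : T -> R) : bm f -> Int m u ->
  Int m (fun x => u x * f x).
Proof.
move=> bf iu; rewrite (_ : (fun x => _) = fun x => f x * u x); first exact: int_bmM.
by apply/funext => x; rewrite mulrC.
Qed.

Lemma quad_int (R : realType) (Q : R * R -> R) (Psi : R -> R) (b : R * R * R * R -> R) :
  bm b -> Int (lb2 R) Q -> Int (lb R) Psi ->
  Int (lb4 R) (fun q => Q q.1.1 * Psi q.1.2 * Psi q.2 * b q).
Proof.
by move=> bb IQ IP; apply: int_Mbm => //; exact: (int_tensor (int_tensor IQ IP) IP).
Qed.

Lemma quad_Rint (R : realType) (Q : R * R -> R) (Psi : R -> R) (b : R * R * R * R -> R) :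
  bm b -> Int (lb2 R) Q -> Int (lb R) Psi ->
  \int[lb4 R]_q (Q q.1.1 * Psi q.1.2 * Psi q.2 * b q) =
  \int[lb2 R]_z (Q z * \int[lb R]_v (Psi v * \int[lb R]_w (Psi w * b (z, v, w)))).
Proof.
move=> bb IQ IP; rewrite /lb4 (Fubini_Rint1 (quad_int bb IQ IP))/=.
have bc := bm_Rint_w bb IP.
transitivity (\int[lb3 R]_p (Q p.1 * Psi p.2 * \int[lb R]_w (Psi w * b (p, w)))).
  apply: eq_Rintegral => p _; rewrite -RintegralZl//; last first.
    by apply: int_Mbm => //; exact: (bm_pair1 p bb).
  by apply: eq_Rintegral => w _; rewrite !mulrA.
have I3 : Int (lb3 R) (fun p => Q p.1 * Psi p.2 * \int[lb R]_w (Psi w * b (p, w))).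
  by apply: int_Mbm => //; exact: (int_tensor IQ IP).
rewrite /lb3 (Fubini_Rint1 I3)/=; apply: eq_Rintegral => z _; rewrite -RintegralZl//; last first.
  by apply: int_Mbm => //; exact: (bm_pair1 z bc).
by apply: eq_Rintegral => v _; rewrite !mulrA.
Qed.

Lemma ae_le_Rint d (T : measurableType d) (R : realType) (m : {measure set T -> \bar R})
  (f g : T -> R) : Int m f -> Int m g -> {ae m, forall x, f x <= g x} ->
  \int[m]_x f x <= \int[m]_x g x.
Proof.
move=> If Ig fg; rewrite -subr_ge0 -RintegralB//.
have I := intB Ig If.
have E : \int[m]_x (g x - f x) = \int[m]_x `|g x - f x|.
  rewrite /Rintegral; congr fine; apply: ae_eq_integral => //.
  - exact: (measurable_int m I).
  - exact: (measurable_int m (int_norm I)).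
  by apply: filterS fg => x h _; rewrite ger0_norm// subr_ge0.
by rewrite E; apply: Rintegral_ge0.
Qed.

Lemma tube_mass (R : realType) (L S de v : R) (Psi : R -> R) : ker (- L) L Psi ->
  (forall w, 0 <= Psi w <= S) -> 0 < de ->
  \int[lb R]_w (Psi w * (`|v - w| < de)%R%:R) <= S * (2 * de).
Proof.
move=> kP PS de0; have bP := ker_bm kP; have IP := ker_int kP.
have mI : measurable (`]v - de, v + de[%classic : set R) by exact: measurable_itv.
have E w : ((`|v - w| < de)%R%:R : R) = \1_(`]v - de, v + de[%classic) w.
  rewrite indicE; congr (_%:R); congr nat_of_bool; apply/idP/idP.
    by rewrite ltr_norml => /andP[h1 h2]; rewrite inE/= in_itv/=; apply/andP; split; lra.
  by rewrite inE/= in_itv/= => /andP[h1 h2]; rewrite ltr_norml; apply/andP; split; lra.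
have S0 : 0 <= S by have /andP[h1 h2] := PS 0; exact: le_trans h1 h2.
have Ii : Int (lb R) (\1_(`]v - de, v + de[%classic) : R -> R).
  apply: (supp_int (l := v - de) (u := v + de)); first exact: bm_indic.
  move=> x h; rewrite indicE memNset//= in_itv/= => /andP[h1 h2].
  by case: h => h; move: h; apply/negP; rewrite -leNgt ltW.
apply: (@le_trans _ _ (\int[lb R]_w (S * \1_(`]v - de, v + de[%classic) w))).
  apply: le_Rintegral => //.
  - rewrite [X in _.-integrable _ X](_ : _ = EFin \o (fun w => Psi w * \1_(`]v - de, v + de[%classic) w)).
      by apply: int_Mbm => //; exact: bm_indic.
    by apply/funext => w /=; rewrite E.
  - exact: (int_bmM (f := fun=> S) (bm_cst _ _) Ii).
  - by move=> w _; rewrite E; apply: ler_wpM2r; [rewrite indicE|have /andP[] := PS w].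
rewrite RintegralZl//; apply: ler_wpM2l => //.
rewrite /Rintegral integral_indic// setIT.
have h : v - de < v + de by lra.
rewrite [X in fine X](_ : _ = (2 * de)%:E)//.
have -> : 2 * de = v + de - (v - de) by lra.
rewrite EFinB; have := lebesgue_measure_itv (R:=R) `]v - de, v + de[.
by rewrite /= lte_fin h.
Qed.

Lemma wint_lin4 d (T : measurableType d) (R : realType) (m : {measure set T -> \bar R})
  (Psi k0 k1 k2 k3 : T -> R) (c0 c1 c2 c3 : R) :
  Int m Psi -> bm k0 -> bm k1 -> bm k2 -> bm k3 ->
  \int[m]_w (Psi w * (c0 * k0 w + c1 * k1 w + c2 * k2 w + c3 * k3 w)) =
  c0 * \int[m]_w (Psi w * k0 w) + c1 * \int[m]_w (Psi w * k1 w)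
  + c2 * \int[m]_w (Psi w * k2 w) + c3 * \int[m]_w (Psi w * k3 w).
Proof.
move=> IP b0 b1 b2 b3.
have I k : bm k -> Int m (fun w => Psi w * k w) by move=> bk; exact: int_Mbm.
have J c k : bm k -> Int m (fun w => c * (Psi w * k w)).
  by move=> bk; exact: (int_bmM (f := fun=> c) (bm_cst _ _) (I _ bk)).
have Z c k : bm k -> c * \int[m]_w (Psi w * k w) = \int[m]_w (c * (Psi w * k w)).
  by move=> bk; rewrite RintegralZl//; exact: I.
rewrite !Z// -RintegralD//; [|exact: J|exact: J].
rewrite -RintegralD//; [|exact: (intD (J _ _ b0) (J _ _ b1))|exact: J].
rewrite -RintegralD//; [|exact: (intD (intD (J _ _ b0) (J _ _ b1)) (J _ _ b2))|exact: J].
by apply: eq_Rintegral => w _; ring.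
Qed.

(** Expanding [(p v - p w) (q v - q w)] gives four products of an integral in [v] with an integral
    in [w], equal in pairs; hence the factor 2. *)
Lemma wedge_expand d (T : measurableType d) (R : realType) (m : {measure set T -> \bar R})
  (Psi p q g : T -> R) : Int m Psi -> bm p -> bm q -> bm g ->
  \int[m]_v (Psi v * \int[m]_w (Psi w * ((p v - p w) * (q v - q w) * (g v * g w)))) =
  2 * ((\int[m]_v (Psi v * g v)) * (\int[m]_v (Psi v * (q v * p v * g v)))
     - (\int[m]_v (Psi v * (q v * g v))) * (\int[m]_v (Psi v * (p v * g v)))).
Proof.
move=> IP bp bq bg.
set P0 := \int[m]_v (Psi v * g v); set P3 := \int[m]_v (Psi v * (q v * p v * g v)).
set P2 := \int[m]_v (Psi v * (q v * g v)); set P1 := \int[m]_v (Psi v * (p v * g v)).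
have b1 := bmM bp bg; have b2 := bmM bq bg; have b3 := bmM (bmM bq bp) bg.
transitivity (\int[m]_v (Psi v * (P0 * (q v * p v * g v) + (- P2) * (p v * g v)
    + (- P1) * (q v * g v) + P3 * g v))).
  apply: eq_Rintegral => v _; congr (_ * _).
  transitivity (\int[m]_w (Psi w * ((q v * p v * g v) * g w + (- (p v * g v)) * (q w * g w)
     + (- (q v * g v)) * (p w * g w) + g v * (q w * p w * g w)))).
    by apply: eq_Rintegral => w _; ring.
  by rewrite wint_lin4// -/P0 -/P1 -/P2 -/P3; ring.
by rewrite wint_lin4// -/P0 -/P1 -/P2 -/P3; ring.
Qed.

Lemma bm_clamp (R : realType) (L : R) : 0 <= L -> bm (clamp L).
Proof.
move=> L0; split; last by exists L => x; exact: clamp_bound.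
have mid : measurable_fun setT (fun x : R => x) by exact: measurable_id.
apply: measurable_funM; last by [].
apply: measurable_funB; apply: measurableT_comp => //; first exact: measurable_funD.
exact: measurable_funB.
Qed.

Lemma clamp_itv (R : realType) (L x : R) : 0 <= L -> - L <= clamp L x <= L.
Proof. by move=> L0; rewrite -ler_norml clamp_bound. Qed.

Lemma bm_cont_clamp (R : realType) (L : R) (b : R -> R) : 0 <= L -> continuous b ->
  bm (fun x => b (clamp L x)).
Proof.
move=> L0 cb; split.
  by apply: measurableT_comp; [exact: continuous_measurable_fun|exact: (proj1 (bm_clamp L0))].
have LL : - L <= L by lra.
have cw : {within `[- L, L], continuous b} by exact: continuous_subspaceT.
have [c1 _ H1] := EVT_max LL cw; have [c2 _ H2] := EVT_min LL cw.
exists (`|b c1| + `|b c2|) => x.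
have h : clamp L x \in `[- L, L] by rewrite in_itv/= clamp_itv.
have := H1 _ h; have := H2 _ h; have := ler_norm (b c1); have := lerNnormlW (lexx `|b c2|).
have := normr_ge0 (b c1); have := normr_ge0 (b c2).
by rewrite ler_norml => *; apply/andP; split; lra.
Qed.

(** The square of the integral of [Psi |g|] is kept as a double integral, so that it can be compared
    with the wedge pointwise in [(v, w)]. *)
Lemma sq_mom_le (R : realType) (K : R) (g : R * R * R -> R) (psi Psi : R -> R) (z : R * R) :
  bm g -> bm psi -> Int (lb R) Psi -> Int (lb R) psi -> 0 <= K -> (forall v, 0 <= Psi v) ->
  (forall v, `|psi v| <= K * Psi v) ->
  mom g psi z ^+ 2 <= K ^+ 2 *
    \int[lb R]_v (Psi v * \int[lb R]_w (Psi w * (`|g (z, v)| * `|g (z, w)|))).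
Proof.
move=> bg bp IP Ip K0 P0 H.
have bn : bm (fun v => `|g (z, v)|) by exact: (bm_norm (bm_pair1 z bg)).
set T := \int[lb R]_v (Psi v * `|g (z, v)|).
have IT : Int (lb R) (fun v => Psi v * `|g (z, v)|) by exact: int_Mbm.
have T0 : 0 <= T by apply: Rintegral_ge0 => v _; exact: mulr_ge0.
have -> : \int[lb R]_v (Psi v * \int[lb R]_w (Psi w * (`|g (z, v)| * `|g (z, w)|))) = T ^+ 2.
  transitivity (\int[lb R]_v (T * (Psi v * `|g (z, v)|))).
    apply: eq_Rintegral => v _; rewrite -/T.
    transitivity (Psi v * \int[lb R]_w (`|g (z, v)| * (Psi w * `|g (z, w)|))).
      by congr (_ * _); apply: eq_Rintegral => w _; ring.
    by rewrite RintegralZl// -/T; ring.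
  by rewrite RintegralZl// expr2.
have B : `|mom g psi z| <= K * T.
  have I1 := mom_int z bg Ip.
  rewrite (le_trans (le_normr_Rintegral _ I1))// -RintegralZl//.
  apply: le_Rintegral => //.
  - exact: int_norm.
  - exact: (int_bmM (f := fun=> K) (bm_cst _ _) IT).
  - by move=> v _; rewrite normrM mulrC mulrA; exact: ler_wpM2r.
rewrite -exprMn -[mom g psi z ^+ 2]real_normK ?num_real//.
by rewrite ler_pXn2r ?nnegrE ?mulr_ge0.
Qed.

(** On the support of the weights, [|g(v) g(w)|] is at most [E^2] in the strip [|v - w| < de], and
    at most [c (v - w) (ad v - ad w) g(v) g(w)] outside it. There [c = 1 / (al de^(be + 1))] is the
    inverse of a lower bound for [(v - w) (ad v - ad w)], and the sign condition removes the
    absolute value. *)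
Lemma mom_sq_estimate (R : realType) (Q : set (R * R)) (g : R * R * R -> R) (ad psi Psi : R -> R)
  (E L S K al be de : R) :
  measurable Q -> Int (lb2 R) (\1_Q : R * R -> R) ->
  bm g -> (forall p, `|g p| <= E) ->
  {ae lb4 R, forall q, Q q.1.1 -> 0 <= g q.1 * g (q.1.1, q.2)} ->
  continuous ad -> 0 <= L -> ker (- L) L Psi -> (forall v, 0 <= Psi v <= S) ->
  bm psi -> Int (lb R) psi -> 0 <= K -> (forall v, `|psi v| <= K * Psi v) ->
  0 < al -> 0 <= be ->
  (forall v w, - L <= w -> w < v -> v <= L -> al * (v - w) `^ be <= ad v - ad w) ->
  0 < de ->
  \int[lb2 R]_z (\1_Q z * mom g psi z ^+ 2) <=
  K ^+ 2 * (E ^+ 2 * (S * (2 * de)) * \int[lb R]_v Psi v * \int[lb2 R]_z \1_Q z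
    + 2 * (al * de `^ be * de)^-1 * \int[lb2 R]_z (\1_Q z *
      (mom g Psi z * mom g (fun v => ad v * (v * Psi v)) z
       - mom g (fun v => ad v * Psi v) z * mom g (fun v => v * Psi v) z))).
Proof.
move=> mQ IQ bg gE sg cad L0 kP PS bp Ip K0 pK al0 be0 Had de0.
have IP := ker_int kP; have bP := ker_bm kP.
have P0 v : 0 <= Psi v by have /andP[] := PS v.
(* [v] and [ad] need not be bounded on the line; composing them with [clamp L] puts them in [bm] and
   changes nothing on the support of [Psi]. *)
pose vc := clamp L : R -> R; pose ac := fun v => ad (clamp L v).
have bv : bm vc by exact: bm_clamp.
have ba : bm ac by exact: bm_cont_clamp.
set c := (al * de `^ be * de)^-1.
have c0 : 0 < c by rewrite invr_gt0 mulr_gt0// mulr_gt0// powR_gt0.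
have [al1 de1 c1] : [/\ 0 <= al, 0 <= de & 0 <= c] by split; exact: ltW.
pose bX := fun q : R * R * R * R => `|g q.1| * `|g (q.1.1, q.2)|.
pose bY := fun q : R * R * R * R => E ^+ 2 * (`|q.1.2 - q.2| < de)%R%:R.
pose bW := fun q : R * R * R * R =>
  (vc q.1.2 - vc q.2) * (ac q.1.2 - ac q.2) * (g q.1 * g (q.1.1, q.2)).
have m12 : measurable_fun setT (fun q : R * R * R * R => q.1.2).
  exact: (measurableT_comp measurable_snd measurable_fst).
have m11 : measurable_fun setT (fun q : R * R * R * R => (q.1.1, q.2)).
  apply: measurable_fun_pair; last exact: measurable_snd.
  exact: (measurableT_comp measurable_fst measurable_fst).
have bg1 : bm (fun q : R * R * R * R => g q.1) by exact: (bm_comp bg measurable_fst).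
have bg2 : bm (fun q : R * R * R * R => g (q.1.1, q.2)) by exact: (bm_comp bg m11).
have bbX : bm bX by exact: (bmM (bm_norm bg1) (bm_norm bg2)).
have bbW : bm bW.
  apply: bmM; last exact: bmM.
  by apply: bmM; apply: bmB; [exact: (bm_comp bv m12)|exact: (bm_comp bv measurable_snd)|
    exact: (bm_comp ba m12)|exact: (bm_comp ba measurable_snd)].
have bbI : bm (fun q : R * R * R * R => (`|q.1.2 - q.2| < de)%R%:R : R).
  have mI : measurable [set x : R | `|x| < de].
    rewrite (_ : [set _ | _] = `]- de, de[%classic) ; first exact: measurable_itv.
    by apply/seteqP; split => x /=; rewrite in_itv/= ltr_norml.
  rewrite [X in bm X](_ : _ = fun q : R * R * R * R => \1_[set x : R | `|x| < de] (q.1.2 - q.2)).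
    exact: (bm_comp (bm_indic R mI) (measurable_funB m12 measurable_snd)).
  apply/funext => q; rewrite indicE; congr (_%:R); congr nat_of_bool.
  by apply/idP/idP; rewrite inE.
have bbY : bm bY by exact: (bmM (bm_cst _ _) bbI).
have key : \int[lb4 R]_q (\1_Q q.1.1 * Psi q.1.2 * Psi q.2 * bX q) <=
   \int[lb4 R]_q (\1_Q q.1.1 * Psi q.1.2 * Psi q.2 * (bY q + c * bW q)).
  apply: ae_le_Rint; [exact: quad_int|apply: quad_int => //; apply: bmD => //; apply: bmM => //; exact: bm_cst|].
  apply: filterS sg => -[[z v] w]/= sg.
  have [zQ|zQ] := pselect (Q z); last by rewrite indicE memNset//= !mul0r.
  have {}sg := sg zQ.
  rewrite indicE mem_set// mul1r.
  have [vL|vL] := pselect (- L <= v <= L); last first.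
    have -> : Psi v = 0 by exact: (supp_out (proj2 kP) vL).
    by rewrite !mul0r.
  have [wL|wL] := pselect (- L <= w <= L); last first.
    have -> : Psi w = 0 by exact: (supp_out (proj2 kP) wL).
    by rewrite !mulr0 !mul0r.
  apply: ler_wpM2l; first exact: mulr_ge0.
  rewrite /bX /bY /bW/= /vc /ac !clamp_id ?ler_norml//.
  have mono : forall x y, - L <= x <= L -> - L <= y <= L -> y < x ->
      al * (x - y) `^ be * (x - y) <= (x - y) * (ad x - ad y).
    move=> x y /andP[h1 h2] /andP[h3 h4] yx; rewrite [leRHS]mulrC.
    by apply: ler_wpM2r; [rewrite subr_ge0 ltW|exact: Had].
  (* The hypothesis on [ad] concerns [w < v]; exchanging [v] and [w] changes the sign of both
     factors, so the product bound holds for all pairs. *)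
  have W0 : al * `|v - w| `^ be * `|v - w| <= (v - w) * (ad v - ad w).
    have [vw|wv|->] := ltgtP v w; last by rewrite !subrr normr0 !mulr0.
      by rewrite distrC gtr0_norm ?subr_gt0// -[leRHS]mulrNN !opprB; exact: mono.
    by rewrite gtr0_norm ?subr_gt0//; exact: mono.
  have W1 : 0 <= (v - w) * (ad v - ad w).
    by apply: le_trans W0; apply: mulr_ge0 => //; apply: mulr_ge0 => //; exact: powR_ge0.
  (* In the strip the term [E ^+ 2] suffices and the wedge term is nonnegative; outside it the wedge
     term alone suffices. *)
  have [h|h] := ltP `|v - w| de.
    rewrite mulr1 -[leLHS]addr0; apply: lerD; last by apply: mulr_ge0 => //; exact: mulr_ge0.
    by rewrite expr2; apply: ler_pM.
  rewrite mulr0 add0r -normrM ger0_norm// [leRHS]mulrA -[leLHS]mul1r; apply: ler_wpM2r => //.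
  rewrite /c mulrC ler_pdivlMr ?mul1r; last by rewrite mulr_gt0// mulr_gt0// powR_gt0.
  apply: le_trans W0; apply: ler_pM => //.
    by apply: mulr_ge0 => //; exact: powR_ge0.
  by rewrite ler_wpM2l//; apply: ge0_ler_powR => //; rewrite nnegrE.
have Q0 z : 0 <= (\1_Q z : R) by rewrite indicE.
have I0 : 0 <= \int[lb R]_v Psi v by apply: Rintegral_ge0 => v _; exact: P0.
have bD : bm (mom g psi) by exact: bm_mom.
have IZ (b : R * R * R * R -> R) : bm b -> Int (lb2 R)
   (fun z => \1_Q z * \int[lb R]_v (Psi v * \int[lb R]_w (Psi w * b (z, v, w)))).
  by move=> bb; apply: int_Mbm => //; exact: (bm_Rint_w (bm_Rint_w bb IP) IP).
have st1 : \int[lb2 R]_z (\1_Q z * mom g psi z ^+ 2) <=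
    K ^+ 2 * \int[lb4 R]_q (\1_Q q.1.1 * Psi q.1.2 * Psi q.2 * bX q).
  rewrite quad_Rint// -RintegralZl//; last exact: IZ.
  apply: le_Rintegral => //.
  - by apply: int_Mbm => //; exact: (bmM bD bD).
  - exact: (int_bmM (f := fun=> K ^+ 2) (bm_cst _ _) (IZ _ bbX)).
  - by move=> z _; rewrite [leRHS]mulrCA; apply: ler_wpM2l => //; exact: sq_mom_le.
have st2 : \int[lb4 R]_q (\1_Q q.1.1 * Psi q.1.2 * Psi q.2 * bY q) <=
    E ^+ 2 * (S * (2 * de)) * \int[lb R]_v Psi v * \int[lb2 R]_z \1_Q z.
  rewrite quad_Rint// mulrC -RintegralZr//.
  apply: le_Rintegral => //; first exact: IZ.
    exact: (int_Mbm (f := fun=> _) (bm_cst _ _) IQ).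
  move=> z _; apply: ler_wpM2l => //; rewrite mulrC -RintegralZr//.
  have bb := bm_pair1 z (bm_Rint_w bbY IP).
  apply: le_Rintegral => //.
  - exact: int_Mbm.
  - exact: (int_Mbm (f := fun=> _) (bm_cst _ _) IP).
  - move=> v _; apply: ler_wpM2l => //.
    apply: (@le_trans _ _ (E ^+ 2 * \int[lb R]_w (Psi w * (`|v - w| < de)%R%:R))).
      have bI := bm_pair1 (z, v) bbI.
      rewrite -RintegralZl//; last exact: (int_Mbm bI).
      by rewrite le_eqVlt; apply/orP; left; apply/eqP; apply: eq_Rintegral => w _; rewrite /bY/= mulrCA.
    by rewrite ler_wpM2l ?sqr_ge0//; exact: (tube_mass v kP).
have st3 : \int[lb4 R]_q (\1_Q q.1.1 * Psi q.1.2 * Psi q.2 * bW q) =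
    2 * \int[lb2 R]_z (\1_Q z *
      (mom g Psi z * mom g (fun v => ad v * (v * Psi v)) z
       - mom g (fun v => ad v * Psi v) z * mom g (fun v => v * Psi v) z)).
  rewrite quad_Rint//; set F := fun z => _.
  transitivity (2 * \int[lb2 R]_z (2^-1 * F z)).
    by rewrite RintegralZl ?mulrA ?divff ?mul1r//; exact: IZ.
  congr (2 * _); apply: eq_Rintegral => z _; rewrite /F.
  rewrite (wedge_expand (p := vc) (q := ac) (g := fun v => g (z, v)))//; last exact: bm_pair1.
  have cut v (h : R -> R) : Psi v * h (clamp L v) = Psi v * h v.
    have [vL|vL] := pselect (- L <= v <= L); first by rewrite clamp_id// ler_norml.
    by rewrite (supp_out (proj2 kP) vL) !mul0r.
  have -> : \int[lb R]_v (Psi v * g (z, v)) = mom g Psi z.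
    by apply: eq_Rintegral => v _; rewrite mulrC.
  have -> : \int[lb R]_v (Psi v * (ac v * vc v * g (z, v))) = mom g (fun v => ad v * (v * Psi v)) z.
    apply: eq_Rintegral => v _; rewrite mulrA (cut v (fun x => ad x * x)); ring.
  have -> : \int[lb R]_v (Psi v * (ac v * g (z, v))) = mom g (fun v => ad v * Psi v) z.
    apply: eq_Rintegral => v _; rewrite mulrA (cut v ad); ring.
  have -> : \int[lb R]_v (Psi v * (vc v * g (z, v))) = mom g (fun v => v * Psi v) z.
    apply: eq_Rintegral => v _; rewrite mulrA (cut v id); ring.
  by rewrite [LHS]mulrCA mulKf.
apply: (le_trans st1); apply: ler_wpM2l; first exact: sqr_ge0.
apply: (le_trans key).
have -> : \int[lb4 R]_q (\1_Q q.1.1 * Psi q.1.2 * Psi q.2 * (bY q + c * bW q)) =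
   \int[lb4 R]_q (\1_Q q.1.1 * Psi q.1.2 * Psi q.2 * bY q) +
   c * \int[lb4 R]_q (\1_Q q.1.1 * Psi q.1.2 * Psi q.2 * bW q).
  rewrite -RintegralZl//; last exact: quad_int.
  rewrite -RintegralD//; first by apply: eq_Rintegral => q _; ring.
    exact: quad_int.
  exact: (int_bmM (f := fun=> c) (bm_cst _ _) (quad_int bbW IQ IP)).
by rewrite st3 (mulrC 2 c) -(mulrA c); apply: lerD.
Qed.

Lemma mom_sq_estimate_opt (R : realType) (Q : set (R * R)) (g : R * R * R -> R) (ad psi Psi : R -> R)
  (E L S K al be B y : R) :
  measurable Q -> Int (lb2 R) (\1_Q : R * R -> R) ->
  bm g -> (forall p, `|g p| <= E) ->
  {ae lb4 R, forall q, Q q.1.1 -> 0 <= g q.1 * g (q.1.1, q.2)} ->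
  continuous ad -> 0 <= L -> ker (- L) L Psi -> (forall v, 0 <= Psi v <= S) ->
  bm psi -> Int (lb R) psi -> 0 <= K -> (forall v, `|psi v| <= K * Psi v) ->
  0 < al -> 0 <= be ->
  (forall v w, - L <= w -> w < v -> v <= L -> al * (v - w) `^ be <= ad v - ad w) ->
  0 < y ->
  \int[lb2 R]_z (\1_Q z *
      (mom g Psi z * mom g (fun v => ad v * (v * Psi v)) z
       - mom g (fun v => ad v * Psi v) z * mom g (fun v => v * Psi v) z)) <= B * y ->
  \int[lb2 R]_z (\1_Q z * mom g psi z ^+ 2) <=
  K ^+ 2 * (E ^+ 2 * S * 2 * \int[lb R]_v Psi v * \int[lb2 R]_z \1_Q z + 2 * al^-1 * B)
    * y `^ (be + 2)^-1.
Proof.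
move=> mQ IQ bg gE sg cad L0 kP PS bp Ip K0 pK al0 be0 Had y0 HW.
set de := y `^ _; have de0 : 0 < de by exact: powR_gt0.
have b20 : 0 < be + 2 by lra.
(* Thus [y = de^(be + 2)], and [B y / (al de^(be + 1))] equals [B de / al]: both error terms become
   multiples of [de]. *)
have yE : y = de `^ be * de * de.
  rewrite -mulrA -expr2 -powR_mulrn; last exact: ltW.
  by rewrite -powRD ?(gt_eqF b20)// /de -powRrM mulVf ?(gt_eqF b20)// powRr1// ltW.
have dx : 0 < de `^ be * de by rewrite mulr_gt0// powR_gt0.
apply: (le_trans (mom_sq_estimate mQ IQ bg gE sg cad L0 kP PS bp Ip K0 pK al0 be0 Had de0)).
rewrite -[leRHS]mulrA; apply: ler_wpM2l; first exact: sqr_ge0.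
rewrite [leRHS]mulrDl; apply: lerD; first by rewrite le_eqVlt; apply/orP; left; apply/eqP; ring.
apply: (@le_trans _ _ (2 * (al * de `^ be * de)^-1 * (B * y))).
  apply: ler_wpM2l => //; apply: mulr_ge0 => //; rewrite invr_ge0 -mulrA; apply: mulr_ge0; exact: ltW.
rewrite -(mulrA al) invfM [X in B * X]yE le_eqVlt; apply/orP; left; apply/eqP.
by field; rewrite !gt_eqF// powR_gt0.
Qed.

Lemma box_Rint (R : realType) (p1 q1 p2 q2 : R) (W : R * R -> R) : bm W ->
  \int[lb2 R]_z (\1_(`[p1, q1] `*` `[p2, q2]) z * W z) =
  \int[lebI p1 q1]_t \int[lebI p2 q2]_x W (t, x).
Proof.
move=> bW.
have mQ : measurable (`[p1, q1] `*` `[p2, q2] : set (R * R)).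
  by apply: measurableX; exact: measurable_itv.
have I : Int (lb2 R) (fun z => \1_(`[p1, q1] `*` `[p2, q2]) z * W z).
  apply: (supp2_int (P1 := p1) (Q1 := q1) (P2 := p2) (Q2 := q2)).
    by apply: bmM => //; exact: bm_indic.
  move=> z hz; rewrite indicE memNset ?mul0r//= => -[]; rewrite /= !in_itv/= => /andP[? ?] /andP[? ?].
  by case: hz => -[]; lra.
rewrite /lb2 (Fubini_Rint1 I)/= lebI_Rint; last exact: (proj1 (bm_Rint (lebI p2 q2) bW)).
rewrite Rintegral_mkcond; apply: eq_Rintegral => t _; rewrite patchE.
have [h|h] := pselect (`[p1, q1]%classic t).
  rewrite ifT ?inE// lebI_Rint; last exact: (proj1 (bm_pair1 t bW)).
  rewrite Rintegral_mkcond; apply: eq_Rintegral => x _; rewrite patchE indicE.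
  have [h'|h'] := pselect (`[p2, q2]%classic x).
    by rewrite mem_set// mul1r mem_set.
  by rewrite !memNset ?mul0r// => -[].
rewrite memNset// -[RHS](mul0r (\int[lb R]_x W (t, x))).
rewrite (_ : (fun x => _) = cst 0); first by rewrite Rintegral_cst// !mul0r.
by apply/funext => x /=; rewrite indicE memNset ?mul0r// => -[].
Qed.

Lemma int_box (R : realType) (p1 q1 p2 q2 : R) :
  Int (lb2 R) (\1_(`[p1, q1] `*` `[p2, q2]) : R * R -> R).
Proof.
apply: (supp2_int (P1 := p1) (Q1 := q1) (P2 := p2) (Q2 := q2)).
  by apply: bm_indic; apply: measurableX; exact: measurable_itv.
move=> z hz; rewrite indicE memNset//= => -[]; rewrite /= !in_itv/= => /andP[? ?] /andP[? ?].
by case: hz => -[]; lra.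
Qed.

(** Near [v0] one has [|psi| >= m]. Evaluating [psi] at [v0 + la v] with [la] small spreads this
    neighbourhood over the whole support of [psi], and squaring gives a smooth nonnegative weight.
    On [[- M, M]], [|psi| <= S = (S / m^2) m^2 <= (S / m^2) Psi]. *)
Lemma weight_exists (R : realType) (M v0 : R) (psi : R -> R) : ker (- M) M psi -> psi v0 != 0 ->
  exists L K S Psi, [/\ 0 < L, ker (- L) L Psi, forall v, 0 <= Psi v <= S, 0 <= K &
    forall v, `|psi v| <= K * Psi v].
Proof.
move=> kp p0; have [Cp sp] := kp; have [_ [S HS]] := ker_bm kp.
pose m := `|psi v0| / 2.
have m0 : 0 < m by rewrite divr_gt0 ?normr_gt0.
have [e e0 He] : exists2 e : R, 0 < e & forall x, `|x - v0| < e -> m <= `|psi x|.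
  have cp : continuous psi := Cinf_cont Cp.
  have /cvgr_dist_lt/(_ m m0) := cp v0.
  move=> /nbhs_ballP[e /= e0 He]; exists e => // x xe.
  have : `|psi v0 - psi x| < m by apply: He; rewrite /ball/= distrC.
  have := ler_distD (psi x) (psi v0) 0; rewrite !subr0 /m; lra.
have [v0M M0] : `|v0| <= M /\ 0 <= M.
  have h : - M <= v0 <= M.
    apply/negP => /negP; rewrite negb_and -!ltNge => h.
    by move/eqP: p0; apply; apply: sp; case/orP: h => h; [left|right].
  by rewrite ler_norml; split => //; move: h => /andP[? ?]; lra.
(* [M'] is positive even if [M = 0], and [la M' = e / 2 < e] keeps [v0 + la v] in the neighbourhood
   for [|v| <= M]. *)
pose M' := M + 1; pose la := e / (2 * M').
have M'0 : 0 < M' by rewrite /M'; lra.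
have la0 : 0 < la by rewrite divr_gt0// mulr_gt0.
(* For [|v|] beyond the first witness, [|la v| > 2 M + 2], so [v0 + la v] leaves [[- M, M]] because
   [|v0| <= M]. *)
exists (2 * M' / la), (S / m ^+ 2), (S ^+ 2), (fun v => psi (v0 + la * v) * psi (v0 + la * v)).
have S0 : 0 <= S := le_trans (normr_ge0 _) (HS 0).
split.
- by rewrite divr_gt0// mulr_gt0.
- split; first by apply: CinfM => n; apply: Cn_aff.
  move=> v hv; rewrite sp ?mul0r//; move: v0M; rewrite ler_norml => /andP[h1 h2].
  case: hv => hv; [left|right].
    have : la * v < - (2 * M') by rewrite (mulrC la) -ltr_pdivlMr// mulNr.
    by rewrite /M'; lra.
  have : 2 * M' < la * v by rewrite (mulrC la) -ltr_pdivrMr.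
  by rewrite /M'; lra.
- move=> v; rewrite -expr2 sqr_ge0/= -[_ ^+ 2]real_normK ?num_real//.
  by rewrite ler_pXn2r ?nnegrE.
- by rewrite divr_ge0// sqr_ge0.
- move=> v; have [hv|hv] := pselect (- M <= v <= M); last first.
    by rewrite (supp_out sp hv) normr0 -expr2 mulr_ge0 ?sqr_ge0// divr_ge0// sqr_ge0.
  have hm : m <= `|psi (v0 + la * v)|.
    apply: He; rewrite addrC addKr normrM gtr0_norm//.
    have h1 : `|v| < M' by move: hv; rewrite -ler_norml => hv; rewrite /M'; lra.
    apply: (@lt_trans _ _ (la * M')); first by rewrite ltr_pM2l.
    rewrite (_ : la * M' = e / 2); first by lra.
    by rewrite /la; field; rewrite gt_eqF.
  rewrite -expr2 -[psi (v0 + la * v) ^+ 2]real_normK ?num_real//.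
  apply: (le_trans (HS v)); rewrite -mulrA -{1}(mulr1 S); apply: ler_wpM2l => //.
  rewrite mulrC ler_pdivlMr ?exprn_gt0// mul1r ler_pXn2r ?nnegrE//; exact: ltW.
Qed.

(** The mollifying kernel is also drawn from [psi]: the square of a translate, positive at 0. *)
Lemma bump_exists (R : realType) (M v0 : R) (psi : R -> R) : ker (- M) M psi -> psi v0 != 0 ->
  exists (c : R) (q : R -> R), [/\ 0 < c, ker (- c) c q, forall z, 0 <= q z & 0 < q 0].
Proof.
move=> [Cp sp] p0; exists (`|M| + `|v0| + 1), (fun v => psi (v0 + 1 * v) * psi (v0 + 1 * v)).
have [h1 h2] := (normr_ge0 M, normr_ge0 v0).
split.
- by lra.
- split; first by apply: CinfM => n; apply: Cn_aff.
  move=> v hv; rewrite sp ?mul0r// mul1r.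
  have := ler_norm M; have := ler_norm v0; have := ler_norm (- v0); rewrite normrN => *.
  by case: hv => hv; [left|right]; lra.
- by move=> v; rewrite -expr2 sqr_ge0.
- by rewrite mulr0 addr0 -expr2 lt0r sqr_ge0 sqrf_eq0 p0.
Qed.

Lemma mom_incr (R : realType) (g : R * R * R -> R) (h : R -> R) (s y : R) (z : R * R) :
  bm g -> Int (lb R) h ->
  mom (fun p => g (p.1.1 + s, p.1.2 + y, p.2) - g p) h z = mom g h (z.1 + s, z.2 + y) - mom g h z.
Proof.
move=> bg Ih; rewrite /mom -RintegralB//; last by exact: (mom_int z bg Ih).
  by apply: eq_Rintegral => v _; rewrite mulrBl.
exact: (mom_int (z.1 + s, z.2 + y) bg Ih).
Qed.

(** * Increments along the axes *)

Lemma ker_cmul (R : realType) (L : R) (b k : R -> R) : continuous b -> ker (- L) L k ->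
  bm (fun v => b v * k v) /\ Int (lb R) (fun v => b v * k v).
Proof.
move=> cb kk.
have sh : supp_in (- L) L (fun v => b v * k v) by move=> v hv; rewrite (proj2 kk _ hv) mulr0.
have ch : continuous (fun v => b v * k v).
  by move=> v; apply: cvgM; [exact: cb|exact: (Cinf_cont (proj1 kk))].
have bh := cont_supp_bm ch sh.
by split=> //; exact: (supp_int bh sh).
Qed.

Lemma itv_widen (R : realType) (p q r t s : R) : p <= t <= q -> 0 <= s < r ->
  p - r <= t + s <= q + r.
Proof. by move=> /andP[? ?] /andP[? ?]; apply/andP; split; lra. Qed.

(** The constant depends on the rectangle and the margin [r], not on the increment: the box enlarged
    by [r] contains both end points of every increment considered and stays in [t > 0]. *)
Lemma axis_increment_estimate (R : realType) (a : R -> R) (be : R) (gamma : nat)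
  (mu1 mu2 : {measure set (R * R * R) -> \bar R}) (f : R * R * R -> R)
  (C M v0 p1 q1 p2 q2 r : R) (psi : R -> R) :
  continuous (derive1 a) -> 1 <= be ->
  (forall M : R, 0 < M -> exists alpha : R, 0 < alpha /\
     forall v w : R, - M <= w -> w < v -> v <= M ->
       alpha * (v - w) `^ be <= derive1 a v - derive1 a w) ->
  radon3 mu1 -> radon3 mu2 -> measurable_fun (Omega3 R) f -> 0 <= C ->
  {ae leb3 R, forall p, Omega3 R p -> `|f p| <= C} ->
  kinetic_eq a gamma mu1 mu2 f ->
  (forall y s : R, 0 <= s ->
     {ae leb4 R, forall q : R * R * R * R, 0 < q.1.1.1 ->
        0 <= (f (q.1.1.1 + s, q.1.1.2 + y, q.1.2) - f (q.1.1.1, q.1.1.2, q.1.2))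
             * (f (q.1.1.1 + s, q.1.1.2 + y, q.2) - f (q.1.1.1, q.1.1.2, q.2))}) ->
  ker (- M) M psi -> psi v0 != 0 ->
  p1 < q1 -> p2 < q2 -> 0 < p1 - r ->
  exists B : R, 0 <= B /\ forall s y l : R, (s = 0 /\ y = l) \/ (s = l /\ y = 0) -> 0 < l -> l < r ->
    \int[lb2 R]_z (\1_(`[p1, q1] `*` `[p2, q2]) z *
      (mom (fbox C (p1 - r) (q1 + r) (p2 - r) (q2 + r) f) psi (z.1 + s, z.2 + y)
       - mom (fbox C (p1 - r) (q1 + r) (p2 - r) (q2 + r) f) psi z) ^+ 2) <= B * l `^ (be + 2)^-1.
Proof.
move=> ca be1 Ha rad1 rad2 mf C0 fC kin sgn kpsi p0 pq1 pq2 pr.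
have [r0|r0] := leP r 0.
  by exists 0; split=> // s y l _ l0 lr; move: (lt_trans l0 lr); rewrite ltNge r0.
have [L [K [S [Psi [L0 kP PS K0 pK]]]]] := weight_exists kpsi p0.
have [c [q [c0 kq q0 qp]]] := bump_exists kpsi p0.
have [al [al0 Hal]] := Ha L L0.
set P1 := p1 - r; set Q1 := q1 + r; set P2 := p2 - r; set Q2 := q2 + r.
set g := fbox C P1 Q1 P2 Q2 f.
have bg : bm g by exact: bm_fbox.
have gC p : `|g p| <= C.
  by rewrite /g /fbox patchE; case: ifP => _; [exact: clamp_bound|rewrite normr0].
(* The weight [v Psi] yields the second conservation law of the div-curl pair. *)
pose Ps1 := fun v : R => v * Psi v.
have kP1 : ker (- L) L Ps1.
  split; first by apply: CinfM; [exact: Cinf_id|exact: (proj1 kP)].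
  by move=> v hv; rewrite /Ps1 (proj2 kP _ hv) mulr0.
have [bA0 IA0] := ker_cmul ca kP; have [bA1 IA1] := ker_cmul ca kP1.
have bP := ker_bm kP; have IP := ker_int kP; have bP1 := ker_bm kP1; have IP1 := ker_int kP1.
have bpsi := ker_bm kpsi; have Ipsi := ker_int kpsi.
(* A compact box inside [t > 0] has finite mass for both Radon measures; this makes [nu] a finite
   measure. *)
have moo : (measure_add mu1 mu2 (box3 P1 Q1 P2 Q2 L) < +oo)%E.
  rewrite measure_addE lte_add_pinfty//; [apply: rad1|apply: rad2];
    by [exact: box3_compact|exact: box3_Omega].
have [_ [S0 HS0]] := ker_bm (ker_derive1n gamma kP).
have [_ [S1 HS1]] := ker_bm (ker_derive1n gamma kP1).
(* One constant for both weights, since [divcurl_x] takes a single [S]; [MM] does the same for the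
   four moments. *)
pose SS := S0 + S1.
have S00 : 0 <= S0 := le_trans (normr_ge0 _) (HS0 0).
have S10 : 0 <= S1 := le_trans (normr_ge0 _) (HS1 0).
have SS0 : 0 <= SS by exact: addr_ge0.
have W0 := kinetic_weak (S := SS) moo C0 pr ca mf fC kin kP
  (fun v => le_trans (HS0 v) (ler_wpDr S10 (lexx S0))).
have W1 := kinetic_weak (S := SS) moo C0 pr ca mf fC kin kP1
  (fun v => le_trans (HS1 v) (ler_wpDl S00 (lexx S1))).
pose N (h : R -> R) := C * \int[lb R]_v `|h v|.
have N0 (h : R -> R) : 0 <= N h by rewrite mulr_ge0//; exact: Rintegral_ge0.
pose MM := N Psi + N (fun v => derive1 a v * Psi v) + N Ps1 + N (fun v => derive1 a v * Ps1 v).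
have [n1 n2 n3 n4] : [/\ 0 <= N Psi, 0 <= N (fun v => derive1 a v * Psi v), 0 <= N Ps1 &
   0 <= N (fun v => derive1 a v * Ps1 v)] by split; exact: N0.
have Na0 : bdd_int MM (mom g Psi) by apply: mom_fbox_bdd => //; rewrite -/(N _) /MM; clear -n1 n2 n3 n4; lra.
have Nb0 : bdd_int MM (mom g (fun v => derive1 a v * Psi v)).
  by apply: mom_fbox_bdd => //; rewrite -/(N _) /MM; clear -n1 n2 n3 n4; lra.
have Na1 : bdd_int MM (mom g Ps1) by apply: mom_fbox_bdd => //; rewrite -/(N _) /MM; clear -n1 n2 n3 n4; lra.
have Nb1 : bdd_int MM (mom g (fun v => derive1 a v * Ps1 v)).
  by apply: mom_fbox_bdd => //; rewrite -/(N _) /MM; clear -n1 n2 n3 n4; lra.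
set nu := mfrestr _ _ in W0 W1.
pose B0 := 4 * MM ^+ 2 * (q1 - p1 + (q2 - p2)) + 4 * MM * SS * fine (nu setT).
pose Q := `[p1, q1] `*` `[p2, q2] : set (R * R).
have m1 : measurable_fun setT (fun p : R * R * R => p.1.1).
  exact: (measurableT_comp measurable_fst measurable_fst).
have m2 : measurable_fun setT (fun p : R * R * R => p.1.2).
  exact: (measurableT_comp measurable_snd measurable_fst).
have m3 : measurable_fun setT (fun p : R * R * R => p.2) by exact: measurable_snd.
have mQ : measurable Q by apply: measurableX; exact: measurable_itv.
have IQ : Int (lb2 R) (\1_Q : R * R -> R) by exact: int_box.
pose BB := K ^+ 2 * ((C + C) ^+ 2 * S * 2 * \int[lb R]_v Psi v * \int[lb2 R]_z \1_Q z + 2 * al^-1 * B0).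
have S_0 : 0 <= S by have /andP[h1 h2] := PS 0; exact: le_trans h1 h2.
exists BB; split.
  have M0 : 0 <= MM by rewrite /MM; clear -n1 n2 n3 n4; lra.
  have d0 : 0 <= q1 - p1 + (q2 - p2) by clear -pq1 pq2; lra.
  apply: mulr_ge0; first exact: sqr_ge0.
  apply: addr_ge0.
    apply: mulr_ge0; last by apply: Rintegral_ge0 => z _; rewrite indicE.
    apply: mulr_ge0; last by apply: Rintegral_ge0 => v _; have /andP[] := PS v.
    by apply: mulr_ge0 => //; apply: mulr_ge0 => //; exact: sqr_ge0.
  apply: mulr_ge0; first by apply: mulr_ge0 => //; rewrite invr_ge0 ltW.
  apply: addr_ge0; first by apply: mulr_ge0 => //; apply: mulr_ge0 => //; exact: sqr_ge0.
  by apply: mulr_ge0; [apply: mulr_ge0 => //; exact: mulr_ge0|exact: fine_ge0].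
move=> s y l hl l0 lr.
pose De := fun p : R * R * R => g (p.1.1 + s, p.1.2 + y, p.2) - g p.
have msh : measurable_fun setT (fun p : R * R * R => (p.1.1 + s, p.1.2 + y, p.2)).
  by apply: measurable_fun_pair => //; apply: measurable_fun_pair; exact: measurable_funD.
have bD : bm De by apply: bmB => //; exact: (bm_comp bg msh).
have [s0 y0] : 0 <= s < r /\ 0 <= y < r.
  by have l1 := ltW l0; case: hl => -[-> ->]; split; rewrite ?l1 ?lr ?r0 ?lexx.
have momD (h : R -> R) : Int (lb R) h -> forall z, mom De h z = mom g h (z.1 + s, z.2 + y) - mom g h z.
  by move=> Ih z; exact: mom_incr.
under eq_Rintegral do rewrite -(momD _ Ipsi).
apply: (mom_sq_estimate_opt (Psi := Psi) (S := S) (L := L) (ad := derive1 a)) => //.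
- move=> p; rewrite (le_trans (ler_normB _ _))// lerD//.
(* Both end points lie in the large box, where [g] is [clamp C] of [f], so the sign condition passes
   from [f] to the increment [De]. *)
- have := leb4_ae (sgn y s (proj1 (andP s0))).
  apply: filterS => -[[[t x] v] w]/= sg [/=]; rewrite !in_itv/= => /andP[t1 t2] /andP[x1 x2].
  have {}sg : 0 < t -> _ := sg.
  have t12 : p1 <= t <= q1 by rewrite t1.
  have x12 : p2 <= x <= q2 by rewrite x1.
  have z0 : 0 <= (0 : R) < r by rewrite lexx.
  have bt := itv_widen t12 z0; have bx := itv_widen x12 z0; rewrite !addr0 in bt bx.
  have bt' := itv_widen t12 s0; have bx' := itv_widen x12 y0.
  rewrite /De/= /g !fbox_in//; apply: clamp_sign => //; apply: sg.
  by apply: lt_le_trans t1; apply: (lt_trans r0); rewrite -subr_gt0.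
- exact: ltW.
- exact: le_trans be1.
- have -> : \int[lb2 R]_z (\1_Q z * (mom De Psi z * mom De (fun v => derive1 a v * (v * Psi v)) z -
     mom De (fun v => derive1 a v * Psi v) z * mom De (fun v => v * Psi v) z)) =
    \int[lebI p1 q1]_t \int[lebI p2 q2]_x (mom De Psi (t, x) * mom De (fun v => derive1 a v * (v * Psi v)) (t, x) -
     mom De (fun v => derive1 a v * Psi v) (t, x) * mom De (fun v => v * Psi v) (t, x)).
    rewrite (box_Rint p1 q1 p2 q2 (W := fun z => mom De Psi z * mom De (fun v => derive1 a v * (v * Psi v)) z -
     mom De (fun v => derive1 a v * Psi v) z * mom De (fun v => v * Psi v) z))//.
    by apply: bmB; apply: bmM; exact: bm_mom.
  apply: (le_trans (ler_norm _)).
  case: hl => -[hs hy].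
  - have D := divcurl_x kq c0 q0 qp m1 m2 SS0 Na0 Nb0 Na1 Nb1 W0 W1 pq1 pq2 l0 lr.
    apply: le_trans D; rewrite le_eqVlt; apply/orP; left; apply/eqP; congr `|_|.
    apply: eq_Rintegral => t _; apply: eq_Rintegral => x _.
    by rewrite /xwedge /xdiff /curry !momD//= hs hy !addr0.
  - have D := divcurl_t kq c0 q0 qp m1 m2 SS0 Na0 Nb0 Na1 Nb1 W0 W1 pq1 pq2 l0 lr.
    apply: le_trans D; rewrite le_eqVlt; apply/orP; left; apply/eqP; congr `|_|.
    apply: eq_Rintegral => t _; apply: eq_Rintegral => x _.
    by rewrite /twedge /tdiff /curry !momD//= hs hy !addr0.
Qed.

(** * General increments *)

Lemma measurable_shift2 (R : realType) (c1 c2 : R) :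
  measurable_fun setT (fun z : R * R => (z.1 + c1, z.2 + c2)).
Proof. by apply: measurable_fun_pair; exact: measurable_funD. Qed.

Lemma bm_incr_sq (R : realType) (u : R * R -> R) (c1 c2 d1 d2 : R) : bm u ->
  bm (fun z : R * R => (u (z.1 + c1, z.2 + c2) - u (z.1 + d1, z.2 + d2)) ^+ 2).
Proof.
move=> bu; have b : bm (fun z : R * R => u (z.1 + c1, z.2 + c2) - u (z.1 + d1, z.2 + d2)).
  by apply: bmB; exact: (bm_comp bu (measurable_shift2 _ _)).
exact: (bmM b b).
Qed.

Lemma bm_incr_sq0 (R : realType) (u : R * R -> R) (c1 c2 : R) : bm u ->
  bm (fun z : R * R => (u (z.1 + c1, z.2 + c2) - u z) ^+ 2).
Proof.
move=> bu; have b := bmB (bm_comp bu (measurable_shift2 c1 c2)) bu.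
exact: (bmM b b).
Qed.

Lemma meas_indM (R : realType) (K : set (R * R)) (F : R * R -> R) : measurable K -> bm F ->
  measurable_fun setT (fun z => (\1_K z * F z)%:E).
Proof. by move=> mK bF; apply/measurable_EFinP; exact: (proj1 (bmM (bm_indic R mK) bF)). Qed.

(** Translation by [(c1, c2)] preserves the integral over the plane and moves [K] into [Q]. *)
Lemma shift_box (R : realType) (u : R * R -> R) (K Q : set (R * R)) (c1 c2 s y b : R) :
  bm u -> measurable K -> measurable Q -> Int (lb2 R) (\1_Q : R * R -> R) ->
  (forall z, K z -> Q (z.1 + c1, z.2 + c2)) ->
  \int[lb2 R]_z (\1_Q z * (u (z.1 + s, z.2 + y) - u z) ^+ 2) <= b ->
  (\int[lb2 R]_z (\1_K z * (u (z.1 + (c1 + s), z.2 + (c2 + y)) - u (z.1 + c1, z.2 + c2)) ^+ 2)%:E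
    <= b%:E)%E.
Proof.
move=> bu mK mQ IQ KQ H.
pose G z := (u (z.1 + s, z.2 + y) - u z) ^+ 2.
have bG : bm G by exact: bm_incr_sq0.
pose F := fun z => (\1_Q z * G z)%:E.
have mF : measurable_fun setT F by exact: meas_indM.
have F0 z : (0 <= F z)%E by rewrite lee_fin mulr_ge0 ?sqr_ge0// indicE.
have I := int_Mbm bG IQ.
have FE : (\int[lb2 R]_z F z)%E = (\int[lb2 R]_z (\1_Q z * G z))%:E.
  by rewrite /Rintegral fineK//; exact: (integrable_fin_num measurableT I).
apply: (@le_trans _ _ (\int[lb2 R]_z F z)%E); last by rewrite FE lee_fin.
rewrite -(lb2_shift_ge0 c1 c2 mF F0).
apply: ge0_le_integral => //.
- by move=> z _; rewrite lee_fin mulr_ge0 ?sqr_ge0// indicE.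
- by apply: meas_indM => //; exact: bm_incr_sq.
- exact: (measurableT_comp mF (measurable_shift2 c1 c2)).
- move=> z _; rewrite /F /G lee_fin/= !addrA; apply: ler_wpM2r; first exact: sqr_ge0.
  rewrite !indicE; have [Kz|Kz] := pselect (K z); last by rewrite memNset.
  by rewrite !mem_set//; exact: KQ.
Qed.

(** For [l < 0] the increment is read backwards from its end point [(c1 + s, c2 + y)], where it has
    length [- l]; the square hides the sign. This is why [K] must be moved into [Q] by both end
    points. *)
Lemma axis_increment_shift (R : realType) (u : R * R -> R) (K Q : set (R * R)) (c1 c2 s y l r h0 B th : R) :
  bm u -> measurable K -> measurable Q -> Int (lb2 R) (\1_Q : R * R -> R) -> 0 <= B -> h0 < r ->
  (forall s y l : R, (s = 0 /\ y = l) \/ (s = l /\ y = 0) -> 0 < l -> l < r ->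
    \int[lb2 R]_z (\1_Q z * (u (z.1 + s, z.2 + y) - u z) ^+ 2) <= B * l `^ th) ->
  (s = 0 /\ y = l) \/ (s = l /\ y = 0) -> `|l| <= h0 ->
  (forall z, K z -> Q (z.1 + c1, z.2 + c2)) ->
  (forall z, K z -> Q (z.1 + (c1 + s), z.2 + (c2 + y))) ->
  (\int[lb2 R]_z (\1_K z * (u (z.1 + (c1 + s), z.2 + (c2 + y)) - u (z.1 + c1, z.2 + c2)) ^+ 2)%:E
    <= (B * `|l| `^ th)%:E)%E.
Proof.
move=> bu mK mQ IQ B0 hr HB hl lh KQ1 KQ2.
have [l0|l0|l0] := ltgtP l 0.
- have hl' : (- s = 0 /\ - y = - l) \/ (- s = - l /\ - y = 0).
    by case: hl => -[-> ->]; [left|right]; rewrite ?oppr0.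
  have l1 : 0 < - l by rewrite oppr_gt0.
  have l2 : - l < r by rewrite -(ltr0_norm l0); exact: le_lt_trans hr.
  have := shift_box bu mK mQ IQ KQ2 (HB _ _ _ hl' l1 l2).
  rewrite (ltr0_norm l0); apply: le_trans; rewrite le_eqVlt; apply/orP; left; apply/eqP.
  by apply: eq_integral => z _; congr (_%:E); rewrite !addrK -sqrrN opprB.
- rewrite gtr0_norm//; apply: (shift_box bu mK mQ IQ KQ1); apply: HB => //.
  by rewrite -(gtr0_norm l0); exact: le_lt_trans hr.
- have [-> ->] : s = 0 /\ y = 0 by case: hl => -[-> ->]; rewrite l0.
  rewrite (eq_integral (cst 0%E)).
    by rewrite integral_cst// mul0e lee_fin mulr_ge0// powR_ge0.
  by move=> z _; rewrite /= !addr0 subrr expr0n/= mulr0.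
Qed.

Lemma norm2_ge (R : realType) (h : R * R) : `|h.1| <= norm2 h /\ `|h.2| <= norm2 h.
Proof.
rewrite /norm2; split; rewrite -sqrtr_sqr ler_wsqrtr//; first by rewrite lerDl sqr_ge0.
by rewrite lerDr sqr_ge0.
Qed.

(** The increment is split at the corner [(s, 0)]; the square of a sum of two terms is at most twice
    the sum of their squares, and each leg contributes [B], whence [4 * B]. *)
Lemma increment_estimate (R : realType) (u : R * R -> R) (K Q : set (R * R)) (r h0 B th : R) :
  bm u -> measurable K -> measurable Q -> Int (lb2 R) (\1_Q : R * R -> R) -> 0 <= B -> h0 < r ->
  0 <= th ->
  (forall s y l : R, (s = 0 /\ y = l) \/ (s = l /\ y = 0) -> 0 < l -> l < r ->
    \int[lb2 R]_z (\1_Q z * (u (z.1 + s, z.2 + y) - u z) ^+ 2) <= B * l `^ th) ->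
  (forall z s y, K z -> `|s| <= h0 -> `|y| <= h0 -> Q (z.1 + s, z.2 + y)) ->
  forall h, norm2 h <= h0 ->
  (\int[lb2 R]_z (\1_K z * (u (z.1 + h.1, z.2 + h.2) - u z) ^+ 2)%:E
    <= (4 * B * norm2 h `^ th)%:E)%E.
Proof.
move=> bu mK mQ IQ B0 hr th0 HB KQ [s y]/= hh.
have [s1 y1] := norm2_ge (s, y); rewrite /= in s1 y1.
have sh := le_trans s1 hh; have yh := le_trans y1 hh.
have h00 : 0 <= h0 := le_trans (normr_ge0 s) sh.
have n0 : `|0 : R| <= h0 by rewrite normr0.
have N0 : 0 <= norm2 (s, y) := le_trans (normr_ge0 s) s1.
have T1 : (\int[lb2 R]_z (\1_K z * (u (z.1 + (0 + s), z.2 + (0 + 0)) - u (z.1 + 0, z.2 + 0)) ^+ 2)%:E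
    <= (B * `|s| `^ th)%:E)%E.
  apply: (axis_increment_shift bu mK mQ IQ B0 hr HB _ sh) => [|z Kz|z Kz]; first by right.
    exact: KQ.
  by rewrite !add0r; exact: KQ.
have T2 : (\int[lb2 R]_z (\1_K z * (u (z.1 + (s + 0), z.2 + (0 + y)) - u (z.1 + s, z.2 + 0)) ^+ 2)%:E
    <= (B * `|y| `^ th)%:E)%E.
  apply: (axis_increment_shift bu mK mQ IQ B0 hr HB _ yh) => [|z Kz|z Kz]; first by left.
    exact: KQ.
  by rewrite addr0 add0r; exact: KQ.
pose F1 z := \1_K z * (u (z.1 + (0 + s), z.2 + (0 + 0)) - u (z.1 + 0, z.2 + 0)) ^+ 2.
pose F2 z := \1_K z * (u (z.1 + (s + 0), z.2 + (0 + y)) - u (z.1 + s, z.2 + 0)) ^+ 2.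
have m1 : measurable_fun setT (EFin \o F1) by apply: meas_indM => //; exact: bm_incr_sq.
have m2 : measurable_fun setT (EFin \o F2) by apply: meas_indM => //; exact: bm_incr_sq.
have F10 z : (0 <= (F1 z)%:E)%E by rewrite lee_fin mulr_ge0 ?sqr_ge0// indicE.
have F20 z : (0 <= (F2 z)%:E)%E by rewrite lee_fin mulr_ge0 ?sqr_ge0// indicE.
apply: (@le_trans _ _ (2%:E * \int[lb2 R]_z (F1 z)%:E + 2%:E * \int[lb2 R]_z (F2 z)%:E)%E).
  rewrite -!ge0_integralZl//.
  rewrite -ge0_integralD//; first last.
  - by apply: emeasurable_funM => //; exact: m2.
  - by move=> z _; exact: mule_ge0.
  - by apply: emeasurable_funM => //; exact: m1.
  - by move=> z _; exact: mule_ge0.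
  apply: ge0_le_integral => //.
  - by move=> z _; rewrite lee_fin mulr_ge0 ?sqr_ge0// indicE.
  - by apply: meas_indM => //; exact: bm_incr_sq0.
  - by apply: emeasurable_funD; apply: emeasurable_funM.
  - move=> z _; rewrite -!EFinM -EFinD lee_fin /F1 /F2 !addr0 !add0r.
    rewrite (_ : (z.1, z.2) = z); last by case: z.
    have : (0 <= (\1_K z : R)) by rewrite indicE.
    move: (\1_K z : R) (u _) (u _) (u _) => k x1 x2 x3 k0.
    have : 0 <= k * ((x3 - x1) - (x1 - x2)) ^+ 2 by rewrite mulr_ge0 ?sqr_ge0.
    by clear; nra.
apply: (@le_trans _ _ (2%:E * (B * `|s| `^ th)%:E + 2%:E * (B * `|y| `^ th)%:E)%E).
  by apply: leeD; apply: lee_wpmul2l.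
rewrite -!EFinM -EFinD lee_fin.
have p1 : `|s| `^ th <= norm2 (s, y) `^ th by apply: ge0_ler_powR; rewrite ?nnegrE.
have p2 : `|y| `^ th <= norm2 (s, y) `^ th by apply: ge0_ler_powR; rewrite ?nnegrE.
have := ler_wpM2l B0 p1; have := ler_wpM2l B0 p2; clear; lra.
Qed.

(* The library does not make compact sets of the plane measurable for the product sigma-algebra;
   this replaces them by rectangles. *)
Lemma ge0_integral_subset d (T : measurableType d) (R : realType) (m : {measure set T -> \bar R})
  (A B : set T) (f : T -> \bar R) : A `<=` B -> (forall x, 0 <= f x)%E ->
  (\int[m]_(x in A) f x <= \int[m]_(x in B) f x)%E.
Proof.
move=> AB f0; rewrite !ge0_integralE//; apply: ereal_sup_le => _ [h hf <-]; exists h => // x.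
apply: (le_trans (hf x)); rewrite !patchE; case: ifPn => [|_]; last by case: ifPn.
by rewrite inE => /AB xB; rewrite mem_set.
Qed.

(** * From the truncated function back to the original one *)

Lemma lb2_ae_shift (R : realType) (P : R * R -> Prop) (c1 c2 : R) :
  {ae lb2 R, forall z, P z} -> {ae lb2 R, forall z, P (z.1 + c1, z.2 + c2)}.
Proof.
move=> [A [mA A0 PA]]; exists ((fun z => (z.1 + c1, z.2 + c2)) @^-1` A).
have ms := measurable_shift2 c1 c2.
have mA' : measurable ((fun z : R * R => (z.1 + c1, z.2 + c2)) @^-1` A).
  by rewrite -[X in measurable X]setTI; exact: ms.
split => //; last by move=> z; exact: PA.
have mI : measurable_fun setT (EFin \o (\1_A : R * R -> R)) by apply/measurable_EFinP.
have I0 (z : R * R) : (0 <= (EFin \o (\1_A : R * R -> R)) z)%E by rewrite lee_fin indicE.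
have H := lb2_shift_ge0 c1 c2 mI I0.
have E1 := integral_indic (lb2 R) measurableT mA.
have E2 := integral_indic (lb2 R) measurableT mA'.
rewrite setIT in E1; rewrite setIT in E2.
exact: (etrans (esym E2) (etrans H (etrans E1 A0))).
Qed.

(** Tonelli for [|F - G|] restricted to [D]: if the double integral vanishes, so does almost every
    inner integral. *)
Lemma ae_section d1 d2 (T1 : measurableType d1) (T2 : measurableType d2) (R : realType)
  (m1 : {sigma_finite_measure set T1 -> \bar R}) (m2 : {sigma_finite_measure set T2 -> \bar R})
  (F G : T1 * T2 -> R) (D : set T1) : measurable D ->
  measurable_fun setT F -> measurable_fun setT G ->
  {ae prodm m1 m2, forall p, D p.1 -> F p = G p} ->
  {ae m1, forall x, D x -> {ae m2, forall y, F (x, y) = G (x, y)}}.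
Proof.
move=> mD mF mG FG.
pose H p := \1_D p.1 * (F p - G p).
have mH : measurable_fun setT H.
  apply: measurable_funM; last exact: measurable_funB.
  exact: (proj1 (bm_comp (bm_indic R mD) measurable_fst)).
have mH' : measurable_fun setT (EFin \o H) by exact/measurable_EFinP.
have mHn : measurable_fun setT (fun p => `|(EFin \o H) p|)%E by exact: measurableT_comp.
have := (ae_eq_integral_abs (prodm m1 m2) measurableT mH').2.
have hz : ae_eq (prodm m1 m2) setT (EFin \o H) (cst 0%E).
  apply: filterS FG => p h _; rewrite /H/= indicE.
  have [Dp|Dp] := pselect (D p.1); last by rewrite memNset// mul0r.
  by rewrite h// subrr mulr0.
move=> /(_ hz); rewrite Tonelli1//.
have mI : measurable_fun setT (fun x => \int[m2]_y `|(EFin \o H) (x, y)|)%E.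
  by apply: (measurable_fun_fubini_tonelli_F (m2 := m2)) mHn _ => p.
move=> I0; have := (ae_eq_integral_abs m1 measurableT mI).1.
rewrite (eq_integral (fun x => \int[m2]_y `|(EFin \o H) (x, y)|)%E); last first.
  by move=> x _; rewrite gee0_abs//; exact: integral_ge0.
move=> /(_ I0); apply: filterS => x /= /(_ I) hx Dx.
have mHx : measurable_fun setT (fun y => (EFin \o H) (x, y)).
  exact: (measurableT_comp mH' (measurable_pair1 x)).
have := (ae_eq_integral_abs m2 measurableT mHx).1 hx.
apply: filterS => y /(_ I); rewrite /H/= indicE mem_set// mul1r => -[] /eqP.
by rewrite subr_eq0 => /eqP.
Qed.

(** The moments of a function and of its truncation agree for almost every [(t, x)] only, which is
    enough under an integral. *)
Lemma mom_ae (R : realType) (F G : R * R * R -> R) (D : set (R * R)) (psi : R -> R) :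
  measurable D -> measurable_fun setT F -> measurable_fun setT G -> measurable_fun setT psi ->
  {ae lb3 R, forall p, D p.1 -> F p = G p} ->
  {ae lb2 R, forall z, D z -> mom F psi z = mom G psi z}.
Proof.
move=> mD mF mG mp FG; have := ae_section mD mF mG FG.
apply: filterS => z h Dz; rewrite /mom /Rintegral; congr fine.
have mm (E : R * R * R -> R) : measurable_fun setT E ->
    measurable_fun setT (fun v => (E (z, v) * psi v)%:E).
  move=> mE; apply/measurable_EFinP; apply: measurable_funM => //.
  exact: (measurableT_comp mE (measurable_pair1 z)).
apply: ae_eq_integral => //; [exact: mm|exact: mm|].
by apply: filterS (h Dz) => v e _; rewrite e.
Qed.

(** On a nonempty [K] the least time [t0] is attained, hence positive. *)
Lemma compact_box (R : realType) (K : set (R * R)) : compact K -> K `<=` Omega2 R ->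
  exists t0 T : R, [/\ 0 < t0, 0 < T & K `<=` `[t0, T] `*` `[- T, T]].
Proof.
move=> cK KO; have [->|K0] := eqVneq K set0; first by exists 1, 1; split => // z.
have {}K0 : K !=set0 by exact/set0P.
have c1 : continuous (fun z : R * R => z.1) by move=> z; exact: cvg_fst.
have c2 : continuous (fun z : R * R => z.2) by move=> z; exact: cvg_snd.
have [a /set_mem Ka Ha] := compact_EVT_min K0 cK (continuous_subspaceT c1).
have [b _ Hb] := compact_EVT_max K0 cK (continuous_subspaceT c1).
have [c _ Hc] := compact_EVT_min K0 cK (continuous_subspaceT c2).
have [d _ Hd] := compact_EVT_max K0 cK (continuous_subspaceT c2).
exists a.1, (1 + `|b.1| + `|c.2| + `|d.2|).
have n1 := normr_ge0 b.1; have n2 := normr_ge0 c.2; have n3 := normr_ge0 d.2.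
split; [exact: (KO a)|by lra|].
move=> z Kz; have zK := mem_set Kz.
have := Ha _ zK; have := Hb _ zK; have := Hc _ zK; have := Hd _ zK.
have := ler_norm b.1; have := ler_norm d.2; have := ler_norm (- c.2); rewrite normrN.
clear -n1 n2 n3 => *; split; rewrite /= in_itv/=; apply/andP; split; lra.
Qed.

Lemma fbox_ae (R : realType) (f : R * R * R -> R) (C P1 Q1 P2 Q2 : R) : 0 < P1 ->
  {ae leb3 R, forall p, Omega3 R p -> `|f p| <= C} ->
  {ae lb3 R, forall p, (`[P1, Q1] `*` `[P2, Q2]) p.1 ->
    patch (cst 0) (Omega3 R) f p = fbox C P1 Q1 P2 Q2 f p}.
Proof.
move=> P0 /leb3_ae; apply: filterS => -[[t x] v] h [/=]; rewrite !in_itv/= => ht hx.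
have O : Omega3 R (t, x, v) by move/andP: ht => [ht _]; exact: lt_le_trans P0 ht.
by rewrite patchE mem_set// fbox_in// clamp_id//; exact: h.
Qed.

(** [A] is the function as given, [At] is measurable on the whole plane and equals it on [Kb], and
    [U] is bounded and equals [At] almost everywhere there. A bound for [U] on [Kb] thus passes to
    [A] on [K]. *)
Lemma transfer_sq (R : realType) (K Kb : set (R * R)) (A At U : R * R -> R) :
  K `<=` Kb -> measurable Kb -> (forall z, Kb z -> A z = At z) ->
  measurable_fun setT At -> bm U -> {ae lb2 R, forall z, Kb z -> At z = U z} ->
  (\int[leb2 R]_(z in K) (`|A z| `^ 2)%:E <= \int[lb2 R]_z (\1_Kb z * U z ^+ 2)%:E)%E.
Proof.
move=> KK mK AE mAt bU AU.
have sq (x : R) : `|x| `^ 2 = x ^+ 2 by rewrite powR_mulrn// real_normK// num_real.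
have mA2 : measurable_fun setT (fun z => (At z ^+ 2)%:E) by apply/measurable_EFinP; exact: measurable_funX.
have mU2 : measurable_fun setT (fun z => (U z ^+ 2)%:E).
  by apply/measurable_EFinP; apply: measurable_funX; exact: (proj1 bU).
apply: (@le_trans _ _ (\int[leb2 R]_(z in Kb) (`|A z| `^ 2)%:E)%E).
  by apply: ge0_integral_subset => // z; rewrite lee_fin powR_ge0.
have -> : (\int[leb2 R]_(z in Kb) (`|A z| `^ 2)%:E = \int[leb2 R]_(z in Kb) (At z ^+ 2)%:E)%E.
  by apply: eq_integral => z /set_mem Kz; rewrite AE// sq.
rewrite leb2_integral_ge0//; last by move=> z; rewrite lee_fin sqr_ge0.
rewrite (ae_eq_integral (fun z => (U z ^+ 2)%:E))//.
- rewrite integral_mkcond le_eqVlt; apply/orP; left; apply/eqP; apply: eq_integral => z _.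
  rewrite patchE indicE; case: ifPn => h; first by rewrite mul1r.
  by rewrite mul0r.
- exact: measurable_funTS.
- exact: measurable_funTS.
- by apply: filterS AU => z h Kz; rewrite h.
Qed.

Lemma test_fun1_ker (R : realType) (psi : R -> R) : test_fun1 psi -> exists M, ker (- M) M psi.
Proof.
move=> [Cp [Kp [cKp Kp0]]]; have [N [_ HN]] := compact_bounded cKp.
exists (N + 1); split; first exact/CinfP.
move=> v hv; apply: Kp0 => Kv.
have := HN _ (ltr_pwDr ltr01 (lexx N)) v Kv.
by rewrite /= ler_norml => /andP[h1 h2]; case: hv; lra.
Qed.

Lemma box_shift_in (R : realType) (t T s y : R) (z : R * R) : 0 < t ->
  (`[t, T] `*` `[- T, T]) z -> `|s| <= t / 8 -> `|y| <= t / 8 ->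
  (`[t / 2, T + t] `*` `[- T - t, T + t]) (z.1 + s, z.2 + y).
Proof.
move=> t0 []; rewrite /= !in_itv/= !ler_norml => /andP[? ?] /andP[? ?] /andP[? ?] /andP[? ?].
by split; apply/andP; split; lra.
Qed.

Lemma box_widen (R : realType) (p1 q1 p2 q2 r : R) : 0 <= r ->
  `[p1, q1] `*` `[p2, q2] `<=` `[p1 - r, q1 + r] `*` `[p2 - r, q2 + r].
Proof.
move=> r0 z []; rewrite /= !in_itv/= => /andP[? ?] /andP[? ?].
by split; apply/andP; split; lra.
Qed.

Lemma Rint_eq0 d (T : measurableType d) (R : realType) (m : {measure set T -> \bar R})
  (f : T -> R) : (forall x, f x = 0) -> \int[m]_x f x = 0.
Proof. by move=> f0; rewrite (_ : f = cst 0) ?Rintegral_cst ?mul0r//; exact/funext. Qed.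

Unset Implicit Arguments.

Theorem theorem2 (R : realType) (a : R -> R) (beta : R) (gamma : nat)
    (mu1 mu2 : {measure set (R * R * R) -> \bar R}) (f : R * R * R -> R) :
  (forall x : R, derivable a x 1) -> continuous (derive1 a) ->
  1 <= beta ->
  (forall M : R, 0 < M -> exists alpha : R, 0 < alpha /\
     forall v w : R, - M <= w -> w < v -> v <= M ->
       alpha * (v - w) `^ beta <= derive1 a v - derive1 a w) ->
  radon3 mu1 -> radon3 mu2 ->
  Linfty3 f ->
  kinetic_eq a gamma mu1 mu2 f ->
  (forall y s : R, 0 <= s ->
     {ae leb4 R, forall q : R * R * R * R, 0 < q.1.1.1 ->
        0 <= (f (q.1.1.1 + s, q.1.1.2 + y, q.1.2) - f (q.1.1.1, q.1.1.2, q.1.2))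
             * (f (q.1.1.1 + s, q.1.1.2 + y, q.2) - f (q.1.1.1, q.1.1.2, q.2))}) ->
  forall psi : R -> R, test_fun1 psi ->
    besov_loc (1 / (4 + 2 * beta)) 2 (Omega2 R)
      (fun z : R * R => Rintegral (leb R) setT (fun v => f (z.1, z.2, v) * psi v)).
Proof.
move=> _ ca be1 Ha rad1 rad2 [mf [C1 fC1]] kin sgn psi tpsi.
have [M kpsi] := test_fun1_ker tpsi.
have bpsi := ker_bm kpsi; have Ipsi := ker_int kpsi; have mpsi := proj1 bpsi.
set g := fun z : R * R => _.
(* [Linfty3] says nothing about the sign of its constant, while truncation requires [0 <= C]. *)
pose C := `|C1|; have C0 : 0 <= C by exact: normr_ge0.
have fC : {ae leb3 R, forall p, Omega3 R p -> `|f p| <= C}.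
  move: fC1 => [A [mA A0 PA]]; exists A; split=> // p np; apply: PA => /= h; apply: np => /= O.
  by apply: (le_trans (h O)); exact: ler_norm.
(* Extension by 0 to [t <= 0] is measurable on the whole space and has the same moments over
   [Omega2 R]. *)
pose F : R * R * R -> R := patch (cst 0) (Omega3 R) f.
have mF : measurable_fun setT F by apply: (measurable_restrictT _ (@measurable_Omega3 R)).1.
pose gt := mom F psi.
have mFp : measurable_fun setT (fun p : R * R * R => F p * psi p.2).
  by apply: measurable_funM => //; exact: (measurableT_comp mpsi measurable_snd).
have mgt : measurable_fun setT gt := meas_Rint (lb R) mFp.
have gE z : Omega2 R z -> g z = gt z.
  move=> Oz; rewrite /g /gt /mom -leb_Rint; last exact: (measurableT_comp mFp (measurable_pair1 z)).
  apply: eq_Rintegral => v _; rewrite /F patchE mem_set//.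
  by case: z Oz.
(* For one compact set this collects a rectangle [Kb], a bounded [u] that agrees with the moment
   almost everywhere near [Kb], and the increment bound for [u]; local integrability and the Besov
   bound both follow from it. *)
have prep K : compact K -> K `<=` Omega2 R -> exists (Kb : set (R * R)) (u : R * R -> R) (h0 B : R),
  [/\ measurable Kb, K `<=` Kb, Int (lb2 R) (\1_Kb : R * R -> R), bm u & 0 < h0] /\ 0 <= B /\
  forall h : R * R, norm2 h <= h0 -> [/\ forall z, Kb z -> Omega2 R (z.1 + h.1, z.2 + h.2),
    {ae lb2 R, forall z, Kb z -> gt (z.1 + h.1, z.2 + h.2) = u (z.1 + h.1, z.2 + h.2)} &
    (\int[lb2 R]_z (\1_Kb z * (u (z.1 + h.1, z.2 + h.2) - u z) ^+ 2)%:E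
      <= (B * norm2 h `^ (beta + 2)^-1)%:E)%E].
  move=> cK KO; have [t0 [T [t00 T0 KT]]] := compact_box cK KO.
  (* [Q] begins at time [t0 / 2], so its enlargement by [r = t0 / 4] begins at [t0 / 4 > 0]; shifts
     of size at most [h0 = t0 / 8 < r] move [Kb] inside [Q]. *)
  pose p1 := t0 / 2; pose q1 := T + t0; pose p2 := - T - t0; pose r := t0 / 4; pose h0 := t0 / 8.
  have pq1 : p1 < q1 by rewrite /p1 /q1; clear -t00 T0; lra.
  have pq2 : p2 < q1 by rewrite /p2 /q1; clear -t00 T0; lra.
  have pr : 0 < p1 - r by rewrite /p1 /r; clear -t00; lra.
  pose G := fbox C (p1 - r) (q1 + r) (p2 - r) (q1 + r) f.
  pose Kb : set (R * R) := `[t0, T] `*` `[- T, T].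
  pose Q : set (R * R) := `[p1, q1] `*` `[p2, q1].
  pose D : set (R * R) := `[p1 - r, q1 + r] `*` `[p2 - r, q1 + r].
  have bG : bm G by exact: bm_fbox.
  have bu : bm (mom G psi) by exact: bm_mom.
  have mK : measurable Kb by apply: measurableX; exact: measurable_itv.
  have mQ : measurable Q by apply: measurableX; exact: measurable_itv.
  have mD : measurable D by apply: measurableX; exact: measurable_itv.
  have KQ z s y : Kb z -> `|s| <= h0 -> `|y| <= h0 -> Q (z.1 + s, z.2 + y).
    exact: box_shift_in.
  have r0 : 0 <= r by rewrite divr_ge0// ltW.
  have QD : Q `<=` D by exact: box_widen.
  have QO : Q `<=` Omega2 R.
    rewrite /Q /p1 => z []; rewrite /= !in_itv/= => /andP[h _] _.
    by apply: lt_le_trans h; rewrite divr_gt0.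
  have [B [B0 HB]] : exists B : R, 0 <= B /\
    forall s y l : R, (s = 0 /\ y = l) \/ (s = l /\ y = 0) -> 0 < l -> l < r ->
    \int[lb2 R]_z (\1_Q z * (mom G psi (z.1 + s, z.2 + y) - mom G psi z) ^+ 2)
      <= B * l `^ (beta + 2)^-1.
    (* The weight and the kernel are built around a point where [psi] is nonzero; if [psi] vanishes
       identically, so do the moments. *)
    have [[v0 pv0]|p0] := pselect (exists v0, psi v0 != 0).
      exact: (axis_increment_estimate ca be1 Ha rad1 rad2 mf C0 fC kin sgn kpsi pv0 pq1 pq2 pr).
    have m0 z : mom G psi z = 0.
      apply: Rint_eq0 => v; have [->|pv] := eqVneq (psi v) 0; first by rewrite mulr0.
      by case: p0; exists v.
    exists 0; split=> // s y l _ _ _; rewrite mul0r Rint_eq0// => z.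
    by rewrite !m0 subrr expr0n mulr0.
  have ae0 := mom_ae mD mF (proj1 bG) mpsi (fbox_ae (q1 + r) (p2 - r) (q1 + r) pr fC).
  exists Kb, (mom G psi), h0, (4 * B); split; [split => //|split].
  - exact: int_box.
  - by rewrite divr_gt0.
  - exact: mulr_ge0.
  move=> h hh; have [n1 n2] := norm2_ge h.
  have KQh z : Kb z -> Q (z.1 + h.1, z.2 + h.2).
    by move=> Kz; apply: KQ => //; exact: le_trans hh.
  split.
  - by move=> z Kz; apply: QO; exact: KQh.
  - by apply: filterS (lb2_ae_shift h.1 h.2 ae0) => z e Kz; apply: e; apply: QD; exact: KQh.
  - apply: (increment_estimate bu mK mQ _ B0 _ _ HB KQ hh); first exact: int_box.
      by rewrite /h0 /r; clear -t00; lra.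
    by rewrite invr_ge0; apply: addr_ge0 => //; exact: le_trans be1.
have n20 : norm2 (0, 0) = 0 :> R by rewrite /norm2/= expr0n addr0 sqrtr0.
have KO0 (Kb : set (R * R)) (u : R * R -> R) :
    (forall z, Kb z -> Omega2 R (z.1 + 0, z.2 + 0)) ->
    {ae lb2 R, forall z, Kb z -> gt (z.1 + 0, z.2 + 0) = u (z.1 + 0, z.2 + 0)} ->
    (forall z, Kb z -> Omega2 R z) /\ {ae lb2 R, forall z, Kb z -> gt z = u z}.
  move=> h1 h2; split; first by move=> z /h1; rewrite !addr0; case: z.
  by apply: filterS h2 => z h Kz; have := h Kz; rewrite !addr0; case: z {h Kz}.
have mO2 : measurable (Omega2 R : set (R * R)).
  rewrite [X in measurable X](_ : _ = (fun p : R * R => p.1) @^-1` `]0, +oo[); last first.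
    by apply/seteqP; split => p /=; rewrite in_itv/= andbT.
  by rewrite -[X in measurable X]setTI; exact: measurable_fst.
split.
- apply: (eq_measurable_fun gt); first by move=> z /set_mem Oz; rewrite gE.
  exact: measurable_funTS.
- move=> K cK KO; have [Kb [u [h0 [B [[mK KK IK bu h00] [B0 H]]]]]] := prep K cK KO.
  (* The zero increment says that [u] agrees with the moment almost everywhere on [Kb] itself. *)
  have [|H1 H2 _] := H (0, 0); first by rewrite n20 ltW.
  have [{}H1 {}H2] := KO0 _ _ H1 H2.
  apply: (le_lt_trans (transfer_sq KK mK (fun z Kz => gE z (H1 z Kz)) mgt bu H2)).
  have I := int_Mbm (bmM bu bu) IK.
  by rewrite -ge0_fin_numE; [exact: (integrable_fin_num measurableT I)|
    apply: integral_ge0 => z _; rewrite lee_fin mulr_ge0 ?sqr_ge0// indicE].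
- move=> K cK KO; have [Kb [u [h0 [B [[mK KK IK bu h00] [B0 H]]]]]] := prep K cK KO.
  have [|H1 H2 _] := H (0, 0); first by rewrite n20 ltW.
  have [{}H1 {}H2] := KO0 _ _ H1 H2.
  (* [besov_loc] asks for a positive constant, while [B] may be 0. *)
  exists (B + 1), h0; split => //; first by rewrite ltr_wpDl.
  move=> h hh; have [H3 H4 H5] := H h hh.
  have mgth : measurable_fun setT (fun z : R * R => gt (z.1 + h.1, z.2 + h.2) - gt z).
    by apply: measurable_funB => //; exact: (measurableT_comp mgt (measurable_shift2 _ _)).
  have bU : bm (fun z : R * R => u (z.1 + h.1, z.2 + h.2) - u z).
    by apply: bmB => //; exact: (bm_comp bu (measurable_shift2 _ _)).
  apply: (le_trans (transfer_sq (A := fun z => g (z.1 + h.1, z.2 + h.2) - g z) KK mK _ mgth bU _)).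
  + by move=> z Kz; rewrite (gE _ (H1 _ Kz)) (gE _ (H3 _ Kz)).
  + by apply: filterS2 H2 H4 => z e1 e2 Kz; rewrite e1// e2.
  apply: (le_trans H5); rewrite lee_fin.
  (* The exponent [s p] with [p = 2] is the exponent of the squared increments. *)
  have -> : 1 / (4 + 2 * beta) * 2 = (beta + 2)^-1.
    by field; clear -be1; apply/andP; split; apply: lt0r_neq0; lra.
  by apply: ler_wpM2r; [exact: powR_ge0|rewrite lerDl].
Qed.
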